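(* Let $n\ge1$ and let $(P_t)_{t\ge0}$ be a diffusion Markov semigroup with generator $L$. Then the following assertions are equivalent: (i) the semigroup $(P_t)_{t\ge0}$ satisfies the $CD(0,n)$ criterion; (ii) the semigroup $(P_t)_{t\ge0}$ satisfies the local logarithmic Sobolev inequality $$\mathrm{Ent}_{P_t}(f)\le t\,LP_tf+\frac n2\,P_tf\,\log\left(1-\frac{2t}{n}\,\frac{P_t\big(fL(\log f)\big)}{P_tf}\right)$$ for all positive functions $f\in\mathcal A$ and all $t\ge0$; (iii) for all $1<q_1<q_2$ and all $u_1,u_2>0$ such that $\tau:=u_1q_1-u_2q_2>0$, $$P_{u_2}\big((P_{\tau}f)^{q_2}\big)^{1/q_2}\le P_{u_1}(f^{q_1})^{1/q_1}\,M^{n/2}$$ for all positive functions $f\in\mathcal A$, where $$M=\left(\frac{q_1-1}{u_2}\right)^{1-1/q_1}\left(\frac{q_2-1}{u_1}\right)^{1/q_2-1}\left(\frac{u_1q_1-u_2q_2}{q_2-q_1}\right)^{1/q_2-1/q_1};$$ (iv) for all $q_1,q_2$ with either $0<q_2<q_1<1$ or $q_2<q_1<0$, and all $u_1,u_2>0$ such that $\tau:=u_1q_1-u_2q_2>0$, $$P_{u_1}(f^{q_1})^{1/q_1}\le P_{u_2}\big((P_{\tau}f)^{q_2}\big)^{1/q_2}\,N^{n/2}$$ for all positive functions $f\in\mathcal A$, where $$N=\left(\frac{1-q_1}{u_2}\right)^{1/q_1-1}\left(\frac{1-q_2}{u_1}\right)^{1-1/q_2}\left(\frac{u_1q_1-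u_2q_2}{q_1-q_2}\right)^{1/q_1-1/q_2}.$$
   Context: A Markov semigroup $(P_t)_{t\ge0}$ is a family of operators acting on bounded measurable functions on a measurable space $(E,\mathcal E)$, preserving positivity, with $P_t(1)=1$ and $P_t\circ P_s=P_{t+s}$. There is a reference measure $\mu$ (in general chosen invariant for the semigroup) such that $P_tf\to f$ in $L^2(\mu)$ as $t\to0$. The infinitesimal generator is $L=\partial_tP_t|_{t=0}$, so that $\partial_tP_tf=LP_tf$. One assumes the existence of a nice dense algebra $\mathcal A$ of functions on $E$ in the domain of $L$, on which the following operations are defined. The carré du champ is $\Gamma(f,g)=\frac12\big(L(fg)-fLg-gLf\big)$, with $\Gamma(f)=\Gamma(f,f)$, and $\Gamma_2(f)=\frac12\big(L\Gamma(f)-2\Gamma(f,Lf)\big)$, for $f,g\in\mathcal A$. The semigroup (or $L$) is a diffusion if $L\phi(f)=\phi'(f)Lf+\phi''(f)\Gamma(f)$ for all $f\in\mathcal A$ and $\phi\in\mathcal C^\infty(\mathbb R)$. The semigroup satisfies the curvature-dimension criterion $CD(0,n)$ if $\Gamma_2(f)\ge\frac1n(Lf)^2$ for all $f\in\mathcal A$. For positive $f$, $\mathrm{Ent}_{P_t}(f)=P_t(f\log f)-P_tf\,\log P_tf$. Inequalities between functions on $E$ are pointwise, and $P_u(g)^{1/q}$ means $(P_u(g))^{1/q}$. *)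

(* Defs.v *)
From mathcomp Require Import all_boot all_order all_algebra.
From mathcomp Require Import all_classical all_reals all_analysis.

Set Implicit Arguments.
Unset Strict Implicit.
Unset Printing Implicit Defensive.

Import Order.TTheory GRing.Theory Num.Theory.
Import numFieldNormedType.Exports.

Local Open Scope classical_set_scope.
Local Open Scope ring_scope.

Definition bounded_measurable d (E : measurableType d) (R : realType)
    (f : E -> R) : Prop :=
  measurable_fun setT f /\ exists C : R, forall x, `|f x| <= C.

Definition square_integrable d (E : measurableType d) (R : realType)
    (mu : {measure set E -> \bar R}) (f : E -> R) : Prop :=
  measurable_fun setT f /\ (\int[mu]_x ((f x) ^+ 2)%:E < +oo)%E.

(* [P t] is only meaningful for [0 <= t] and on bounded measurable functions;
   its values elsewhere are irrelevant. *)
Record markov_semigroup d (E : measurableType d) (R : realType)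
    (mu : {measure set E -> \bar R}) (P : R -> (E -> R) -> (E -> R)) : Prop := {
  markov_stable : forall t f, 0 <= t ->
    bounded_measurable f -> bounded_measurable (P t f);
  markov_linear : forall t (a : R) f g, 0 <= t ->
    bounded_measurable f -> bounded_measurable g ->
    forall x, P t (fun y => a * f y + g y) x = a * P t f x + P t g x;
  markov_ge0 : forall t f, 0 <= t -> bounded_measurable f ->
    (forall x, 0 <= f x) -> forall x, 0 <= P t f x;
  markov_cst1 : forall t, 0 <= t -> forall x, P t (fun=> 1) x = 1;
  markov_add : forall s t f, 0 <= s -> 0 <= t -> bounded_measurable f ->
    forall x, P (t + s) f x = P t (P s f) x;
  markov_0 : forall f, bounded_measurable f -> forall x, P 0 f x = f x;
  markov_L2_continuous : forall f,
    bounded_measurable f -> square_integrable mu f ->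
    (\int[mu]_x ((P t f x - f x) ^+ 2)%:E)%E @[t --> 0^'+] --> (0 : \bar R)%E
}.

Definition generator d (E : measurableType d) (R : realType)
    (P : R -> (E -> R) -> (E -> R)) (f : E -> R) : E -> R :=
  fun x => lim (h^-1 * (P h f x - f x) @[h --> 0^'+]).

(* The semigroup acts on bounded functions: the limit defining [generator] is
   required in the supremum norm, so that [generator P f] is the derivative at
   every point of [E]. *)
Definition generator_domain d (E : measurableType d) (R : realType)
    (P : R -> (E -> R) -> (E -> R)) (f : E -> R) : Prop :=
  bounded_measurable f /\
  forall eps : R, 0 < eps -> \forall h \near 0^'+,
    forall x, `|h^-1 * (P h f x - f x) - generator P f x| <= eps.

Definition carre_du_champ d (E : measurableType d) (R : realType)
    (P : R -> (E -> R) -> (E -> R)) (f g : E -> R) : E -> R :=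
  fun x => 2^-1 * (generator P (fun y => f y * g y) x
                   - f x * generator P g x - g x * generator P f x).

Definition gamma2 d (E : measurableType d) (R : realType)
    (P : R -> (E -> R) -> (E -> R)) (f : E -> R) : E -> R :=
  fun x => 2^-1 * (generator P (carre_du_champ P f f) x
                   - 2 * carre_du_champ P f (generator P f) x).

Definition smooth (R : realType) (phi : R -> R) : Prop :=
  forall (k : nat) (x : R), derivable (derive1n k phi) x 1.

(* Stability under [generator P] makes the iterated operators in [gamma2]
   meaningful. *)
Record nice_dense_algebra d (E : measurableType d) (R : realType)
    (mu : {measure set E -> \bar R}) (P : R -> (E -> R) -> (E -> R))
    (A : set (E -> R)) : Prop := {
  alg_domain : forall f, A f -> generator_domain P f;
  alg_add : forall f g, A f -> A g -> A (fun x => f x + g x);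
  alg_scale : forall (a : R) f, A f -> A (fun x => a * f x);
  alg_mul : forall f g, A f -> A g -> A (fun x => f x * g x);
  alg_smooth : forall (phi : R -> R) f, smooth phi -> A f -> A (phi \o f);
  alg_generator : forall f, A f -> A (generator P f);
  alg_semigroup : forall t f, 0 <= t -> A f -> A (P t f);
  alg_dense : forall f, square_integrable mu f ->
    forall eps : R, 0 < eps -> exists2 g, A g &
      (\int[mu]_x ((f x - g x) ^+ 2)%:E < eps%:E)%E
}.

Definition diffusion d (E : measurableType d) (R : realType)
    (P : R -> (E -> R) -> (E -> R)) (A : set (E -> R)) : Prop :=
  forall (phi : R -> R) f, smooth phi -> A f -> forall x,
    generator P (phi \o f) x =
      derive1 phi (f x) * generator P f x
      + derive1n 2 phi (f x) * carre_du_champ P f f x.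

Definition CD0 d (E : measurableType d) (R : realType)
    (P : R -> (E -> R) -> (E -> R)) (A : set (E -> R)) (n : R) : Prop :=
  forall f, A f -> forall x, n^-1 * (generator P f x) ^+ 2 <= gamma2 P f x.

Definition entropy d (E : measurableType d) (R : realType)
    (P : R -> (E -> R) -> (E -> R)) (t : R) (f : E -> R) : E -> R :=
  fun x => P t (fun y => f y * ln (f y)) x - P t f x * ln (P t f x).

Definition log_sobolev_arg d (E : measurableType d) (R : realType)
    (P : R -> (E -> R) -> (E -> R)) (n t : R) (f : E -> R) : E -> R :=
  fun x => 1 - 2 * t / n *
    (P t (fun y => f y * generator P (fun z => ln (f z)) y) x / P t f x).

(* [A (fun y => ln (f y))] says that the generator applies to [log f].
   Since [ln] is 0 outside the positive reals, the positivity of its argument,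
   implicit in the usual notation, is part of the assertion. *)
Definition local_log_sobolev d (E : measurableType d) (R : realType)
    (P : R -> (E -> R) -> (E -> R)) (A : set (E -> R)) (n : R) : Prop :=
  forall f t, A f -> (forall x, 0 < f x) -> A (fun y => ln (f y)) -> 0 <= t ->
  forall x,
    0 < log_sobolev_arg P n t f x /\
    entropy P t f x <= t * generator P (P t f) x
                       + n / 2 * P t f x * ln (log_sobolev_arg P n t f x).

Definition hypercontractivity_cst (R : realType) (q1 q2 u1 u2 : R) : R :=
  ((q1 - 1) / u2) `^ (1 - q1^-1) * ((q2 - 1) / u1) `^ (q2^-1 - 1)
  * ((u1 * q1 - u2 * q2) / (q2 - q1)) `^ (q2^-1 - q1^-1).

Definition local_hypercontractivity d (E : measurableType d) (R : realType)
    (P : R -> (E -> R) -> (E -> R)) (A : set (E -> R)) (n : R) : Prop :=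
  forall q1 q2 u1 u2 : R, 1 < q1 -> q1 < q2 -> 0 < u1 -> 0 < u2 ->
  let tau := u1 * q1 - u2 * q2 in 0 < tau ->
  forall f, A f -> (forall x, 0 < f x) -> forall x,
    (P u2 (fun y => (P tau f y) `^ q2) x) `^ q2^-1
    <= (P u1 (fun y => (f y) `^ q1) x) `^ q1^-1
       * (hypercontractivity_cst q1 q2 u1 u2) `^ (n / 2).

Definition reverse_hypercontractivity_cst (R : realType) (q1 q2 u1 u2 : R) : R :=
  ((1 - q1) / u2) `^ (q1^-1 - 1) * ((1 - q2) / u1) `^ (1 - q2^-1)
  * ((u1 * q1 - u2 * q2) / (q1 - q2)) `^ (q1^-1 - q2^-1).

(* The boundedness of [f `^ q1] says that [P u1] applies to it; it is automatic
   when [0 < q1], and only matters when [q1 < 0] and [f] is not bounded away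
   from 0. *)
Definition local_reverse_hypercontractivity d (E : measurableType d)
    (R : realType) (P : R -> (E -> R) -> (E -> R)) (A : set (E -> R)) (n : R) :
    Prop :=
  forall q1 q2 u1 u2 : R,
  (0 < q2 /\ q2 < q1 /\ q1 < 1) \/ (q2 < q1 /\ q1 < 0) -> 0 < u1 -> 0 < u2 ->
  let tau := u1 * q1 - u2 * q2 in 0 < tau ->
  forall f, A f -> (forall x, 0 < f x) ->
  bounded_measurable (fun y => (f y) `^ q1) -> forall x,
    (P u1 (fun y => (f y) `^ q1) x) `^ q1^-1
    <= (P u2 (fun y => (P tau f y) `^ q2) x) `^ q2^-1
       * (reverse_hypercontractivity_cst q1 q2 u1 u2) `^ (n / 2).

(* Main.v *)
Require Import Defs.
From mathcomp Require Import all_boot all_order all_algebra.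
From mathcomp Require Import all_classical all_reals all_analysis.
From mathcomp Require Import measurable_realfun ring lra.
Import Order.TTheory GRing.Theory Num.Theory.
Import numFieldNormedType.Exports.
Local Open Scope classical_set_scope.
Local Open Scope ring_scope.

Set Implicit Arguments.
Unset Strict Implicit.
Unset Printing Implicit Defensive.

(** The four assertions are compared through a linear form of the logarithmic
    Sobolev inequality.  By concavity of the logarithm,
    ln w is the infimum over k > 0 of k w - 1 - ln k, attained at k = 1 / w, and
    this infimum is - oo when w <= 0; hence the local inequality, including the
    positivity of its argument, says exactly that, for all h in A, F = exp h,
    t > 0 and k > 0,

      Ent_{P_t}(F) <= t L P_t F - k t P_t (F L h) + n/2 P_t F (k - 1 - ln k),

    which is [linear_log_sobolev].

    CD(0,n) implies it ([CD0_linear_log_sobolev]).  Along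
    phi(s) = P_s (P_{t-s} F ln P_{t-s} F), with g = P_{t-s} F = exp h, one has
    formally phi' = P_s (g Gamma(h)) = L P_t F - P_s (g L h) and
    phi'' = 2 P_s (g Gamma_2(h)), so that CD(0,n) and the Cauchy-Schwarz
    inequality give phi'' >= c (phi' - L P_t F)^2 with c = 2 / (n P_t F).
    Differentiating Gamma(P_s f) in s is not legitimate, because L is unbounded.
    What does exist is a second order expansion of phi to the left of each point:
    phi(s) - phi(s - r) is P_{s-r} applied to an expression in the single
    function g.  This is enough to compare phi with an explicit strict
    supersolution of the differential inequality by the maximum principle
    ([entropy_flow_maximum]).  Conversely, for k = 1 + e t, both sides of the
    linear inequality agree to first order as t tends to 0, and the second order
    terms, with e = 2 L h / n, are Gamma_2(h) >= (L h)^2 / n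
    ([linear_log_sobolev_CD0]).

    For the hypercontractive inequalities, let
    H(q) = 1/q ln P_u ((P_tau f)^q), where u and tau depend on q and q u + tau is
    constant.  With F = (P_tau f)^q = exp h and k = tau' (q - 1) / u, the
    derivative of H is q^-2 (P_u F)^-1 times
    Ent_{P_u}(F) - u L P_u F + k u P_u (F L h) ([log_norm_jet1]), so the linear
    inequality is the bound H' <= n/2 (k - 1 - ln k) / q^2.  Integrated along the
    path on which 1/u is affine in q, which minimises the integral of the right
    side, it gives both the direct and the reverse inequality with their
    constants; differentiated at tau = 0, either of these gives back the linear
    inequality for every k.

    Differentiation under P_u uses expansions that are uniform on E ([jet1] and
    [jet2]).  The logarithm of a function of A bounded below by a positive
    constant belongs to A because the logarithm extends, from a half-line away
    from 0, to a smooth function on the line ([smooth_truncation]). *)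

(** * Smooth functions on the line *)

Section calculus.
Context {R : realType}.
Implicit Types (f g : R -> R) (k : nat).

Lemma is_derive_quadratic g (x d C : R) : 0 < C ->
  (forall h, C * `|h| <= 1 -> `|g (x + h) - g x - h * d| <= C * h ^+ 2) ->
  is_derive x 1 g d.
Proof.
move=> C0 H.
have cv : h^-1 *: (g (h *: 1 + x) - g x) @[h --> 0^'] --> d.
  apply/cvgrPdist_le => eps e0.
  have m0 : 0 < Num.min C^-1 (eps / C) by rewrite lt_min invr_gt0 C0 divr_gt0.
  apply/nbhs_ballP; exists (Num.min C^-1 (eps / C)) => //= h.
  move=> hb hn0; move: hb; rewrite -ball_normE /= sub0r normrN lt_min => /andP[h1 h2].
  have hp : 0 < `|h| by rewrite normr_gt0.
  have -> : d - h^-1 *: (g (h *: 1 + x) - g x) =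
            - h^-1 * (g (x + h) - g x - h * d).
    by rewrite /GRing.scale /= mulr1 (addrC h x); field.
  rewrite normrM normrN normfV ler_pdivrMl //.
  apply: le_trans (H h _) _.
    by rewrite -ler_pdivlMl // mulr1 ltW.
  rewrite -real_normK ?num_real // expr2 mulrCA ler_pM2l // mulrC.
  by rewrite -ler_pdivlMr // ltW.
apply: DeriveDef; first by apply/cvg_ex; exists d.
exact/cvg_lim.
Qed.

(** Smoothness is recursive in this form, so that each closure property is one
    induction on the order of differentiation. *)
Fixpoint derivable_upto k f : Prop :=
  if k is k'.+1 then (forall x, derivable f x 1) /\ derivable_upto k' (derive1 f)
  else True.

Lemma smoothP f : smooth f <-> forall k, derivable_upto k f.
Proof.
split.
  move=> sf k; elim: k f sf => //= k IH f sf; split; first exact: (sf 0%N).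
  by apply: IH => j x; rewrite -derive1Sn; exact: sf.
move=> H k; elim: k f H => [|k IH] f H x; first by have [] := H 1%N.
by rewrite derive1Sn; apply: IH => j; have [] := H j.+1.
Qed.

Lemma derivable_uptoS k f (f' : R -> R) : (forall x : R, is_derive x 1 f (f' x)) ->
  derivable_upto k f' -> derivable_upto k.+1 f.
Proof.
move=> df Hf' /=; split => [x|]; first by have [] := df x.
suff -> : derive1 f = f' by [].
by apply/funext => x; rewrite derive1E; have [_ ->] := df x.
Qed.

Lemma derivable_uptoW k f : derivable_upto k.+1 f -> derivable_upto k f.
Proof. by elim: k f => //= k IH f [df [dg Hg]]; split => //; apply: IH. Qed.

Lemma derivable_upto_derive k f : derivable_upto k.+1 f ->
  exists2 f' : R -> R, (forall x : R, is_derive x 1 f (f' x)) & derivable_upto k f'.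
Proof.
move=> [df Hf]; exists (derive1 f) => // x; rewrite derive1E; exact: derivableP.
Qed.

Lemma derivable_upto_cst k (c : R) : derivable_upto k (fun=> c).
Proof.
elim: k c => // k IH c; apply: (derivable_uptoS (f' := fun=> 0)) => // x.
Qed.

Lemma derivable_upto_id k : derivable_upto k (fun x : R => x).
Proof.
case: k => // k; apply: (derivable_uptoS (f' := fun=> 1)).
exact: derivable_upto_cst.
Qed.

Lemma is_deriveM_fun f g (x df dg : R) : is_derive x 1 f df -> is_derive x 1 g dg ->
  is_derive x 1 (fun y => f y * g y) (df * g x + f x * dg).
Proof.
by move=> ? ?; apply: is_derive_eq; rewrite /GRing.scale /= addrC (mulrC df).
Qed.

Lemma is_deriveD_fun f g (x df dg : R) : is_derive x 1 f df -> is_derive x 1 g dg ->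
  is_derive x 1 (fun y => f y + g y) (df + dg).
Proof. by move=> ? ?; exact: is_deriveD. Qed.

Lemma is_derive_comp_fun f g (x df dg : R) :
  is_derive (g x) 1 f df -> is_derive x 1 g dg ->
  is_derive x 1 (fun y => f (g y)) (df * dg).
Proof.
by move=> ? ?; apply: is_derive_eq (is_derive1_comp _ _) _.
Qed.

Lemma derivable_upto_add k f g : derivable_upto k f -> derivable_upto k g ->
  derivable_upto k (fun x => f x + g x).
Proof.
elim: k f g => // k IH f g /derivable_upto_derive [f' df Hf'] /derivable_upto_derive [g' dg Hg'].
apply: (derivable_uptoS (f' := fun x => f' x + g' x)); last exact: IH.
Qed.

Lemma derivable_upto_mul k f g : derivable_upto k f -> derivable_upto k g ->
  derivable_upto k (fun x => f x * g x).
Proof.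
elim: k f g => // k IH f g Hf Hg.
have [f' df Hf'] := derivable_upto_derive Hf.
have [g' dg Hg'] := derivable_upto_derive Hg.
apply: (derivable_uptoS (f' := fun x => f' x * g x + f x * g' x)).
  by move=> x; exact: (is_deriveM_fun (df _) (dg x)).
by apply: derivable_upto_add; apply: IH => //; exact: derivable_uptoW.
Qed.

Lemma derivable_upto_comp k f g : derivable_upto k f -> derivable_upto k g ->
  derivable_upto k (fun x => f (g x)).
Proof.
elim: k f g => // k IH f g Hf Hg.
have [f' df Hf'] := derivable_upto_derive Hf.
have [g' dg Hg'] := derivable_upto_derive Hg.
apply: (derivable_uptoS (f' := fun x => f' (g x) * g' x)).
by apply: derivable_upto_mul => //; apply: IH => //; exact: derivable_uptoW.
Qed.

Lemma is_derive_inv_fun g (x dg : R) : g x != 0 -> is_derive x 1 g dg ->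
  is_derive x 1 (fun y => (g y)^-1) (- dg * ((g x)^-1 * (g x)^-1)).
Proof.
move=> g0 dgx; apply: is_derive_eq (is_deriveV _ _) _ => //.
by rewrite /GRing.scale /= -exprVn expr2; ring.
Qed.

Lemma derivable_upto_inv k g : (forall x, g x != 0) -> derivable_upto k g ->
  derivable_upto k (fun x => (g x)^-1).
Proof.
elim: k g => // k IH g g0 Hg.
have [g' dg Hg'] := derivable_upto_derive Hg.
apply: (derivable_uptoS (f' := fun x => - g' x * ((g x)^-1 * (g x)^-1))).
  by move=> x; exact: (is_derive_inv_fun (g0 x) (dg x)).
have Hi := IH g g0 (derivable_uptoW Hg).
apply: derivable_upto_mul; last exact: derivable_upto_mul.
under [X in derivable_upto _ X]eq_fun do rewrite -mulN1r.
by apply: derivable_upto_mul => //; exact: derivable_upto_cst.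
Qed.

Lemma derivable_upto_ln k g : (forall x, 0 < g x) -> derivable_upto k g ->
  derivable_upto k (fun x => ln (g x)).
Proof.
case: k => // k g0 Hg.
have [g' dg Hg'] := derivable_upto_derive Hg.
apply: (derivable_uptoS (f' := fun x => (g x)^-1 * g' x)).
  by move=> x; apply: is_derive_comp_fun => //; exact: is_derive1_ln.
apply: derivable_upto_mul => //; apply: derivable_upto_inv; last exact: derivable_uptoW.
by move=> x; rewrite gt_eqF.
Qed.

Lemma derivable_upto_expR k : derivable_upto k (@expR R).
Proof.
elim: k => // k IH; exact: (derivable_uptoS (f' := expR)).
Qed.

(** The derivatives of exp (-1/x), extended by 0, are combinations of the
    functions x^-m exp (-1/x) of this family. *)
Definition flat (m : nat) (x : R) : R :=
  if 0 < x then x^-1 ^+ m * expR (- x^-1) else 0.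

Lemma expR_ge_pow (y : R) (m : nat) : 0 <= y -> y ^+ m <= m`!%:R * expR y.
Proof.
case: m => [|m] y0; first by rewrite expr0 mul1r -[leLHS]addr0 (le_trans _ (expR_ge1Dx y)) ?lerD2l.
have := expR_ge1Dxn m y0.
rewrite -ler_pdivrMl ?ltr0n ?fact_gt0 // mulrC; apply: le_trans.
by rewrite lerDr.
Qed.

(** At 0 the exponential wins: y^(m+2) <= (m+2)! exp y with y = 1/x bounds the
    function by a multiple of x^2. *)
Lemma is_derive_flat m (x : R) : is_derive x 1 (flat m) (flat m.+2 x - m%:R * flat m.+1 x).
Proof.
case: (ltgtP x 0) => [x0|x0|->].
- have -> : flat m.+2 x - m%:R * flat m.+1 x = 0.
    by rewrite /flat ltNge (ltW x0) /= mulr0 subr0.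
  apply: (near_eq_is_derive (f := fun=> 0)).
  near=> y; rewrite /flat ifN // -leNgt; near: y; exact: lt_le_nbhsl.
- have x0' : x != 0 by rewrite gt_eqF.
  apply: (near_eq_is_derive (f := fun y : R => y^-1 ^+ m * expR (- y^-1))).
  + near=> y; rewrite /flat ifT //; near: y; exact: lt_nbhsr.
  + have di : is_derive x 1 (fun y : R => y^-1) (- x^-2).
      by apply: is_derive_eq (is_derive_inv_fun (g := fun y => y) x0' (is_derive_id _ _)) _;
        rewrite mulN1r -expr2 exprVn.
    have dp : is_derive x 1 (fun y : R => y^-1 ^+ m) (m%:R * x^-1 ^+ m.-1 * (- x^-2)).
      apply: (is_derive_comp_fun (f := fun y => y ^+ m)) => //.
      apply: DeriveDef; first exact: exprn_derivable.
      by rewrite exp_derive /GRing.scale /= mulr1.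
    have de : is_derive x 1 (fun y : R => expR (- y^-1)) (expR (- x^-1) * x^-2).
      apply: (is_derive_comp_fun (f := expR)) => //.
      by have := @is_deriveN R R R (fun y : R => y^-1) x 1 _ di; rewrite opprK.
    apply: is_derive_eq (is_deriveM_fun dp de) _.
    rewrite /flat x0; case: m dp => [|m] dp /=.
      by rewrite !mul0r !expr0 mul1r add0r subr0 mulrC exprVn.
    by rewrite -!exprVn !exprS; ring.
- rewrite {2 3}/flat ltxx mulr0 subr0.
  pose C : R := m.+2`!%:R.
  have C1 : 1 <= C by rewrite ler1n fact_gt0.
  apply: (@is_derive_quadratic _ _ _ C) => [|h _]; first exact: lt_le_trans ltr01 C1.
  rewrite add0r /flat ltxx mulr0 !subr0; case: ifPn => h0; last first.
    by rewrite normr0 mulr_ge0 ?sqr_ge0 // (le_trans ler01).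
  rewrite ger0_norm ?mulr_ge0 ?expR_ge0 ?exprn_ge0 ?invr_ge0 ?(ltW h0) //.
  have hi : 0 <= h^-1 by rewrite invr_ge0 ltW.
  have := @expR_ge_pow h^-1 m.+2 hi.
  rewrite -ler_pdivrMr ?expR_gt0 // -expRN => H.
  have hn : h != 0 by rewrite gt_eqF.
  have -> : h^-1 ^+ m = h^-1 ^+ m.+2 * h ^+ 2 by rewrite !exprS expr0; field.
  by rewrite mulrAC ler_wpM2r ?sqr_ge0.
Unshelve. all: by end_near.
Qed.

Lemma derivable_upto_flat k m : derivable_upto k (flat m).
Proof.
elim: k m => // k IH m.
apply: (derivable_uptoS (f' := fun x => flat m.+2 x + (- m%:R) * flat m.+1 x)).
  by move=> x; rewrite mulNr; exact: is_derive_flat.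
apply: derivable_upto_add => //; apply: derivable_upto_mul => //.
exact: derivable_upto_cst.
Qed.

Lemma flat0_ge0 x : 0 <= flat 0 x.
Proof. by rewrite /flat; case: ifP => // _; rewrite mul1r expR_ge0. Qed.

(** A weighted mean of x and a/2 whose weights are the flat functions of x - a/2
    and of a - x: the second weight vanishes for x >= a, the first for x <= a/2. *)
Lemma smooth_truncation (a : R) : 0 < a ->
  exists rho : R -> R, [/\ smooth rho, (forall x, 0 < rho x) &
                           forall x, a <= x -> rho x = x].
Proof.
move=> a0; pose u x := flat 0 (x + - (a / 2)); pose v x := flat 0 (a + (-1) * x).
pose rho x := (x * u x + (a / 2) * v x) * (u x + v x)^-1.
have u0 x : 0 <= u x by exact: flat0_ge0.
have v0 x : 0 <= v x by exact: flat0_ge0.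
have uz x : x <= a / 2 -> u x = 0.
  by move=> xa; rewrite /u /flat ifN // -leNgt; lra.
have up x : a / 2 < x -> 0 < u x.
  by move=> xa; rewrite /u /flat ifT ?mul1r ?expR_gt0 //; lra.
have vz x : a <= x -> v x = 0.
  by move=> xa; rewrite /v /flat ifN // -leNgt; lra.
have vp x : x < a -> 0 < v x.
  by move=> xa; rewrite /v /flat ifT ?mul1r ?expR_gt0 //; lra.
have uv x : 0 < u x + v x.
  case: (ltP (a / 2) x) => xa; first by rewrite ltr_pwDl ?up.
  by rewrite ltr_wpDl // vp //; lra.
exists rho; split.
- apply/smoothP => k.
  have su : derivable_upto k u.
    apply: (derivable_upto_comp (f := flat 0)); first exact: derivable_upto_flat.
    apply: derivable_upto_add; [exact: derivable_upto_id|exact: derivable_upto_cst].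
  have sv : derivable_upto k v.
    apply: (derivable_upto_comp (f := flat 0)); first exact: derivable_upto_flat.
    apply: derivable_upto_add; first exact: derivable_upto_cst.
    apply: derivable_upto_mul; [exact: derivable_upto_cst|exact: derivable_upto_id].
  apply: derivable_upto_mul.
    apply: derivable_upto_add; apply: derivable_upto_mul => //.
      exact: derivable_upto_id.
    exact: derivable_upto_cst.
  apply: derivable_upto_inv; last exact: derivable_upto_add.
  by move=> x; rewrite gt_eqF.
- move=> x; rewrite mulr_gt0 ?invr_gt0 //.
  have a2 : 0 < a / 2 by lra.
  case: (ltP (a / 2) x) => xa.
    by rewrite ltr_pwDl // ?mulr_gt0 ?up ?(lt_trans a2) // mulr_ge0 // ltW.
  by rewrite uz // mulr0 add0r mulr_gt0 // vp //; lra.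
- move=> x xa; rewrite /rho vz // mulr0 !addr0 mulfK // gt_eqF // up //; lra.
Qed.

End calculus.

(** * Expansions with uniform remainder *)

Section estimates.
Context {R : realType}.

Lemma expR_taylor1 (z : R) : `|z| <= 1 / 2 -> `|expR z - 1 - z| <= 2 * `|z| ^+ 2.
Proof.
rewrite ler_norml => /andP[z1 z2].
have e1 := expR_ge1Dx z; have e2 := expR_ge1Dx (- z).
have e0 := expR_gt0 z; have := expRxMexpNx_1 z => e3.
rewrite ger0_norm; last lra.
rewrite real_normK ?num_real //.
have e4 : expR z * (1 - z) <= expR z * expR (- z) by rewrite ler_pM2l.
rewrite e3 in e4; rewrite -subr_ge0 -(pmulr_rge0 _ (ltac:(lra) : 0 < 1 - z)).
have : 0 <= z ^+ 2 * (1 - 2 * z) by rewrite mulr_ge0 ?sqr_ge0 //; lra.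
lra.
Qed.

(** The left side without norm has derivative y^2 / (1 + y), and the mean value
    theorem bounds it. *)
Lemma ln1D_taylor2 (z : R) : `|z| <= 1 / 2 ->
  `|ln (1 + z) - z + z ^+ 2 / 2| <= 2 * `|z| ^+ 3.
Proof.
move=> hz.
pose f (y : R) := ln (1 + y) + (y * y * (1 / 2) + (-1) * y).
have df (y : R) : `|y| <= 1 / 2 -> is_derive y 1 f (y ^+ 2 / (1 + y)).
  rewrite ler_norml => /andP[y1 y2].
  have yp : 0 < 1 + y by lra.
  have dl : is_derive y 1 (fun x : R => ln (1 + x)) ((1 + y)^-1 * (0 + 1)).
    apply: (is_derive_comp_fun (f := @ln R) (g := fun x : R => 1 + x)).
      exact: is_derive1_ln.
  have dq : is_derive y 1 (fun x : R => x * x * (1 / 2))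
      ((1 * y + y * 1) * (1 / 2) + (y * y) * 0).
    apply: (is_deriveM_fun (f := fun x => x * x) (g := fun=> 1 / 2)) => //.
    exact: (is_deriveM_fun (is_derive_id y 1) (is_derive_id y 1)).
  have dn : is_derive y 1 (fun x : R => (-1) * x) (0 * y + (-1) * 1).
    exact: (is_deriveM_fun (is_derive_cst (-1 : R) y 1) (is_derive_id y 1)).
  apply: is_derive_eq (is_deriveD_fun dl (is_deriveD_fun dq dn)) _.
  by field; rewrite gt_eqF.
have f0 : f 0 = 0 by rewrite /f addr0 ln1; ring.
have mvt (a b : R) : a < b -> - (1 / 2) <= a -> b <= 1 / 2 ->
    exists c, [/\ a < c, c < b & f b - f a = c ^+ 2 / (1 + c) * (b - a)].
  move=> ab a2 b2.
  have dfi (y : R) : a <= y -> y <= b -> is_derive y 1 f (y ^+ 2 / (1 + y)).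
    by move=> ay yb; apply: df; rewrite ler_norml; apply/andP; split; lra.
  have [y|y|c] := @MVT R f (fun y => y ^+ 2 / (1 + y)) a b ab.
  - by rewrite in_itv /= => /andP[ay yb]; apply: dfi; exact: ltW.
  - apply: derivable_within_continuous => z'; rewrite in_itv /= => /andP[ay yb].
    by have [] := dfi _ ay yb.
  - by rewrite in_itv /= => /andP[ac cb] E; exists c.
have key : exists2 c : R, `|c| <= `|z| & f z = c ^+ 2 / (1 + c) * z.
  move: (hz); rewrite ler_norml => /andP[z1 z2].
  case: (ltgtP z 0) => z0.
  - have [||c [a b]] := mvt z 0 z0; [lra|lra|].
    rewrite f0 => e; exists c; last by move: e; lra.
    by rewrite !ltr0_norm ?lerN2 ?ltW.
  - have [||c [a b]] := mvt 0 z z0; [lra|lra|].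
    rewrite f0 => e; exists c; last by move: e; lra.
    by rewrite !gtr0_norm ?ltW.
  - by exists 0; rewrite ?normr0 ?normr_ge0 // z0 f0 mulr0.
have [c cz fz] := key.
have -> : ln (1 + z) - z + z ^+ 2 / 2 = f z by rewrite /f; field.
have c2 : 1 / 2 <= 1 + c.
  have := le_trans cz hz; rewrite ler_norml => /andP[]; lra.
rewrite fz normrM (exprSr `|z| 2) mulrA ler_wpM2r // normrM normrX normfV.
rewrite (ger0_norm (x := 1 + c)); last lra.
rewrite ler_pdivrMr; last lra.
have : `|c| ^+ 2 <= `|z| ^+ 2 by rewrite ler_sqr // nnegrE normr_ge0.
have : 0 <= `|z| ^+ 2 by rewrite exprn_ge0.
nra.
Qed.

Lemma ln1D_taylor1 (z : R) : `|z| <= 1 / 2 -> `|ln (1 + z) - z| <= 2 * `|z| ^+ 2.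
Proof.
move=> hz; have H := ln1D_taylor2 hz.
have z0 : 0 <= `|z| by [].
have -> : ln (1 + z) - z = (ln (1 + z) - z + z ^+ 2 / 2) + (- (z ^+ 2 / 2)) by ring.
apply: le_trans (ler_normD _ _) _.
rewrite normrN normrM normrX (ger0_norm (x := 2^-1)) ?invr_ge0 ?ler0n //.
have : `|z| ^+ 3 <= `|z| ^+ 2 * (1 / 2) by rewrite exprSr ler_wpM2l ?exprn_ge0.
have : 0 <= `|z| ^+ 2 by rewrite exprn_ge0.
lra.
Qed.

End estimates.

Section unifO.
Context {R : realType} {X : Type}.
Implicit Types (G H : R -> X -> R) (a b c : X -> R) (N M : nat).

Definition bounded_fct a := exists C : R, forall x, `|a x| <= C.

(** The constant also bounds the radius on which the estimate holds, so that two
    estimates are combined by enlarging a single number. *)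
Definition unifO N G := exists C : R, 1 <= C /\
  forall h, C * `|h| <= 1 -> forall x, `|G h x| <= C * `|h| ^+ N.

Lemma bounded_fct_ge1 a : bounded_fct a -> exists2 C : R, 1 <= C & forall x, `|a x| <= C.
Proof.
by move=> [C H]; exists (Num.max 1 C) => [|x]; rewrite le_max ?lexx // H orbT.
Qed.

Lemma bounded_fct_cst (k : R) : bounded_fct (fun=> k).
Proof. by exists `|k|. Qed.

Lemma bounded_fctD a b : bounded_fct a -> bounded_fct b ->
  bounded_fct (fun x => a x + b x).
Proof.
by move=> [C H] [D K]; exists (C + D) => x; rewrite (le_trans (ler_normD _ _)) // lerD.
Qed.

Lemma bounded_fctM a b : bounded_fct a -> bounded_fct b ->
  bounded_fct (fun x => a x * b x).
Proof.
by move=> [C H] [D K]; exists (C * D) => x; rewrite normrM ler_pM.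
Qed.

Lemma bounded_fctN a : bounded_fct a -> bounded_fct (fun x => - a x).
Proof. by move=> [C H]; exists C => x; rewrite normrN. Qed.

Lemma bounded_fctV a (e : R) : 0 < e -> (forall x, e <= `|a x|) ->
  bounded_fct (fun x => (a x)^-1).
Proof.
move=> e0 H; exists e^-1 => x; rewrite normfV lef_pV2 ?posrE //.
exact: lt_le_trans (H x).
Qed.

Lemma unifO_eq N G H : (forall h x, G h x = H h x) -> unifO N G -> unifO N H.
Proof. by move=> E; have -> : G = H by apply/funext => h; apply/funext. Qed.

Lemma unifO_near N G H : (exists C : R, 1 <= C /\
    forall h, C * `|h| <= 1 -> forall x, `|H h x| <= `|G h x|) ->
  unifO N G -> unifO N H.
Proof.
move=> [D [D1 HD]] [C [C1 HC]]; exists (C + D); split=> [|h hh x]; first lra.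
have h0 : 0 <= `|h| by [].
apply: le_trans (HD h _ x) _; first nra.
apply: le_trans (HC h _ x) _; first nra.
rewrite ler_wpM2r ?exprn_ge0 //; lra.
Qed.

Lemma unifO_add N G H : unifO N G -> unifO N H -> unifO N (fun h x => G h x + H h x).
Proof.
move=> [C [C1 HC]] [D [D1 HD]]; exists (C + D); split=> [|h hh x]; first lra.
have h0 : 0 <= `|h| by [].
rewrite mulrDl (le_trans (ler_normD _ _)) // lerD //; [apply: HC|apply: HD]; nra.
Qed.

Lemma unifO_opp N G : unifO N G -> unifO N (fun h x => - G h x).
Proof. by move=> [C [C1 H]]; exists C; split=> // h hh x; rewrite normrN H. Qed.

Lemma unifO_mul N M G H : unifO N G -> unifO M H ->
  unifO (N + M) (fun h x => G h x * H h x).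
Proof.
move=> [C [C1 HC]] [D [D1 HD]]; exists (C * D); split=> [|h hh x].
  by rewrite -(mulr1 1) ler_pM.
have h0 : 0 <= `|h| by [].
rewrite normrM exprD mulrACA ler_pM //; [apply: HC|apply: HD]; nra.
Qed.

Lemma unifO_weaken N M G : (N <= M)%N -> unifO M G -> unifO N G.
Proof.
move=> NM [C [C1 H]]; exists C; split=> // h hh x; apply: le_trans (H h hh x) _.
have h0 : 0 <= `|h| by [].
rewrite ler_wpM2l ?(le_trans ler01) // ler_wiXn2l //; nra.
Qed.

Lemma unifO0 a : bounded_fct a -> unifO 0 (fun=> a).
Proof.
by move=> /bounded_fct_ge1[C C1 H]; exists C; split=> // h _ x; rewrite expr0 mulr1.
Qed.

Lemma unifO_var : unifO 1 (fun h _ => h).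
Proof. by exists 1; split=> // h _ x; rewrite mul1r. Qed.

Lemma unifO_expr_scale N a : bounded_fct a -> unifO N (fun h x => h ^+ N * a x).
Proof.
move=> /bounded_fct_ge1[C C1 H]; exists C; split=> // h _ x.
by rewrite normrM normrX mulrC ler_wpM2r ?exprn_ge0.
Qed.

Lemma unifO_expr_mul N G : unifO 0 G -> unifO N (fun h x => h ^+ N * G h x).
Proof.
move=> /(unifO_mul _) H; rewrite -[N in unifO N _]addn0; apply: H.
exists 1; split=> // h _ x; by rewrite normrX mul1r.
Qed.

Lemma unifO_exp N G M : unifO N G -> unifO (N * M) (fun h x => G h x ^+ M).
Proof.
move=> GO; elim: M => [|M IH].
  by rewrite muln0; apply: unifO_eq (unifO0 (bounded_fct_cst 1)) => h x; rewrite expr0.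
by rewrite mulnS; apply: unifO_eq (unifO_mul GO IH) => h x; rewrite exprS.
Qed.

Lemma unifO_comp N G (r : R -> R) : unifO N G ->
  (exists C : R, 1 <= C /\ forall h, C * `|h| <= 1 -> `|r h| <= C * `|h|) ->
  unifO N (fun h => G (r h)).
Proof.
move=> [C [C1 HC]] [D [D1 HD]]; exists (C * D ^+ N.+1); split=> [|h hh x].
  by rewrite -(mulr1 1) ler_pM // exprn_ege1.
have h0 : 0 <= `|h| by [].
have DN : 1 <= D ^+ N by exact: exprn_ege1.
have D2 : 1 <= D ^+ N.+1 by exact: exprn_ege1.
have CD : C * D <= C * D ^+ N.+1 by rewrite exprS ler_wpM2l; nra.
have h1 : C * D * `|h| <= 1 by nra.
have h2 : `|r h| <= D * `|h| by apply: HD; nra.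
apply: le_trans (HC _ _ x) _; first nra.
apply: (@le_trans _ _ (C * (D * `|h|) ^+ N)).
  by rewrite ler_wpM2l ?lerXn2r ?nnegrE //; nra.
rewrite exprMn exprSr -!mulrA ler_wpM2l //; first lra.
rewrite ler_wpM2l ?exprn_ge0 //; first lra.
by rewrite ler_peMl ?exprn_ge0.
Qed.

Lemma unifO_small N G (e : R) : 0 < e -> unifO N.+1 G ->
  exists C : R, 1 <= C /\ forall h, C * `|h| <= 1 -> forall x, `|G h x| <= e.
Proof.
move=> e0 [C [C1 H]]; exists (C * (1 + C / e)).
have ce : 0 < C / e by apply: divr_gt0 => //; lra.
split=> [|h hh x]; first nra.
have h0 : 0 <= `|h| by [].
have hC : C * `|h| <= 1 by nra.
have h1 : `|h| <= 1 by nra.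
apply: le_trans (H h hC x) _.
apply: (@le_trans _ _ (C * `|h|)).
  by rewrite ler_wpM2l ?(le_trans ler01) // exprS ler_piMr // exprn_ile1.
have : C * (C / e) * `|h| <= 1 by nra.
rewrite mulrAC mulrA ler_pdivrMr // mul1r; nra.
Qed.

(** First order expansion at 0 in the variable h, uniform in x, with a remainder
    of order h^2 rather than o(h): such expansions multiply and compose without
    choosing epsilons. *)
Definition jet1 G a b := [/\ bounded_fct a, bounded_fct b &
  unifO 2 (fun h x => G h x - (a x + h * b x))].

Definition jet2 G a b c := [/\ bounded_fct a, bounded_fct b, bounded_fct c &
  unifO 3 (fun h x => G h x - (a x + h * b x + h ^+ 2 * c x))].

Lemma unifO_affine a b : bounded_fct a -> bounded_fct b ->
  unifO 0 (fun h x => a x + h * b x).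
Proof.
move=> ba bb; apply: unifO_add; first exact: unifO0.
apply: (@unifO_weaken _ 1) => //.
exact: unifO_eq (unifO_expr_scale 1 bb).
Qed.

Lemma jet1_unifO0 G a b : jet1 G a b -> unifO 0 G.
Proof.
move=> [ba bb HG]; have := unifO_add (unifO_weaken (leq0n 2) HG) (unifO_affine ba bb).
by apply: unifO_eq => h x; rewrite subrK.
Qed.

Lemma jet1_unifO1 G a b : jet1 G a b -> unifO 1 (fun h x => G h x - a x).
Proof.
move=> [ba bb HG].
have := unifO_add (unifO_weaken (isT : (1 <= 2)%N) HG) (unifO_expr_scale 1 bb).
by apply: unifO_eq => h x; ring.
Qed.

Lemma jet2_jet1 G a b c : jet2 G a b c -> jet1 G a b.
Proof.
move=> [ba bb bc HG]; split=> //.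
have := unifO_add (unifO_weaken (isT : (2 <= 3)%N) HG) (unifO_expr_scale 2 bc).
by apply: unifO_eq => h x; ring.
Qed.

Lemma jet1_eq G H a b a' b' : (forall h x, G h x = H h x) ->
  (forall x, a x = a' x) -> (forall x, b x = b' x) -> jet1 G a b -> jet1 H a' b'.
Proof.
move=> E ea eb.
have -> : G = H by apply/funext => h; apply/funext.
have -> : a = a' by apply/funext.
by have -> : b = b' by apply/funext.
Qed.

Lemma jet2_eq G H a b c a' b' c' : (forall h x, G h x = H h x) ->
  (forall x, a x = a' x) -> (forall x, b x = b' x) -> (forall x, c x = c' x) ->
  jet2 G a b c -> jet2 H a' b' c'.
Proof.
move=> E ea eb ec.
have -> : G = H by apply/funext => h; apply/funext.
have -> : a = a' by apply/funext.
have -> : b = b' by apply/funext.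
by have -> : c = c' by apply/funext.
Qed.

Lemma jet1_cst a : bounded_fct a -> jet1 (fun=> a) a (fun=> 0).
Proof.
move=> ba; split=> //; first exact: bounded_fct_cst.
by exists 1; split=> // h _ x; rewrite mulr0 addr0 subrr normr0 mul1r exprn_ge0.
Qed.

Lemma jet2_cst a : bounded_fct a -> jet2 (fun=> a) a (fun=> 0) (fun=> 0).
Proof.
move=> ba; split=> //; try exact: bounded_fct_cst.
by exists 1; split=> // h _ x; rewrite !mulr0 !addr0 subrr normr0 mul1r exprn_ge0.
Qed.

Lemma jet1_affine (a b : R) : jet1 (fun h _ => a + h * b) (fun=> a) (fun=> b).
Proof.
split; try exact: bounded_fct_cst.
by exists 1; split=> // h _ x; rewrite subrr normr0 mul1r exprn_ge0.
Qed.

Lemma jet2_affine (a b : R) :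
  jet2 (fun h _ => a + h * b) (fun=> a) (fun=> b) (fun=> 0).
Proof.
split; try exact: bounded_fct_cst.
by exists 1; split=> // h _ x; rewrite mulr0 addr0 subrr normr0 mul1r exprn_ge0.
Qed.

Lemma jet1_add G H a b a' b' : jet1 G a b -> jet1 H a' b' ->
  jet1 (fun h x => G h x + H h x) (fun x => a x + a' x) (fun x => b x + b' x).
Proof.
move=> [ba bb OG] [ba' bb' OH]; split; try exact: bounded_fctD.
by apply: unifO_eq (unifO_add OG OH) => h x; ring.
Qed.

Lemma jet2_add G H a b c a' b' c' : jet2 G a b c -> jet2 H a' b' c' ->
  jet2 (fun h x => G h x + H h x) (fun x => a x + a' x) (fun x => b x + b' x)
       (fun x => c x + c' x).
Proof.
move=> [ba bb bc OG] [ba' bb' bc' OH]; split; try exact: bounded_fctD.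
by apply: unifO_eq (unifO_add OG OH) => h x; ring.
Qed.

Lemma jet1_mul G H a b a' b' : jet1 G a b -> jet1 H a' b' ->
  jet1 (fun h x => G h x * H h x) (fun x => a x * a' x)
       (fun x => a x * b' x + b x * a' x).
Proof.
move=> jG jH; have H0 := jet1_unifO0 jH.
case: jG jH => ba bb OG [ba' bb' OH]; split; first exact: bounded_fctM.
  by apply: bounded_fctD; apply: bounded_fctM.
have T1 := unifO_mul OG H0.
have T2 := unifO_mul (unifO_affine ba bb) OH.
have T3 := unifO_expr_scale 2 (bounded_fctM bb bb').
by apply: unifO_eq (unifO_add T1 (unifO_add T2 T3)) => h x; ring.
Qed.

Lemma unifO_quadratic a b c : bounded_fct a -> bounded_fct b -> bounded_fct c ->
  unifO 0 (fun h x => a x + h * b x + h ^+ 2 * c x).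
Proof.
move=> ba bb bc; apply: unifO_add; first exact: unifO_affine.
apply: (@unifO_weaken _ 2) => //; exact: unifO_expr_scale.
Qed.

Lemma jet2_mul G H a b c a' b' c' : jet2 G a b c -> jet2 H a' b' c' ->
  jet2 (fun h x => G h x * H h x) (fun x => a x * a' x)
       (fun x => a x * b' x + b x * a' x)
       (fun x => a x * c' x + b x * b' x + c x * a' x).
Proof.
move=> jG jH; have H0 := jet1_unifO0 (jet2_jet1 jH).
case: jG jH => ba bb bc OG [ba' bb' bc' OH]; split; first exact: bounded_fctM.
- by apply: bounded_fctD; apply: bounded_fctM.
- by do 2?apply: bounded_fctD; apply: bounded_fctM.
have T1 := unifO_mul OG H0.
have T2 := unifO_mul (unifO_quadratic ba bb bc) OH.
have T3 := unifO_expr_mul 3 (unifO_affine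
  (bounded_fctD (bounded_fctM bb bc') (bounded_fctM bc bb')) (bounded_fctM bc bc')).
by apply: unifO_eq (unifO_add T1 (unifO_add T2 T3)) => h x; ring.
Qed.

Lemma jet1_scale (k : R) G a b : jet1 G a b ->
  jet1 (fun h x => k * G h x) (fun x => k * a x) (fun x => k * b x).
Proof.
move=> jG; have := jet1_mul (jet1_cst (bounded_fct_cst k)) jG.
by apply: jet1_eq => // x; ring.
Qed.

Lemma jet2_scale (k : R) G a b c : jet2 G a b c ->
  jet2 (fun h x => k * G h x) (fun x => k * a x) (fun x => k * b x) (fun x => k * c x).
Proof.
move=> jG; have := jet2_mul (jet2_cst (bounded_fct_cst k)) jG.
by apply: jet2_eq => // x; ring.
Qed.

Lemma jet1_expR G a b : jet1 G a b ->
  jet1 (fun h x => expR (G h x)) (fun x => expR (a x)) (fun x => expR (a x) * b x).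
Proof.
move=> jG; have O1 := jet1_unifO1 jG; case: jG => ba bb OG.
have be : bounded_fct (fun x => expR (a x)).
  have [C HC] := ba; exists (expR C) => x.
  rewrite ger0_norm ?expR_ge0 // ler_expR; exact: le_trans (ler_norm _) (HC x).
split=> //; first exact: bounded_fctM.
have [D [D1 HD]] := unifO_small (ltac:(lra) : 0 < 1 / 2 :> R) O1.
have T1 : unifO 2 (fun h x => expR (G h x - a x) - 1 - (G h x - a x)).
  apply: unifO_near (unifO_mul (unifO0 (bounded_fct_cst 2)) (unifO_exp 2 O1)).
  exists D; split=> // h hh x; apply: le_trans (expR_taylor1 (HD h hh x)) _.
  by rewrite [leRHS]normrM normrX (ger0_norm (x := 2)).
have := unifO_mul (unifO0 be) (unifO_add T1 OG).
apply: unifO_eq => h x.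
have -> : expR (G h x) = expR (a x) * expR (G h x - a x) by rewrite -expRD addrC subrK.
by ring.
Qed.

Lemma bounded_fct_ln a (e : R) : 0 < e -> (forall x, e <= a x) -> bounded_fct a ->
  bounded_fct (fun x => ln (a x)).
Proof.
move=> e0 ea [C HC]; exists (`|ln e| + `|ln C|) => x.
have ap : 0 < a x by exact: lt_le_trans (ea x).
have aC : a x <= C by exact: le_trans (ler_norm _) (HC x).
have l1 : ln e <= ln (a x) by rewrite ler_ln ?posrE.
have l2 : ln (a x) <= ln C by rewrite ler_ln ?posrE // (lt_le_trans ap).
rewrite ler_norml; have := ler_norm (ln C); have := ler_norm (- ln e).
rewrite normrN; have := normr_ge0 (ln C); have := normr_ge0 (ln e).
by move=> *; apply/andP; split; lra.
Qed.

(** The increment of ln G is ln (1 + z) with z = (G - a) / a small, which reduces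
    the expansions of ln G to those of ln (1 + z). *)
Lemma jet_ln_aux N G a (e : R) : 0 < e -> (forall x, e <= a x) ->
  bounded_fct a -> unifO N.+1 (fun h x => G h x - a x) ->
  unifO N.+1 (fun h x => (G h x - a x) / a x) /\
  exists C : R, 1 <= C /\ forall h, C * `|h| <= 1 -> forall x,
    `|(G h x - a x) / a x| <= 1 / 2 /\ ln (G h x) = ln (a x) + ln (1 + (G h x - a x) / a x).
Proof.
move=> e0 ea ba OG.
have bi : bounded_fct (fun x => (a x)^-1).
  apply: (@bounded_fctV _ e) => // x; exact: le_trans (ea x) (ler_norm _).
have Oz : unifO N.+1 (fun h x => (G h x - a x) / a x).
  by have := unifO_mul OG (unifO0 bi); rewrite addn0.
split=> //; have [D [D1 HD]] := unifO_small (ltac:(lra) : 0 < 1 / 2 :> R) Oz.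
exists D; split=> // h hh x; split; first exact: HD.
have ap : 0 < a x by exact: lt_le_trans (ea x).
rewrite -lnM ?posrE //; last first.
  have := HD h hh x; rewrite ler_norml => /andP[]; lra.
by congr ln; field; rewrite gt_eqF.
Qed.

Lemma jet1_ln G a b (e : R) : 0 < e -> (forall x, e <= a x) -> jet1 G a b ->
  jet1 (fun h x => ln (G h x)) (fun x => ln (a x)) (fun x => b x / a x).
Proof.
move=> e0 ea jG; have O1 := jet1_unifO1 jG; case: jG => ba bb OG.
have bi : bounded_fct (fun x => (a x)^-1).
  apply: (@bounded_fctV _ e) => // x; exact: le_trans (ea x) (ler_norm _).
have [Oz [D [D1 HD]]] := jet_ln_aux e0 ea ba O1.
split; [exact: (@bounded_fct_ln _ e)|exact: bounded_fctM|].
have T1 : unifO 2 (fun h x => ln (G h x) - ln (a x) - (G h x - a x) / a x).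
  apply: unifO_near (unifO_mul (unifO0 (bounded_fct_cst 2)) (unifO_exp 2 Oz)).
  exists D; split=> // h hh x; have [z2 ->] := HD h hh x.
  rewrite (addrAC (ln (a x))) subrr add0r; apply: le_trans (ln1D_taylor1 z2) _.
  by rewrite [leRHS]normrM normrX (ger0_norm (x := 2)).
have := unifO_add T1 (unifO_mul OG (unifO0 bi)).
by apply: unifO_eq => h x; ring.
Qed.

Lemma jet2_ln G a b c (e : R) : 0 < e -> (forall x, e <= a x) -> jet2 G a b c ->
  jet2 (fun h x => ln (G h x)) (fun x => ln (a x)) (fun x => b x / a x)
       (fun x => c x / a x - (b x / a x) ^+ 2 / 2).
Proof.
move=> e0 ea jG; have O1 := jet1_unifO1 (jet2_jet1 jG); case: jG => ba bb bc OG.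
have bi : bounded_fct (fun x => (a x)^-1).
  apply: (@bounded_fctV _ e) => // x; exact: le_trans (ea x) (ler_norm _).
have [Oz [D [D1 HD]]] := jet_ln_aux e0 ea ba O1.
have bba := bounded_fctM bb bi; have bca := bounded_fctM bc bi.
have bb2 := bounded_fctM (bounded_fctM bba bba) (bounded_fct_cst (- (1 / 2))).
split; [exact: (@bounded_fct_ln _ e)|by []| |].
  by have [C HC] := bounded_fctD bca bb2; exists C => x; apply: le_trans (HC x);
    rewrite le_eqVlt; apply/orP; left; apply/eqP; congr (`|_|); field;
    rewrite gt_eqF // (lt_le_trans e0).
have T1 : unifO 3 (fun h x => ln (G h x) - ln (a x) - (G h x - a x) / a x
     + ((G h x - a x) / a x) ^+ 2 / 2).
  apply: unifO_near (unifO_mul (unifO0 (bounded_fct_cst 2)) (unifO_exp 3 Oz)).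
  exists D; split=> // h hh x; have [z2 ->] := HD h hh x.
  rewrite (addrAC (ln (a x))) subrr add0r; apply: le_trans (ln1D_taylor2 z2) _.
  by rewrite [leRHS]normrM normrX (ger0_norm (x := 2)).
have T2 := unifO_mul OG (unifO0 bi).
have O2 : unifO 2 (fun h x => (G h x - a x) / a x - h * (b x / a x)).
  have := unifO_add (unifO_weaken (isT : (2 <= 3)%N) T2) (unifO_expr_scale 2 bca).
  by apply: unifO_eq => h x; ring.
have O3 : unifO 1 (fun h x => (G h x - a x) / a x + h * (b x / a x)).
  exact: unifO_add Oz (unifO_expr_scale 1 bba).
have T3 := unifO_mul (unifO_mul O2 O3) (unifO0 (bounded_fct_cst (- (1 / 2)))).
have := unifO_add T1 (unifO_add T2 T3).
by apply: unifO_eq => h x; field; rewrite gt_eqF // (lt_le_trans e0).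
Qed.

(** A candidate inverse is tested by multiplication: 1/G - H = (1 - G H) / G, and
    1/G is bounded near 0. *)
Lemma unifO_inv N G H a (e : R) : 0 < e -> (forall x, e <= `|a x|) ->
  unifO 1 (fun h x => G h x - a x) -> unifO N (fun h x => 1 - G h x * H h x) ->
  unifO N (fun h x => (G h x)^-1 - H h x).
Proof.
move=> e0 ea O1 OH.
have e2 : 0 < e / 2 by lra.
have [D [D1 HD]] := unifO_small e2 O1.
apply: unifO_near (unifO_mul (unifO0 (bounded_fct_cst (2 / e))) OH).
exists D; split=> // h hh x.
have Ge : e / 2 <= `|G h x|.
  have := HD h hh x; have := ler_normD (G h x) (a x - G h x).
  rewrite addrC subrK distrC; have := ea x; lra.
have G0 : G h x != 0 by rewrite -normr_gt0; lra.
have -> : (G h x)^-1 - H h x = (G h x)^-1 * (1 - G h x * H h x) by field.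
rewrite !normrM ler_wpM2r // normfV (ger0_norm (x := 2)) // ger0_norm ?invr_ge0 ?(ltW e0) //.
rewrite -[leRHS]invrK lef_pV2 ?posrE //; first by rewrite invf_div.
  by rewrite normr_gt0.
by rewrite invr_gt0 divr_gt0.
Qed.

Lemma jet1_inv G a b (e : R) : 0 < e -> (forall x, e <= `|a x|) -> jet1 G a b ->
  jet1 (fun h x => (G h x)^-1) (fun x => (a x)^-1) (fun x => - b x / (a x) ^+ 2).
Proof.
move=> e0 ea jG; have O1 := jet1_unifO1 jG; case: jG => ba bb OG.
have a0 x : a x != 0 by rewrite -normr_gt0 (lt_le_trans e0).
have bi : bounded_fct (fun x => (a x)^-1) by exact: (@bounded_fctV _ e).
have bb' : bounded_fct (fun x => - b x / a x ^+ 2).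
  have [C HC] := bounded_fctM (bounded_fctN bb) (bounded_fctM bi bi).
  by exists C => x; apply: le_trans (HC x); rewrite -invfM -expr2.
split=> //; apply: unifO_inv e0 ea O1 _.
have T1 := unifO_mul (unifO_opp OG) (unifO_affine bi bb').
have T2 := unifO_expr_scale 2 (bounded_fctN (bounded_fctM bb bb')).
by apply: unifO_eq (unifO_add T1 T2) => h x; field.
Qed.

Lemma jet2_inv G a b c (e : R) : 0 < e -> (forall x, e <= `|a x|) -> jet2 G a b c ->
  jet2 (fun h x => (G h x)^-1) (fun x => (a x)^-1) (fun x => - b x / (a x) ^+ 2)
       (fun x => b x ^+ 2 / a x ^+ 3 - c x / a x ^+ 2).
Proof.
move=> e0 ea jG; have O1 := jet1_unifO1 (jet2_jet1 jG); case: jG => ba bb bc OG.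
have a0 x : a x != 0 by rewrite -normr_gt0 (lt_le_trans e0).
have bi : bounded_fct (fun x => (a x)^-1) by exact: (@bounded_fctV _ e).
have bb' : bounded_fct (fun x => - b x / a x ^+ 2).
  have [C HC] := bounded_fctM (bounded_fctN bb) (bounded_fctM bi bi).
  by exists C => x; apply: le_trans (HC x); rewrite -invfM -expr2.
have bc' : bounded_fct (fun x => b x ^+ 2 / a x ^+ 3 - c x / a x ^+ 2).
  have bi2 := bounded_fctM bi bi.
  have [C HC] := bounded_fctD (bounded_fctM (bounded_fctM bb bb) (bounded_fctM bi bi2))
    (bounded_fctN (bounded_fctM bc bi2)).
  exists C => x; apply: le_trans (HC x).
  by rewrite le_eqVlt; apply/orP; left; apply/eqP; congr (`|_|); field.
split=> //; apply: unifO_inv e0 ea O1 _.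
have T1 := unifO_mul (unifO_opp OG) (unifO_quadratic bi bb' bc').
have T2 := unifO_expr_mul 3 (unifO_affine
  (bounded_fctN (bounded_fctD (bounded_fctM bb bc') (bounded_fctM bc bb')))
  (bounded_fctN (bounded_fctM bc bc'))).
by apply: unifO_eq (unifO_add T1 T2) => h x; field.
Qed.

Lemma jet2_opp_var G a b c : jet2 G a b c ->
  jet2 (fun h => G (- h)) a (fun x => - b x) c.
Proof.
move=> [ba bb bc OG]; split=> //; first exact: bounded_fctN.
have := unifO_comp (r := -%R) OG _; move=> H.
apply: unifO_eq (H _) => [h x|]; first by ring.
by exists 1; split=> // h _; rewrite normrN mul1r.
Qed.

End unifO.

Section scalar_jets.
Context {R : realType}.

Lemma jet1_at (X Y : Type) (G : R -> X -> R) a b (f : Y -> X) :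
  jet1 G a b -> jet1 (fun h y => G h (f y)) (a \o f) (b \o f).
Proof.
move=> [[A HA] [B HB] [C [C1 HC]]]; split; [by exists A => y; exact: HA|by exists B => y; exact: HB|].
by exists C; split=> // h hh y; exact: HC.
Qed.

Lemma jet2_at (X Y : Type) (G : R -> X -> R) a b c (f : Y -> X) :
  jet2 G a b c -> jet2 (fun h y => G h (f y)) (a \o f) (b \o f) (c \o f).
Proof.
move=> [[A HA] [B HB] [D HD] [C [C1 HC]]]; split;
  [by exists A => y; exact: HA|by exists B => y; exact: HB|by exists D => y; exact: HD|].
by exists C; split=> // h hh y; exact: HC.
Qed.

(** Scalar expansions are uniform expansions over a one-point set. *)
Definition sjet1 (g : R -> R) (a b : R) :=
  jet1 (fun h (_ : unit) => g h) (fun=> a) (fun=> b).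
Definition sjet2 (g : R -> R) (a b c : R) :=
  jet2 (fun h (_ : unit) => g h) (fun=> a) (fun=> b) (fun=> c).

Lemma sjet1_at (X : Type) (G : R -> X -> R) a b x :
  jet1 G a b -> sjet1 (fun h => G h x) (a x) (b x).
Proof. exact: (jet1_at (fun _ : unit => x)). Qed.

Lemma sjet2_at (X : Type) (G : R -> X -> R) a b c x :
  jet2 G a b c -> sjet2 (fun h => G h x) (a x) (b x) (c x).
Proof. exact: (jet2_at (fun _ : unit => x)). Qed.

Lemma jet1_of_scalar (X : Type) g a b : sjet1 g a b ->
  jet1 (fun h (_ : X) => g h) (fun=> a) (fun=> b).
Proof. exact: (jet1_at (fun _ : X => tt)). Qed.

Lemma sjet1_value g a b : sjet1 g a b -> g 0 = a.
Proof.
move=> [_ _ [C [C1 H]]]; have := H 0 _ tt; rewrite normr0 mulr0 ler01 => /(_ isT).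
by rewrite mul0r addr0 expr0n mulr0 normr_le0 subr_eq0 => /eqP.
Qed.

Lemma sjet1_is_derive (f : R -> R) x a b : sjet1 (fun h => f (x + h)) a b ->
  is_derive x 1 f b.
Proof.
move=> J; have := sjet1_value J; rewrite addr0 => fa.
case: J => _ _ [C [C1 H]]; apply: (@is_derive_quadratic _ _ _ _ C); first lra.
move=> h hh; have := H h hh tt; rewrite fa real_normK ?num_real //.
by rewrite opprD addrA.
Qed.

Lemma sjet1_le0 g a b : sjet1 g a b ->
  (exists C : R, 1 <= C /\ forall h, 0 < h -> C * h <= 1 -> g h <= a) -> b <= 0.
Proof.
move=> [_ _ [C [C1 H]]] [D [D1 K]]; rewrite leNgt; apply/negP => b0.
have [h [h0 hC hD hb]] : exists h : R, [/\ 0 < h, C * h <= 1, D * h <= 1 & C * h < b].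
  pose h := Num.min (C + D)^-1 (b / (2 * C)).
  have h1 : h <= (C + D)^-1 by rewrite ge_min lexx.
  have h2 : h <= b / (2 * C) by rewrite ge_min lexx orbT.
  have h0 : 0 < h by rewrite lt_min invr_gt0 divr_gt0 //; lra.
  have : h * (C + D) <= 1 by rewrite -ler_pdivlMr ?mul1r //; lra.
  have : h * (2 * C) <= b by rewrite -ler_pdivlMr //; lra.
  exists h; split=> //; nra.
have := H h _ tt; rewrite gtr0_norm // => /(_ hC) /=.
rewrite ler_norml => /andP[+ _]; have := K h h0 hD; rewrite expr2; nra.
Qed.

(** Second order necessary condition for a one-sided maximum. *)
Lemma sjet2_le0 g a c : sjet2 g a 0 c ->
  (exists C : R, 1 <= C /\ forall h, 0 < h -> C * h <= 1 -> g h <= a) -> c <= 0.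
Proof.
move=> [_ _ _ [C [C1 H]]] [D [D1 K]]; rewrite leNgt; apply/negP => b0.
have [h [h0 hC hD hb]] : exists h : R, [/\ 0 < h, C * h <= 1, D * h <= 1 & C * h < c].
  pose h := Num.min (C + D)^-1 (c / (2 * C)).
  have h1 : h <= (C + D)^-1 by rewrite ge_min lexx.
  have h2 : h <= c / (2 * C) by rewrite ge_min lexx orbT.
  have h0 : 0 < h by rewrite lt_min invr_gt0 divr_gt0 //; lra.
  have : h * (C + D) <= 1 by rewrite -ler_pdivlMr ?mul1r //; lra.
  have : h * (2 * C) <= c by rewrite -ler_pdivlMr //; lra.
  exists h; split=> //; nra.
have := H h _ tt; rewrite gtr0_norm // => /(_ hC) /=.
rewrite ler_norml => /andP[+ _]; have := K h h0 hD; rewrite mulr0 addr0 => k1 k2.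
have : h ^+ 2 * (c - C * h) <= 0 by rewrite (exprSr h 2) in k2; nra.
have : 0 < h ^+ 2 by rewrite exprn_gt0.
nra.
Qed.

End scalar_jets.

(** * Bounded functions and the generator *)

Section bounded_measurable.
Context {d : measure_display} {E : measurableType d} {R : realType}.
Implicit Types f g : E -> R.

Lemma bm_cst (c : R) : bounded_measurable (fun _ : E => c).
Proof. by split; [exact: measurable_cst|exists `|c|]. Qed.

Lemma bm_add f g : bounded_measurable f -> bounded_measurable g ->
  bounded_measurable (fun x => f x + g x).
Proof.
move=> [mf bf] [mg bg]; split; [exact: measurable_funD|exact: bounded_fctD].
Qed.

Lemma bm_mul f g : bounded_measurable f -> bounded_measurable g ->
  bounded_measurable (fun x => f x * g x).
Proof.
move=> [mf bf] [mg bg]; split; [exact: measurable_funM|exact: bounded_fctM].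
Qed.

Lemma bm_scale (a : R) f : bounded_measurable f -> bounded_measurable (fun x => a * f x).
Proof. by move=> bf; apply: bm_mul => //; exact: bm_cst. Qed.

Lemma bm_sub f g : bounded_measurable f -> bounded_measurable g ->
  bounded_measurable (fun x => f x - g x).
Proof.
move=> bf bg; have := bm_add bf (bm_scale (-1) bg).
by under eq_fun do rewrite mulN1r.
Qed.

End bounded_measurable.

#[global] Hint Extern 0 (bounded_measurable (fun=> _)) => solve [exact: bm_cst] : core.

Lemma at_right0_ex {R : realType} (Q : R -> Prop) : (\forall h \near 0^'+, Q h) ->
  exists2 del : R, 0 < del & forall h, 0 < h -> h < del -> Q h.
Proof.
case=> del /= d0 H; exists del => // h h0 hd; apply: H => //=.
by rewrite sub0r normrN gtr0_norm.
Qed.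

Section semigroup.
Context {d : measure_display} {E : measurableType d} {R : realType}
  {mu : {measure set E -> \bar R}} {P : R -> (E -> R) -> (E -> R)}.
Hypothesis hP : markov_semigroup mu P.
Implicit Types (f g : E -> R) (t s : R).

Lemma P_bm t f : 0 <= t -> bounded_measurable f -> bounded_measurable (P t f).
Proof. exact: (markov_stable hP). Qed.

Lemma P_axpy t (a : R) f g x : 0 <= t -> bounded_measurable f -> bounded_measurable g ->
  P t (fun y => a * f y + g y) x = a * P t f x + P t g x.
Proof. by move=> *; exact: (markov_linear hP). Qed.

Lemma P_scale t (a : R) f x : 0 <= t -> bounded_measurable f ->
  P t (fun y => a * f y) x = a * P t f x.
Proof.
move=> t0 bf; have Z : P t (fun=> 0) x = 0.
  have := @P_axpy t (-1) (fun=> 0) (fun=> 0) x t0 (bm_cst _) (bm_cst _).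
  by rewrite /= mulr0 addr0 mulN1r addNr.
have := @P_axpy t a f (fun=> 0) x t0 bf (bm_cst _).
by rewrite /= Z addr0; under eq_fun do rewrite addr0.
Qed.

Lemma P_cst t (a : R) x : 0 <= t -> P t (fun=> a) x = a.
Proof.
move=> t0; have := @P_scale t a (fun=> 1) x t0 (bm_cst _).
by rewrite /= (markov_cst1 hP) // mulr1.
Qed.

Lemma P_add t f g x : 0 <= t -> bounded_measurable f -> bounded_measurable g ->
  P t (fun y => f y + g y) x = P t f x + P t g x.
Proof.
move=> t0 bf bg; have := @P_axpy t 1 f g x t0 bf bg.
by rewrite mul1r; under eq_fun do rewrite mul1r.
Qed.

Lemma P_sub t f g x : 0 <= t -> bounded_measurable f -> bounded_measurable g ->
  P t (fun y => f y - g y) x = P t f x - P t g x.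
Proof.
move=> t0 bf bg; have := @P_axpy t (-1) g f x t0 bg bf.
by rewrite mulN1r addrC => <-; congr P; apply/funext => y; rewrite mulN1r addrC.
Qed.

Lemma P_ge0 t f x : 0 <= t -> bounded_measurable f -> (forall y, 0 <= f y) -> 0 <= P t f x.
Proof. by move=> *; exact: (markov_ge0 hP). Qed.

Lemma P_le t f g x : 0 <= t -> bounded_measurable f -> bounded_measurable g ->
  (forall y, f y <= g y) -> P t f x <= P t g x.
Proof.
move=> t0 bf bg fg; rewrite -subr_ge0 -P_sub //; apply: P_ge0 => //.
  exact: bm_sub.
by move=> y; rewrite subr_ge0.
Qed.

Lemma P_ge_cst t f (c : R) x : 0 <= t -> bounded_measurable f ->
  (forall y, c <= f y) -> c <= P t f x.
Proof. by move=> t0 bf cf; rewrite -(P_cst c x t0); exact: P_le. Qed.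

Lemma P_le_cst t f (c : R) x : 0 <= t -> bounded_measurable f ->
  (forall y, f y <= c) -> P t f x <= c.
Proof. by move=> t0 bf cf; rewrite -(P_cst c x t0); exact: P_le. Qed.

Lemma P_norm_le t f (c : R) x : 0 <= t -> bounded_measurable f ->
  (forall y, `|f y| <= c) -> `|P t f x| <= c.
Proof.
move=> t0 bf cf; rewrite ler_norml P_le_cst // ?P_ge_cst //.
  by move=> y; have := cf y; rewrite ler_norml => /andP[].
by move=> y; have := cf y; rewrite ler_norml => /andP[].
Qed.

Lemma P_0 f x : bounded_measurable f -> P 0 f x = f x.
Proof. by move=> bf; exact: (markov_0 hP). Qed.

Lemma P_comp t s f x : 0 <= t -> 0 <= s -> bounded_measurable f ->
  P (t + s) f x = P t (P s f) x.
Proof. by move=> t0 s0 bf; exact: (markov_add hP). Qed.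

Lemma cvg_generator f x : generator_domain P f ->
  h^-1 * (P h f x - f x) @[h --> 0^'+] --> generator P f x.
Proof.
move=> [_ H]; apply/cvgrPdist_le => e e0; have := H e e0.
by apply: filterS => h /(_ x); rewrite distrC.
Qed.

Lemma generator_unique f x (l : R) :
  (forall e : R, 0 < e -> \forall h \near 0^'+, `|h^-1 * (P h f x - f x) - l| <= e) ->
  generator P f x = l.
Proof.
move=> H; apply: cvg_lim => //; apply/cvgrPdist_le => e e0; have := H e e0.
by apply: filterS => h; rewrite distrC.
Qed.

Lemma generator_axpy (a : R) f g x : generator_domain P f -> generator_domain P g ->
  generator P (fun y => a * f y + g y) x = a * generator P f x + generator P g x.
Proof.
move=> df dg; apply: cvg_lim => //.
have H := cvgD (cvgM (cvg_cst a) (cvg_generator (x := x) df)) (cvg_generator (x := x) dg).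
have K : (h^-1 * (P h (fun y => a * f y + g y) x - (a * f x + g x))) @[h --> 0^'+] --> a * generator P f x + generator P g x; last exact: K.
apply: (cvg_trans _ (H _ _ _)); apply: near_eq_cvg; near=> h.
have h0 : 0 <= h by [].
rewrite P_axpy //; [|by case: df|by case: dg].
rewrite ?fctE /=; ring.
Unshelve. all: by end_near. Qed.

Lemma generator_cst (c : R) x : generator P (fun=> c) x = 0.
Proof.
apply: generator_unique => e e0; near=> h.
rewrite P_cst; last by [].
by rewrite subrr mulr0 subrr normr0 ltW.
Unshelve. all: by end_near. Qed.

(** The difference quotient commutes with P_t, which contracts the supremum norm. *)
Lemma generator_P t f x : 0 <= t -> generator_domain P f ->
  bounded_measurable (generator P f) ->
  generator P (P t f) x = P t (generator P f) x.
Proof.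
move=> t0 [bf H] bL; apply: generator_unique => e e0.
have := H e e0; apply: filter_app; near=> h => K.
have h0 : 0 <= h by [].
have bPh := P_bm h0 bf.
rewrite -P_comp // (addrC h) P_comp // -P_sub // -P_scale //; last exact: bm_sub.
rewrite -P_sub //; last by apply: bm_scale; exact: bm_sub.
apply: P_norm_le => //; apply: bm_sub => //; apply: bm_scale; exact: bm_sub.
Unshelve. all: by end_near. Qed.

Lemma P_increment_small f (C : R) : generator_domain P f ->
  (forall x, `|generator P f x| <= C) ->
  exists2 del : R, 0 < del & forall h, 0 < h -> h < del ->
    forall x, `|P h f x - f x| <= h * (C + 1).
Proof.
move=> [bf H] bC; have [del d0 K] := at_right0_ex (H 1 ltr01).
exists del => // h h0 hd x; have := K h h0 hd x.
have := bC x; rewrite ler_norml => /andP[c1 c2].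
rewrite ler_norml => /andP[k1 k2].
have hn : h != 0 by rewrite gt_eqF.
have -> : P h f x - f x = h * (h^-1 * (P h f x - f x)) by field.
rewrite normrM gtr0_norm // ler_pM2l // ler_norml; apply/andP; split; lra.
Qed.

(** To the right of t this is the definition of the generator seen through P_t.
    To the left, the difference quotient is seen through P_{t-k}, and an extra term
    P_k L f - L f appears; it is small because L f is in the domain as well. *)
Lemma is_derive_P f t x : generator_domain P f ->
  generator_domain P (generator P f) ->
  bounded_fct (generator P (generator P f)) -> 0 < t ->
  is_derive t 1 (fun s => P s f x) (P t (generator P f) x).
Proof.
move=> df dLf [C bC] t0; have [bf H] := df; have [bL _] := dLf.
have [del1 d10 K1] := P_increment_small dLf bC.
have C0 : 0 < C + 1 by have := le_trans (normr_ge0 _) (bC x); lra.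
suff cv : h^-1 *: (P (h *: 1 + t) f x - P t f x) @[h --> 0^'] --> P t (generator P f) x.
  by apply: DeriveDef; [apply/cvg_ex; eexists; exact: cv|exact/cvg_lim].
apply/cvgrPdist_le => e e0.
have [del2 d20 K2] := at_right0_ex (H (e / 2) (ltac:(lra) : 0 < e / 2)).
pose m := Num.min (Num.min del1 del2) (Num.min t (e / 2 / (C + 1))).
have m0 : 0 < m by rewrite !lt_min d10 d20 t0 /= divr_gt0 //; lra.
apply/nbhs_ballP; exists m => // h hb hn0; move: hb.
rewrite -ball_normE /= sub0r normrN !lt_min -!andbA => /and4P[h1 h2 h3 h4].
rewrite /GRing.scale /= mulr1.
case: (ltgtP h 0) => hh; last 1 first.
- by rewrite hh eqxx in hn0.
- move: h1 h2 h3 h4; rewrite ltr0_norm //; set k := - h => h1 h2 h3 h4.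
  have k0 : 0 < k by rewrite /k; lra.
  have -> : h = - k by rewrite /k opprK.
  have tk : 0 <= - k + t by lra.
  have k0' := ltW k0.
  have bPk := P_bm k0' bf; have bPkL := P_bm k0' bL.
  have Et g : bounded_measurable g -> P t g x = P (- k + t) (P k g) x.
    by move=> bg; rewrite -P_comp // addrAC addNr add0r.
  rewrite (Et _ bL) (Et _ bf).
  have -> : P (- k + t) (P k (generator P f)) x -
      (- k)^-1 * (P (- k + t) f x - P (- k + t) (P k f) x) =
     P (- k + t) (fun y => (P k (generator P f) y - generator P f y) -
       (k^-1 * (P k f y - f y) - generator P f y)) x.
    rewrite P_sub //; [|exact: bm_sub|].
      rewrite P_sub // P_sub //; last by apply: bm_scale; exact: bm_sub.
      rewrite P_scale //; last exact: bm_sub.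
      by rewrite P_sub // invrN; ring.
    by apply: bm_sub => //; apply: bm_scale; exact: bm_sub.
  apply: P_norm_le => //.
    by apply: bm_sub; apply: bm_sub => //; apply: bm_scale; exact: bm_sub.
  move=> y; apply: le_trans (ler_normB _ _) _.
  have a1 := K1 k k0 h1 y; have a2 := K2 k k0 h2 y.
  have : k * (C + 1) < e / 2 by rewrite -ltr_pdivlMr.
  lra.
- move: h1 h2 h3 h4; rewrite gtr0_norm // => h1 h2 h3 h4.
  have h0 := ltW hh; have t0' := ltW t0; have bPh := P_bm h0 bf.
  rewrite (addrC h) P_comp // -P_sub // -P_scale //; last exact: bm_sub.
  rewrite -P_sub //; last by apply: bm_scale; exact: bm_sub.
  apply: P_norm_le => //; first by apply: bm_sub => //; apply: bm_scale; exact: bm_sub.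
  by move=> y; rewrite distrC; apply: le_trans (K2 h hh h2 y) _; lra.
Qed.

End semigroup.

Lemma mean_value_le {R : realType} (g g' : R -> R) (t M : R) : 0 < t ->
  (forall s, 0 < s -> s <= t -> is_derive s 1 g (g' s)) ->
  (forall s, 0 < s -> s <= t -> `|g' s| <= M) ->
  (forall e : R, 0 < e -> \forall s \near 0^'+, `|g s - g 0| <= e) ->
  `|g t - g 0| <= M * t.
Proof.
move=> t0 dg bM rc.
have dc s : 0 < s -> s <= t -> {for s, continuous g}.
  by move=> s0 st; apply: differentiable_continuous; apply/derivable1_diffP; have [] := dg s s0 st.
have [s|s|c] := @MVT R g g' 0 t t0.
- by rewrite in_itv /= => /andP[s0 st]; apply: dg => //; exact: ltW.
- move: s; apply/continuous_within_itvP => //; split.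
  + by move=> s; rewrite in_itv /= => /andP[s0 st]; apply: dc => //; exact: ltW.
  + apply/cvgrPdist_le => e e0; have := rc e e0.
    by apply: filterS => s; rewrite distrC.
  + by apply: cvg_at_left_filter; exact: dc.
- rewrite in_itv /= => /andP[c0 ct] ->; rewrite subr0 normrM (gtr0_norm t0).
  by rewrite ler_pM2r //; apply: bM => //; exact: ltW.
Qed.

(** * The algebra and the carre du champ *)

Lemma at_right0I {R : realType} (m : R) (Q : R -> Prop) : 0 < m ->
  (forall s, 0 < s -> s < m -> Q s) -> \forall s \near 0^'+, Q s.
Proof.
move=> m0 H; near=> s; apply: H; first by [].
by near: s; exact: nbhs_right_lt.
Unshelve. all: by end_near. Qed.

Section algebra.
Context {d : measure_display} {E : measurableType d} {R : realType}
  {mu : {measure set E -> \bar R}} {P : R -> (E -> R) -> (E -> R)}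
  {A : set (E -> R)}.
Hypothesis hP : markov_semigroup mu P.
Hypothesis hA : nice_dense_algebra mu P A.
Implicit Types (f g h u v : E -> R) (t s : R).

Local Notation L := (generator P).
Local Notation Gam := (carre_du_champ P).

Lemma A_domain f : A f -> generator_domain P f.
Proof. exact: (alg_domain hA). Qed.

Lemma A_bm f : A f -> bounded_measurable f.
Proof. by case/A_domain. Qed.

Lemma A_bounded f : A f -> bounded_fct f.
Proof. by case/A_bm. Qed.

(** Constants are smooth images of any element, and density provides one. *)
Lemma A_cst (c : R) : A (fun=> c).
Proof.
have [|g Ag _] := alg_dense hA (f := fun=> 0) _ ltr01.
  split; first exact: measurable_cst.
  rewrite [X in (X < _)%E](_ : _ = 0%E) ?ltry //.
  by under eq_integral do rewrite expr0n; rewrite integral0.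
apply: (alg_smooth hA (phi := fun=> c) _ Ag).
by apply/smoothP => k; exact: derivable_upto_cst.
Qed.

Lemma A_add f g : A f -> A g -> A (fun x => f x + g x).
Proof. exact: (alg_add hA). Qed.

Lemma A_mul f g : A f -> A g -> A (fun x => f x * g x).
Proof. exact: (alg_mul hA). Qed.

Lemma A_scale (a : R) f : A f -> A (fun x => a * f x).
Proof. exact: (alg_scale hA). Qed.

Lemma A_opp f : A f -> A (fun x => - f x).
Proof. by move=> /(A_scale (-1)); under eq_fun do rewrite mulN1r. Qed.

Lemma A_sub f g : A f -> A g -> A (fun x => f x - g x).
Proof. by move=> Af Ag; apply: A_add => //; exact: A_opp. Qed.

Lemma A_L f : A f -> A (L f).
Proof. exact: (alg_generator hA). Qed.

Lemma A_P t f : 0 <= t -> A f -> A (P t f).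
Proof. exact: (alg_semigroup hA). Qed.

Lemma A_expR f : A f -> A (fun x => expR (f x)).
Proof.
by apply: (alg_smooth hA); apply/smoothP => k; exact: derivable_upto_expR.
Qed.

Lemma expR_lower_bound f : A f ->
  exists e : R, 0 < e /\ forall x, e <= expR (f x).
Proof.
move=> /A_bounded[C HC]; exists (expR (- C)); split=> [|x]; first exact: expR_gt0.
by rewrite ler_expR; have := HC x; rewrite ler_norml => /andP[].
Qed.

Lemma P_expR_gt0 f t x : A f -> 0 <= t -> 0 < P t (fun y => expR (f y)) x.
Proof.
move=> Af t0; have [e [e0 ef]] := expR_lower_bound Af.
by apply: lt_le_trans e0 (P_ge_cst hP _ t0 _ ef); apply: A_bm; exact: A_expR.
Qed.

Lemma A_ln f (e : R) : 0 < e -> (forall x, e <= f x) -> A f -> A (fun x => ln (f x)).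
Proof.
move=> e0 ef Af; have [rho [srho rho0 rhoE]] := smooth_truncation e0.
have <- : (fun y => ln (rho y)) \o f = (fun x => ln (f x)).
  by apply/funext => x /=; rewrite rhoE.
apply: (alg_smooth hA) => //; apply/smoothP => k.
by apply: derivable_upto_ln => //; exact: (smoothP rho).1.
Qed.

Lemma A_gamma f g : A f -> A g -> A (Gam f g).
Proof.
move=> Af Ag; apply: A_scale; apply: A_sub.
  by apply: A_sub; [apply: A_L; exact: A_mul|apply: A_mul => //; exact: A_L].
by apply: A_mul => //; exact: A_L.
Qed.

Lemma L_axpy (a : R) f g x : A f -> A g ->
  L (fun y => a * f y + g y) x = a * L f x + L g x.
Proof. by move=> Af Ag; apply: (generator_axpy hP); exact: A_domain. Qed.

Lemma L_cst (c : R) x : L (fun=> c) x = 0.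
Proof. exact: (generator_cst hP). Qed.

Lemma L_add f g x : A f -> A g -> L (fun y => f y + g y) x = L f x + L g x.
Proof.
move=> Af Ag; have := @L_axpy 1 f g x Af Ag.
by rewrite mul1r; under eq_fun do rewrite mul1r.
Qed.

Lemma L_scale (a : R) f x : A f -> L (fun y => a * f y) x = a * L f x.
Proof.
move=> Af; have := @L_axpy a f (fun=> 0) x Af (A_cst _).
by rewrite L_cst addr0; under eq_fun do rewrite addr0.
Qed.

Lemma L_sub f g x : A f -> A g -> L (fun y => f y - g y) x = L f x - L g x.
Proof.
move=> Af Ag; have := @L_axpy (-1) g f x Ag Af.
by rewrite mulN1r addrC => <-; congr generator; apply/funext => y; rewrite mulN1r addrC.
Qed.

Lemma L_mul f g x : L (fun y => f y * g y) x = f x * L g x + g x * L f x + 2 * Gam f g x.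
Proof. by rewrite /carre_du_champ; field. Qed.

Lemma generator_P_comm t f : 0 <= t -> A f -> L (P t f) = P t (L f).
Proof.
move=> t0 Af; apply/funext => x; apply: (generator_P hP) => //; first exact: A_domain.
by apply: A_bm; exact: A_L.
Qed.

Lemma P_right_continuous f x (e : R) : A f -> 0 < e ->
  \forall s \near 0^'+, `|P s f x - P 0 f x| <= e.
Proof.
move=> Af e0; have [C C1 HC] := bounded_fct_ge1 (A_bounded (A_L Af)).
have [del d0 K] := P_increment_small (A_domain Af) HC.
have m0 : 0 < Num.min del (e / (C + 1)).
  by rewrite lt_min d0 divr_gt0 //; lra.
apply: (at_right0I m0) => s s0; rewrite lt_min => /andP[sd se].
rewrite (P_0 hP) ?A_bm //; last exact: A_bm.
apply: le_trans (K s s0 sd x) _.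
by rewrite -ler_pdivlMr ?ltW //; lra.
Qed.

Lemma A_is_derive_P f t x : A f -> 0 < t -> is_derive t 1 (fun s => P s f x) (P t (L f) x).
Proof.
move=> Af t0; apply: (is_derive_P hP) => //; first exact: A_domain.
  by apply: A_domain; exact: A_L.
by apply: A_bounded; do 2!apply: A_L.
Qed.

Lemma P_taylor0 f : A f -> exists2 C : R, 1 <= C & forall t x, 0 <= t ->
  `|P t f x - f x| <= C * t.
Proof.
move=> Af; have [C C1 HC] := bounded_fct_ge1 (A_bounded (A_L Af)).
exists C => // t x; rewrite le_eqVlt => /predU1P[<-|t0].
  by rewrite (P_0 hP) ?subrr ?normr0 ?mulr0 //; exact: A_bm.
rewrite -[f x](P_0 hP) ?A_bm //; last exact: A_bm.
apply: (mean_value_le (g := fun s => P s f x) (g' := fun s => P s (L f) x)) => //.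
- by move=> s s0 _; exact: A_is_derive_P.
- move=> s s0 _; apply: (P_norm_le hP) => //; first exact: ltW.
  by apply: A_bm; exact: A_L.
- by move=> e e0; exact: P_right_continuous.
Qed.

(** The derivative in s of P_s f - s L f is P_s L f - L f, of order s. *)
Lemma P_taylor1 f : A f -> exists2 C : R, 1 <= C & forall t x, 0 <= t ->
  `|P t f x - f x - t * L f x| <= C * t ^+ 2.
Proof.
move=> Af; have [C C1 HC] := P_taylor0 (A_L Af).
exists C => // t x; rewrite le_eqVlt => /predU1P[<-|t0].
  rewrite (P_0 hP) ?A_bm //; last exact: A_bm.
  by rewrite subrr mul0r subr0 normr0 expr0n mulr0.
pose g s := P s f x + s * (- L f x).
have -> : P t f x - f x - t * L f x = g t - g 0.
  rewrite /g (P_0 hP); last exact: A_bm.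
  by ring.
rewrite expr2 mulrA.
apply: (mean_value_le (g := g) (g' := fun s => P s (L f) x + (1 * (- L f x) + s * 0))) => //.
- move=> s s0 _; apply: is_deriveD_fun; first exact: A_is_derive_P.
  exact: (is_deriveM_fun (is_derive_id s 1) (is_derive_cst (- L f x) s 1)).
- move=> s s0 st; rewrite mul1r mulr0 addr0; apply: le_trans (HC s x (ltW s0)) _.
  by rewrite ler_wpM2l //; lra.
- move=> e e0.
  have H1 := P_right_continuous x Af (ltac:(lra) : 0 < e / 2).
  have H2 : \forall s \near 0^'+, `|s * L f x| <= e / 2.
    have k0 : 0 < e / 2 / (`|L f x| + 1) by rewrite divr_gt0 //; lra.
    apply: (at_right0I k0) => s s0.
    rewrite ltr_pdivlMr; last by rewrite ltr_wpDl.
    rewrite normrM (gtr0_norm s0); have := normr_ge0 s; have := normr_ge0 (L f x); nra.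
  near=> s; rewrite /g mul0r addr0.
  have -> : P s f x + s * - L f x - P 0 f x = (P s f x - P 0 f x) - s * L f x by ring.
  apply: le_trans (ler_normB _ _) _.
  have -> : e = e / 2 + e / 2 by field.
  by apply: lerD; [near: s; exact: H1|near: s; exact: H2].
Unshelve. all: by end_near. Qed.

Lemma P_taylor2 f : A f -> exists2 C : R, 1 <= C & forall t x, 0 <= t ->
  `|P t f x - f x - t * L f x - t ^+ 2 * (L (L f) x / 2)| <= C * t ^+ 3.
Proof.
move=> Af; have [C C1 HC] := P_taylor1 (A_L Af).
have [C' C1' HC'] := P_taylor1 Af.
exists C => // t x; rewrite le_eqVlt => /predU1P[<-|t0].
  rewrite (P_0 hP) ?A_bm //; last exact: A_bm.
  by rewrite subrr !mul0r !subr0 expr0n mul0r subr0 normr0 expr0n mulr0.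
pose g s := P s f x + (s * (- L f x) + (s * s) * (- (L (L f) x / 2))).
have -> : P t f x - f x - t * L f x - t ^+ 2 * (L (L f) x / 2) = g t - g 0.
  rewrite /g (P_0 hP); last exact: A_bm.
  by ring.
rewrite (exprSr t 2) mulrA.
apply: (mean_value_le (g := g) (g' := fun s => P s (L f) x + ((1 * (- L f x) + s * 0) +
   ((1 * s + s * 1) * (- (L (L f) x / 2)) + s * s * 0)))) => //.
- move=> s s0 _; apply: is_deriveD_fun; first exact: A_is_derive_P.
  apply: is_deriveD_fun.
    exact: (is_deriveM_fun (is_derive_id s 1) (is_derive_cst (- L f x) s 1)).
  apply: (is_deriveM_fun (f := fun s => s * s) (g := fun=> _)) => //.
  exact: (is_deriveM_fun (is_derive_id s 1) (is_derive_id s 1)).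
- move=> s s0 st.
  have -> : P s (L f) x + (1 * - L f x + s * 0 + ((1 * s + s * 1) * - (L (L f) x / 2) + s * s * 0))
     = P s (L f) x - L f x - s * L (L f) x by field.
  apply: le_trans (HC s x (ltW s0)) _.
  rewrite ler_wpM2l //; first lra.
  by rewrite !expr2; apply: ler_pM => //; exact: ltW.
- move=> e e0.
  pose K := C' + `|L (L f) x / 2|.
  have K0 : 1 <= K by rewrite /K; have := normr_ge0 (L (L f) x / 2); lra.
  have k0 : 0 < Num.min 1 (e / (K + `|L f x| + 1)).
    rewrite lt_min ltr01 divr_gt0 //; have := normr_ge0 (L f x); lra.
  apply: (at_right0I k0) => s s0.
  rewrite lt_min ltr_pdivlMr; last by have := normr_ge0 (L f x); lra.
  move=> /andP[s1 se].
  have -> : g s - g 0 = (P s f x - f x - s * L f x) - s * (s * (L (L f) x / 2)).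
    rewrite /g (P_0 hP); last exact: A_bm.
    by ring.
  apply: le_trans (ler_normB _ _) _.
  have := HC' s x (ltW s0).
  rewrite !normrM !(gtr0_norm s0) -normrM expr2.
  have := normr_ge0 (L (L f) x / 2); have := normr_ge0 (L f x).
  rewrite /K in se K0; set a := `|L f x| in se *; set b := `|L (L f) x / 2| in se K0 *.
  set c := `|_ - _|; nra.
Qed.

Lemma P_is_jet2 f : A f ->
  exists C : R, 1 <= C /\ forall t x, 0 <= t ->
  `|P t f x - (f x + t * L f x + t ^+ 2 * (L (L f) x / 2))| <= C * `|t| ^+ 3.
Proof.
move=> Af; have [C C1 HC] := P_taylor2 Af; exists C; split=> // t x t0.
by rewrite (ger0_norm t0) !opprD !addrA; exact: HC.
Qed.

Lemma gamma_sym f g x : Gam f g x = Gam g f x.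
Proof.
rewrite /carre_du_champ; have -> : (fun y => f y * g y) = (fun y => g y * f y).
  by apply/funext => y; rewrite mulrC.
by ring.
Qed.

Lemma gamma_axpy (a : R) f g u x : A f -> A g -> A u ->
  Gam (fun y => a * f y + g y) u x = a * Gam f u x + Gam g u x.
Proof.
move=> Af Ag Au; rewrite /carre_du_champ L_axpy //.
have -> : (fun y => (a * f y + g y) * u y) = (fun y => a * (f y * u y) + g y * u y).
  by apply/funext => y; ring.
by rewrite L_axpy; [ring|exact: A_mul|exact: A_mul].
Qed.

Lemma gamma_cst (c : R) u x : A u -> Gam (fun=> c) u x = 0.
Proof. by move=> Au; rewrite /carre_du_champ L_scale // L_cst; ring. Qed.

Lemma gamma_add f g u x : A f -> A g -> A u ->
  Gam (fun y => f y + g y) u x = Gam f u x + Gam g u x.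
Proof.
move=> Af Ag Au; have := @gamma_axpy 1 f g u x Af Ag Au.
by rewrite mul1r; under eq_fun do rewrite mul1r.
Qed.

Lemma gamma_scale (a : R) f u x : A f -> A u ->
  Gam (fun y => a * f y) u x = a * Gam f u x.
Proof.
move=> Af Au; have := @gamma_axpy a f (fun=> 0) u x Af (A_cst _) Au.
by rewrite gamma_cst // addr0; under eq_fun do rewrite addr0.
Qed.

(** For c = f x, the function (f - c)^2 is nonnegative and vanishes at x, so its
    generator is nonnegative there; that value is 2 Gamma(f)(x). *)
Lemma gamma_ge0 f x : A f -> 0 <= Gam f f x.
Proof.
move=> Af; set c := f x.
have Aff := A_mul Af Af.
have Al : A (fun y => - 2 * c * f y + c * c) by apply: A_add; [exact: A_scale|exact: A_cst].
have AW : A (fun y => (f y - c) * (f y - c)).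
  by apply: A_mul; apply: A_sub => //; exact: A_cst.
have LW : L (fun y => (f y - c) * (f y - c)) x = 2 * Gam f f x.
  have -> : (fun y => (f y - c) * (f y - c)) =
      (fun y => f y * f y + (- 2 * c * f y + c * c)) by apply/funext => y; ring.
  rewrite L_add // L_axpy //; last exact: A_cst.
  by rewrite L_cst L_mul -/c; ring.
have [C C1 HC] := P_taylor1 AW.
rewrite -(pmulr_rge0 _ (ltr0n R 2)) -LW leNgt; apply/negP => l0.
set l := L _ x in LW l0 HC.
(* Any time t below - l / C would contradict the expansion. *)
pose t := - l / (2 * C).
have t0 : 0 < t by rewrite divr_gt0 //; lra.
have := HC t x (ltW t0); rewrite subrr mulr0 subr0.
have p0 : 0 <= P t (fun y => (f y - c) * (f y - c)) x.
  by apply: (P_ge0 hP); [exact: ltW|exact: A_bm|move=> y; rewrite -expr2 sqr_ge0].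
rewrite ler_norml => /andP[_]; rewrite -/l.
have tC : 2 * C * t = - l by rewrite /t; field; lra.
have : l * t < 0 by rewrite pmulr_llt0.
rewrite expr2; nra.
Qed.

(** Cauchy-Schwarz for the nonnegative form Gamma at the point x. *)
Lemma gamma_null f u x : A f -> A u -> Gam f f x = 0 -> Gam f u x = 0.
Proof.
move=> Af Au f0; have H (k : R) : 0 <= 2 * k * Gam f u x + Gam u u x.
  have Ak := A_scale k Af; have Aku := A_add Ak Au.
  have := gamma_ge0 x Aku; rewrite gamma_axpy // gamma_sym gamma_axpy //.
  by rewrite f0 (gamma_sym _ (fun y => k * f y + u y)) gamma_axpy // (gamma_sym u f); lra.
apply/eqP; rewrite -[_ == _]negbK; apply/negP => n0.
(* The expression is affine in k, and this k gives it the value -1. *)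
have := H (- (Gam u u x + 1) / (2 * Gam f u x)).
have -> : 2 * (- (Gam u u x + 1) / (2 * Gam f u x)) * Gam f u x = - (Gam u u x + 1) by field.
lra.
Qed.

Section diffusion_calculus.
Hypothesis hD : diffusion P A.

Lemma derivable_upto2 (phi : R -> R) : smooth phi ->
  (forall y : R, is_derive y 1 phi (derive1 phi y)) /\
  (forall y : R, is_derive y 1 (derive1 phi) (derive1n 2 phi y)).
Proof.
move=> sphi; split=> y; rewrite ?derive1nS derive1E; apply: derivableP.
  exact: (sphi 0%N).
exact: (sphi 1%N).
Qed.

Lemma diffusionE (phi p1 p2 : R -> R) f x : smooth phi -> A f ->
  (forall y : R, is_derive y 1 phi (p1 y)) -> (forall y : R, is_derive y 1 p1 (p2 y)) ->
  L (fun y => phi (f y)) x = p1 (f x) * L f x + p2 (f x) * Gam f f x.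
Proof.
move=> sphi Af d1 d2; have := hD sphi Af x.
have E1 : derive1 phi = p1 by apply/funext => y; rewrite derive1E; have [_ ->] := d1 y.
rewrite derive1nS derive1n1 E1.
by rewrite derive1E; have [_ ->] := d2 (f x).
Qed.

Lemma gamma_smooth (phi : R -> R) f x : smooth phi -> A f ->
  Gam (fun y => phi (f y)) (fun y => phi (f y)) x = (derive1 phi (f x)) ^+ 2 * Gam f f x.
Proof.
move=> sphi Af; have [d1 d2] := derivable_upto2 sphi.
rewrite {1}/carre_du_champ (diffusionE x sphi Af d1 d2).
have s2 : smooth (fun y => phi y * phi y).
  by apply/smoothP => k; apply: derivable_upto_mul; exact: (smoothP phi).1.
have e1 (y : R) : is_derive y 1 (fun y => phi y * phi y) (derive1 phi y * phi y + phi y * derive1 phi y).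
  exact: (is_deriveM_fun (d1 y) (d1 y)).
have e2 (y : R) : is_derive y 1 (fun y => derive1 phi y * phi y + phi y * derive1 phi y)
   ((derive1n 2 phi y * phi y + derive1 phi y * derive1 phi y) +
    (derive1 phi y * derive1 phi y + phi y * derive1n 2 phi y)).
  exact: (is_deriveD_fun (is_deriveM_fun (d2 y) (d1 y)) (is_deriveM_fun (d1 y) (d2 y))).
rewrite (diffusionE (phi := fun y => phi y * phi y) x s2 Af e1 e2).
by field.
Qed.

(** The diffusion property only speaks of functions of a single f.  At the point x
    the function r = phi(f) - phi'(f x) f satisfies Gamma(r)(x) = 0, hence
    Gamma(r, u)(x) = 0 for every u. *)
Lemma gamma_chain (phi : R -> R) f u x : smooth phi -> A f -> A u ->
  Gam (fun y => phi (f y)) u x = derive1 phi (f x) * Gam f u x.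
Proof.
move=> sphi Af Au; set c := derive1 phi (f x).
have [d1 d2] := derivable_upto2 sphi.
pose psi (y : R) := - c * y + phi y.
have spsi : smooth psi.
  apply/smoothP => k; apply: derivable_upto_add; last exact: (smoothP phi).1.
  by apply: derivable_upto_mul; [exact: derivable_upto_cst|exact: derivable_upto_id].
have Ap : A (fun y => phi (f y)) by exact: (alg_smooth hA).
have dpsi : derive1 psi (f x) = 0.
  have dp : is_derive (f x) 1 psi ((0 * f x + - c * 1) + derive1 phi (f x)).
    apply: (is_deriveD_fun _ (d1 (f x))).
    exact: (is_deriveM_fun (is_derive_cst (- c) (f x) 1) (is_derive_id (f x) 1)).
  by rewrite derive1E; have [_ ->] := dp; rewrite -/c; ring.
have := @gamma_null (fun y => psi (f y)) u x (alg_smooth hA spsi Af) Au.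
rewrite gamma_smooth // dpsi expr0n mul0r => /(_ erefl).
by rewrite gamma_axpy // mulNr => /eqP; rewrite addrC subr_eq0 => /eqP.
Qed.

Lemma derive1_expR (y : R) : derive1 expR y = expR y.
Proof. by rewrite derive1E; have [_ ->] := is_derive_expR y. Qed.

Lemma gamma_expR f u x : A f -> A u ->
  Gam (fun y => expR (f y)) u x = expR (f x) * Gam f u x.
Proof.
move=> Af Au; rewrite (gamma_chain (phi := expR)) ?derive1_expR //.
by apply/smoothP => k; exact: derivable_upto_expR.
Qed.

Lemma L_expR f x : A f -> L (fun y => expR (f y)) x = expR (f x) * (L f x + Gam f f x).
Proof.
move=> Af; rewrite (diffusionE (phi := expR) (p1 := expR) (p2 := expR)) //; first by ring.
by apply/smoothP => k; exact: derivable_upto_expR.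
Qed.

Lemma gamma_sqr f u x : A f -> A u ->
  Gam (fun y => f y * f y) u x = 2 * f x * Gam f u x.
Proof.
move=> Af Au; rewrite (gamma_chain (phi := fun y => y * y)) //.
  have dy : is_derive (f x) 1 (fun y : R => y * y) (1 * f x + f x * 1).
    exact: (is_deriveM_fun (is_derive_id (f x) 1) (is_derive_id (f x) 1)).
  by rewrite derive1E; have [_ ->] := dy; ring.
by apply/smoothP => k; apply: derivable_upto_mul; exact: derivable_upto_id.
Qed.

(** Polarisation of the chain rule for the square. *)
Lemma gamma_mul f g u x : A f -> A g -> A u ->
  Gam (fun y => f y * g y) u x = f x * Gam g u x + g x * Gam f u x.
Proof.
move=> Af Ag Au; have Afg := A_mul Af Ag.
have Aff := A_mul Af Af; have Agg := A_mul Ag Ag.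
have Afpg := A_add Af Ag.
have := gamma_sqr x Afpg Au.
have -> : (fun y => (f y + g y) * (f y + g y)) =
   (fun y => f y * f y + (2 * (f y * g y) + g y * g y)) by apply/funext => y; ring.
rewrite (@gamma_add (fun y => f y * f y)) //; last by apply: A_add => //; exact: A_scale.
rewrite (@gamma_axpy 2 (fun y => f y * g y)) // gamma_sqr // gamma_sqr // gamma_add // => H; lra.
Qed.

(** B and the term subtracted from L B are the first and second order
    coefficients, in r, of P_r (F ln F) - P_r F ln P_r F.  The appearance of Gamma_2
    comes from the derivation property of Gamma applied to L F = F (L h + Gamma(h)). *)
Lemma entropy_second_order h x : A h ->
  let F := fun y => expR (h y) in
  let B := fun y => F y * Gam h h y in
  (forall y, L (fun z => F z * h z) y - (1 + h y) * L F y = B y) /\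
  (forall y, L F y - F y * L h y = B y) /\
  L B x - 2^-1 * (L (L (fun z => F z * h z)) x - (1 + h x) * L (L F) x - L F x ^+ 2 / F x)
    = F x * gamma2 P h x.
Proof.
move=> Ah F B; have AF := A_expR Ah.
have AG := A_gamma Ah Ah; have ALh := A_L Ah; have ALF := A_L AF.
have LF y : L F y = F y * (L h y + Gam h h y) by exact: L_expR.
have AB : A B by exact: A_mul.
have gF u y : A u -> Gam F u y = F y * Gam h u y by exact: gamma_expR.
have e1 y : L (fun z => F z * h z) y = (1 + h y) * L F y + B y.
  by rewrite L_mul /B gF // LF; ring.
split; first by move=> y; rewrite e1; ring.
split; first by move=> y; rewrite LF /B; ring.
have -> : L (fun z => F z * h z) = (fun y => (L F y + h y * L F y) + B y).
  by apply/funext => y; rewrite e1; ring.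
have AhLF := A_mul Ah ALF.
rewrite L_add //; last exact: A_add.
rewrite L_add // L_mul.
have -> : L F = (fun y => F y * (L h y + Gam h h y)) by apply/funext.
rewrite gamma_sym gamma_mul //; last exact: A_add.
rewrite gamma_add // gF //.
rewrite {1 2}/B L_mul (LF x) gF // /gamma2 (gamma_sym (Gam h h)) (gamma_sym (L h)).
by field; rewrite gt_eqF // expR_gt0.
Qed.

End diffusion_calculus.

End algebra.

(** * Expansions along the semigroup *)

Section more_jets.
Context {R : realType} {X : Type}.
Implicit Types (G H : R -> X -> R) (a b c : X -> R).

Lemma jet1_near G H a b : jet1 G a b -> unifO 2 (fun h x => H h x - G h x) ->
  jet1 H a b.
Proof.
move=> [ba bb OG] OH; split=> //.
by apply: unifO_eq (unifO_add OH OG) => h x; ring.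
Qed.

Lemma jet2_near G H a b c : jet2 G a b c -> unifO 3 (fun h x => H h x - G h x) ->
  jet2 H a b c.
Proof.
move=> [ba bb bc OG] OH; split=> //.
by apply: unifO_eq (unifO_add OH OG) => h x; ring.
Qed.

Lemma jet2_var_mul G a b : jet1 G a b ->
  jet2 (fun h x => h * G h x) (fun=> 0) a b.
Proof.
move=> [ba bb OG]; split=> //; first exact: bounded_fct_cst.
have V : unifO 1 (fun h (_ : X) => h : R) by exact: unifO_var.
by apply: unifO_eq (unifO_mul V OG) => h x; ring.
Qed.

Lemma jet2_var2_mul G a b : jet1 G a b ->
  jet2 (fun h x => h ^+ 2 * G h x) (fun=> 0) (fun=> 0) a.
Proof.
move=> jG; have O1 := jet1_unifO1 jG; case: jG => ba bb OG; split=> //; try exact: bounded_fct_cst.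
have V : unifO 1 (fun h (_ : X) => h : R) by exact: unifO_var.
by apply: unifO_eq (unifO_mul (unifO_mul V V) O1) => h x; ring.
Qed.

Lemma jet1_small G a b (e : R) : 0 < e -> jet1 G a b ->
  exists C : R, 1 <= C /\ forall h, C * `|h| <= 1 -> forall x, `|G h x - a x| <= e.
Proof. by move=> e0 /jet1_unifO1; exact: unifO_small. Qed.

End more_jets.

Lemma sjet1_pos {R : realType} (g : R -> R) a b : sjet1 g a b -> 0 < a ->
  exists C : R, 1 <= C /\ forall h, C * `|h| <= 1 -> 0 < g h.
Proof.
move=> J a0; have a2 : 0 < a / 2 by rewrite divr_gt0.
have [C [C1 H]] := jet1_small a2 J; exists C; split=> // h hh.
by have := H h hh tt; rewrite ler_norml => /andP[]; lra.
Qed.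

Section semigroup_jets.
Context {d : measure_display} {E : measurableType d} {R : realType}
  {mu : {measure set E -> \bar R}} {P : R -> (E -> R) -> (E -> R)}
  {A : set (E -> R)}.
Hypothesis hP : markov_semigroup mu P.
Hypothesis hA : nice_dense_algebra mu P A.
Implicit Types (f g : E -> R) (t s : R).

Local Notation L := (generator P).

(** Continuing P_t f to negative times by its second order Taylor polynomial makes
    all expansions two-sided, at t = 0 in particular. *)
Definition extended_semigroup t f : E -> R :=
  if 0 <= t then P t f else fun x => f x + t * L f x + t ^+ 2 * (L (L f) x / 2).
Local Notation T := extended_semigroup.

Lemma extended_semigroupE t f : 0 <= t -> T t f = P t f.
Proof. by rewrite /extended_semigroup => ->. Qed.

Lemma P0_eq f : A f -> P 0 f = f.
Proof. by move=> Af; apply/funext => x; rewrite (P_0 hP) //; exact: (A_bm hA). Qed.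

Lemma A_T t f : A f -> A (T t f).
Proof.
move=> Af; rewrite /extended_semigroup; case: ifP => t0; first exact: (A_P hA).
have AL := A_L hA Af; have ALL := A_L hA AL.
apply: (A_add hA); first by apply: (A_add hA) => //; exact: (A_scale hA).
apply: (A_scale hA).
have -> : (fun x => L (L f) x / 2) = (fun x => 2^-1 * L (L f) x).
  by apply/funext => x; rewrite mulrC.
exact: (A_scale hA).
Qed.

Lemma A_half f : A f -> A (fun x => f x / 2).
Proof.
move=> Af; have -> : (fun x => f x / 2) = (fun x => 2^-1 * f x).
  by apply/funext => x; rewrite mulrC.
exact: (A_scale hA).
Qed.

Lemma T_jet2 f : A f -> jet2 (fun h => T h f) f (L f) (fun x => L (L f) x / 2).
Proof.
move=> Af; have AL := A_L hA Af; have ALL := A_L hA AL.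
split; try exact: (A_bounded hA).
  by apply: (A_bounded hA); exact: A_half.
have [C [C1 HC]] := P_is_jet2 hP hA Af; exists C; split=> // h _ x.
rewrite /extended_semigroup; case: ifP => h0; first exact: HC.
by rewrite subrr normr0 mulr_ge0 ?exprn_ge0 // (le_trans ler01 C1).
Qed.

(** For negative increments the comparison is made through P_{t+h}, with t + h < t:
    the two terms are the first order error at time 0 and h times the increment of
    L f. *)
Lemma T_jet1_at t f : A f -> 0 <= t ->
  jet1 (fun h => T (t + h) f) (P t f) (P t (L f)).
Proof.
move=> Af; rewrite le_eqVlt => /predU1P[<-|t0].
  have := jet2_jet1 (T_jet2 Af); rewrite (P0_eq Af) (P0_eq (A_L hA Af)).
  by apply: jet1_eq => // h x; rewrite add0r.
have AL := A_L hA Af; have t0' := ltW t0.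
split; try by apply: (A_bounded hA); exact: (A_P hA).
have [C C1 HC] := P_taylor1 hP hA Af.
have [C' C1' HC'] := P_taylor0 hP hA AL.
exists (C + C' + t^-1); have ti : 0 < t^-1 by rewrite invr_gt0.
split=> [|h hh x]; first lra.
have th : `|h| <= t.
  have : t^-1 * `|h| <= 1.
    apply: le_trans hh; rewrite ler_wpM2r //; lra.
  by rewrite mulrC ler_pdivrMr // mul1r.
have th0 : 0 <= t + h by move: th; rewrite ler_norml => /andP[]; lra.
rewrite extended_semigroupE // real_normK ?num_real //.
have bf := A_bm hA Af; have bL := A_bm hA AL.
have h2 : 0 <= h ^+ 2 by rewrite sqr_ge0.
have h2t : 0 <= t^-1 * h ^+ 2 by rewrite mulr_ge0 // ltW.
case: (leP 0 h) => h0.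
  have bPf := P_bm hP h0 bf.
  have -> : P (t + h) f x - (P t f x + h * P t (L f) x) =
            P t (fun y => P h f y - f y - h * L f y) x.
    rewrite (P_sub hP) //; [|exact: bm_sub|exact: bm_scale].
    by rewrite (P_sub hP) // (P_scale hP) // (P_comp hP) //; ring.
  apply: le_trans (P_norm_le hP (c := C * h ^+ 2) _ t0' _ _) _.
  - by apply: bm_sub; [exact: bm_sub|exact: bm_scale].
  - by move=> y; exact: HC.
  - nra.
have k0 : 0 <= - h by lra.
have bPf := P_bm hP k0 bf; have bPL := P_bm hP k0 bL.
have Et g : bounded_measurable g -> P t g x = P (t + h) (P (- h) g) x.
  by move=> bg; rewrite -(P_comp hP) // addrK.
rewrite (Et f) // (Et (L f)) //.
have -> : P (t + h) f x - (P (t + h) (P (- h) f) x + h * P (t + h) (P (- h) (L f)) x) =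
   P (t + h) (fun y => (- h) * (P (- h) (L f) y - L f y) - (P (- h) f y - f y - (- h) * L f y)) x.
  rewrite (P_sub hP) //.
  - rewrite (P_scale hP) //; last exact: bm_sub.
    rewrite (P_sub hP) // (P_sub hP) //; [|exact: bm_sub|exact: bm_scale].
    by rewrite (P_sub hP) // (P_scale hP) //; ring.
  - by apply: bm_scale; exact: bm_sub.
  - by apply: bm_sub; [exact: bm_sub|exact: bm_scale].
apply: le_trans (P_norm_le hP (c := (C + C') * h ^+ 2) _ th0 _ _) _.
- by apply: bm_sub; [apply: bm_scale; exact: bm_sub|apply: bm_sub; [exact: bm_sub|exact: bm_scale]].
- move=> y; apply: le_trans (ler_normB _ _) _.
  have := HC _ y k0; rewrite sqrrN => a1.
  have a2 : `|- h * (P (- h) (L f) y - L f y)| <= C' * h ^+ 2.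
    rewrite normrM (ger0_norm k0); have := HC' _ y k0; nra.
  lra.
- nra.
Qed.

Lemma T_jet1 f (tau : R -> R) t tau1 : A f -> 0 <= t -> sjet1 tau t tau1 ->
  jet1 (fun h => T (tau h) f) (P t f) (fun x => tau1 * P t (L f) x).
Proof.
move=> Af t0 jt; have [ba bb OT] := T_jet1_at Af t0.
have jtE := jet1_of_scalar E jt.
split=> //; first by apply: bounded_fctM => //; exact: bounded_fct_cst.
have OC := unifO_comp (r := fun h => tau h - t) OT.
have [D [D1 HD]] := jet1_unifO1 jt.
have {}OC := OC (ex_intro _ D (conj D1 (fun h hh => HD h hh tt))).
case: jtE => _ _ Otau.
have := unifO_add OC (unifO_mul Otau (unifO0 bb)).
apply: unifO_eq => h x; rewrite (_ : t + (tau h - t) = tau h); ring.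
Qed.

Lemma P_remainder N (u : R -> R) u0 u1 (W : R -> E -> R) : sjet1 u u0 u1 -> 0 < u0 ->
  (forall h, measurable_fun setT (W h)) -> unifO N W ->
  unifO N (fun h => P (u h) (W h)).
Proof.
move=> ju up mW [C [C1 HC]]; have [D [D1 HD]] := sjet1_pos ju up.
exists (C + D); split=> [|h hh x]; first lra.
have h0 : 0 <= `|h| by [].
have hC : C * `|h| <= 1 by nra.
have hD : D * `|h| <= 1 by nra.
apply: le_trans (P_norm_le hP (c := C * `|h| ^+ N) _ (ltW (HD h hD)) _ (HC h hC)) _.
  by split=> //; exists (C * `|h| ^+ N) => y; exact: HC.
by rewrite ler_wpM2r ?exprn_ge0 //; lra.
Qed.

(** The remainder of W is handled by contractivity; its first two coefficients are
    in A, where the dependence of P_{u(h)} on h is differentiable. *)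
Lemma P_jet1 (u : R -> R) u0 u1 (W : R -> E -> R) a b : sjet1 u u0 u1 -> 0 < u0 ->
  (forall h, measurable_fun setT (W h)) -> A a -> A b -> jet1 W a b ->
  jet1 (fun h => P (u h) (W h)) (P u0 a) (fun x => P u0 b x + u1 * P u0 (L a) x).
Proof.
move=> ju up mW Aa Ab jW.
have ja := T_jet1 Aa (ltW up) ju; have jb := T_jet1 Ab (ltW up) ju.
have jvar : jet1 (fun h (_ : E) => 0 + h * 1 : R) (fun=> 0) (fun=> 1) by exact: jet1_affine.
have jS := jet1_add ja (jet1_mul jvar jb).
have := jet1_near jS (H := fun h => P (u h) (W h)).
case: jW => _ _ OR.
have ba := A_bm hA Aa; have bb := A_bm hA Ab.
have mR h : measurable_fun setT (fun x => W h x - (a x + h * b x)).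
  by apply: measurable_funB => //; case: (bm_add ba (bm_scale h bb)).
have OP := P_remainder ju up mR OR.
move=> K; apply: jet1_eq (K _) => // [x|x|]; [by rewrite mul0r addr0|by ring|].
apply: unifO_near OP; have [D [D1 HD]] := sjet1_pos ju up.
have [C [C1 HC]] := OR.
exists (C + D); split=> [|h hh x]; first lra.
have h0 : 0 <= `|h| by [].
have hC : C * `|h| <= 1 by nra.
have hD : D * `|h| <= 1 by nra.
have uh := ltW (HD h hD).
rewrite !extended_semigroupE //.
have bab := bm_add ba (bm_scale h bb).
have bR : bounded_measurable (fun x => W h x - (a x + h * b x)).
  by split=> //; exists (C * `|h| ^+ 2) => y; exact: HC.
have EW : W h = (fun x => (W h x - (a x + h * b x)) + (a x + h * b x)).
  by apply/funext => y; rewrite subrK.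
rewrite [in leLHS]EW (P_add hP) // (P_add hP _ uh ba) ?(P_scale hP) //; last exact: bm_scale.
by rewrite le_eqVlt; apply/orP; left; apply/eqP; congr (`|_|); ring.
Qed.

(** Since W vanishes at r = 0, first order knowledge of r -> P_{s-r} b suffices for
    a second order expansion. *)
Lemma P_jet2_backward s (W : R -> E -> R) b c : 0 < s ->
  (forall h, measurable_fun setT (W h)) -> A b -> A c -> jet2 W (fun=> 0) b c ->
  jet2 (fun r => P (s - r) (W r)) (fun=> 0) (P s b) (fun x => P s (fun y => c y - L b y) x).
Proof.
move=> sp mW Ab Ac jW.
have ju : sjet1 (fun r => s - r) s (- 1).
  have := @jet1_affine R unit s (-1).
  by apply: jet1_eq => // h _; rewrite mulrN1.
have jb := T_jet1 Ab (ltW sp) ju; have jc := T_jet1 Ac (ltW sp) ju.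
have jS := jet2_add (jet2_var_mul jb) (jet2_var2_mul jc).
have := jet2_near jS (H := fun r => P (s - r) (W r)).
case: jW => _ _ _ OR.
have bb := A_bm hA Ab; have bc := A_bm hA Ac; have bL := A_bm hA (A_L hA Ab).
have mR h : measurable_fun setT (fun x => W h x - (0 + h * b x + h ^+ 2 * c x)).
  apply: measurable_funB => //.
  by case: (bm_add (bm_add (bm_cst (0 : R)) (bm_scale h bb)) (bm_scale (h ^+ 2) bc)).
have OP := P_remainder ju sp mR OR.
move=> K; apply: jet2_eq (K _) => // [x|x|x|]; [by rewrite addr0|by rewrite addr0| |].
  by rewrite (P_sub hP) ?(ltW sp) //; ring.
apply: unifO_near OP; have [D [D1 HD]] := sjet1_pos ju sp.
have [C [C1 HC]] := OR.
exists (C + D); split=> [|h hh x]; first lra.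
have h0 : 0 <= `|h| by [].
have hC : C * `|h| <= 1 by nra.
have hD : D * `|h| <= 1 by nra.
have uh := ltW (HD h hD).
rewrite !extended_semigroupE //.
have bb1 := bm_add (bm_cst (0 : R)) (bm_scale h bb).
have bbc := bm_add bb1 (bm_scale (h ^+ 2) bc).
have bR : bounded_measurable (fun x => W h x - (0 + h * b x + h ^+ 2 * c x)).
  by split=> //; exists (C * `|h| ^+ 3) => y; exact: HC.
have EW : W h = (fun x => (W h x - (0 + h * b x + h ^+ 2 * c x)) + (0 + h * b x + h ^+ 2 * c x)).
  by apply/funext => y; rewrite subrK.
rewrite [in leLHS]EW (P_add hP) // (P_add hP _ uh bb1) ?(P_scale hP) //; last exact: bm_scale.
rewrite (P_add hP _ uh (bm_cst 0)) ?(P_scale hP) ?(P_cst hP) //; last exact: bm_scale.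
by rewrite le_eqVlt; apply/orP; left; apply/eqP; congr (`|_|); ring.
Qed.

End semigroup_jets.

(** * The entropy along the semigroup *)

(** The local inequality with ln w replaced by its tangents k w - 1 - ln k. *)
Definition linear_log_sobolev d (E : measurableType d) (R : realType)
    (P : R -> (E -> R) -> (E -> R)) (A : set (E -> R)) (n : R) : Prop :=
  forall h, A h -> forall t k x, 0 < t -> 0 < k ->
  forall F, F = (fun y => expR (h y)) ->
  entropy P t F x <= t * generator P (P t F) x
    - k * t * P t (fun y => F y * generator P h y) x
    + n / 2 * P t F x * (k - 1 - ln k).

Section barrier.
Context {R : realType}.
Variables (Lp c t e C : R).

(** The derivative y of this function, up to the constant Lp, is
    - e / (c (t + e s)) + C / (t + e s)^2, and
    y' = c y^2 - c C^2 / (t + e s)^4: a strict supersolution of y' = c y^2 as soon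
    as C is not 0. *)
Definition barrier (s : R) : R :=
  s * Lp - c^-1 * ln (t + e * s) + C * (s * (t * (t + e * s))^-1).

Definition barrier1 (s : R) : R := Lp - c^-1 * (e / (t + e * s)) + C / (t + e * s) ^+ 2.

Definition barrier2 (s : R) : R :=
  c^-1 * (e / (t + e * s)) ^+ 2 / 2 - C * e / (t + e * s) ^+ 3.

Lemma barrier_jet2 s : 0 < t -> 0 < t + e * s ->
  sjet2 (fun r => barrier (s + r)) (barrier s) (barrier1 s) (barrier2 s).
Proof.
move=> t0 D0; set D := t + e * s in D0.
have js : jet2 (fun r (_ : unit) => s + r * 1) (fun=> s) (fun=> 1) (fun=> 0) by exact: jet2_affine.
have jD : jet2 (fun r (_ : unit) => D + r * e) (fun=> D) (fun=> e) (fun=> 0) by exact: jet2_affine.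
have jl := jet2_ln D0 (fun=> lexx D) jD.
have jtD := jet2_scale t jD.
have tD0 : 0 < t * D by rewrite mulr_gt0.
have ji := jet2_inv tD0 (fun=> ler_norm (t * D)) jtD.
have jB := jet2_add (jet2_add (jet2_scale Lp js) (jet2_scale (- c^-1) jl)) (jet2_scale C (jet2_mul js ji)).
have DE r : t + e * (s + r) = D + r * e by rewrite /D; ring.
have tn : t != 0 by rewrite gt_eqF.
have Dn : D != 0 by rewrite gt_eqF.
apply: jet2_eq jB => [r _|_|_|_]; rewrite /barrier /barrier1 /barrier2 ?DE; set ci := c^-1.
- by ring.
- by rewrite /D; ring.
- by rewrite /D; field; rewrite -/D Dn tn.
- by rewrite /D; field; rewrite -/D Dn tn.
Qed.

Lemma barrier_gap : 0 < t -> 0 < t + e * t ->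
  barrier t - barrier 0 = t * Lp - c^-1 * ln ((t + e * t) / t) + C / (t + e * t).
Proof.
move=> t0 D0; rewrite /barrier mulr0 addr0 ln_div ?posrE //.
set ci := c^-1; field; rewrite !gt_eqF //.
Qed.

Lemma barrier_strict s : 0 < c -> C != 0 -> 0 < t + e * s ->
  barrier2 s < c / 2 * (barrier1 s - Lp) ^+ 2.
Proof.
move=> c0 C0 D0; rewrite -subr_gt0.
have -> : c / 2 * (barrier1 s - Lp) ^+ 2 - barrier2 s = c / 2 * (C / (t + e * s) ^+ 2) ^+ 2.
  by rewrite /barrier1 /barrier2; field; rewrite !gt_eqF.
rewrite mulr_gt0 ?divr_gt0 // lt0r sqr_ge0 sqrf_eq0 mulf_neq0 //.
by rewrite invr_eq0 expf_eq0 /= gt_eqF.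
Qed.

End barrier.

Section entropy_flow.
Context {d : measure_display} {E : measurableType d} {R : realType}
  {mu : {measure set E -> \bar R}} {P : R -> (E -> R) -> (E -> R)}
  {A : set (E -> R)}.
Hypothesis hP : markov_semigroup mu P.
Hypothesis hA : nice_dense_algebra mu P A.
Hypothesis hD : diffusion P A.
Implicit Types (f g : E -> R) (t s : R).

Local Notation L := (generator P).
Local Notation Gam := (carre_du_champ P).
Local Notation T := (@extended_semigroup d E R P).

Definition entropy_path t f s : E -> R :=
  fun y => T (t - s) f y * ln (T (t - s) f y).

Definition entropy_flow t f s : E -> R := P s (entropy_path t f s).

Lemma measurable_A f : A f -> measurable_fun setT f.
Proof. by case/(A_bm hA). Qed.

Lemma measurable_xlnx f : A f -> measurable_fun setT (fun y => f y * ln (f y)).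
Proof.
move=> /measurable_A mf; apply: measurable_funM => //.
by apply: measurableT_comp => //; exact: measurable_ln.
Qed.

Section fixed_function.
Variables (f : E -> R) (e : R).
Hypothesis Af : A f.
Hypothesis e0 : 0 < e.
Hypothesis ef : forall x, e <= f x.

Lemma P_lower_bound t x : 0 <= t -> e <= P t f x.
Proof. by move=> t0; apply: (P_ge_cst hP) => //; exact: (A_bm hA). Qed.

Lemma P_expR_form t : 0 <= t ->
  exists h, [/\ A h, P t f = (fun y => expR (h y)) & forall y, ln (P t f y) = h y].
Proof.
move=> t0; exists (fun y => ln (P t f y)); split=> //.
  apply: (A_ln hA e0); last exact: (A_P hA).
  by move=> x; exact: P_lower_bound.
apply/funext => y; rewrite lnK // posrE.
exact: lt_le_trans (P_lower_bound y t0).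
Qed.

Lemma entropy_path_jet1 t s : 0 <= s -> s <= t -> forall h, A h ->
  P (t - s) f = (fun y => expR (h y)) ->
  let g := fun y => expR (h y) in
  jet1 (fun r => entropy_path t f (s + r)) (fun y => g y * h y)
       (fun y => - ((1 + h y) * L g y)).
Proof.
move=> s0 st h Ah Eg g.
have ts0 : 0 <= t - s by rewrite subr_ge0.
have ju : sjet1 (fun r => t - (s + r)) (t - s) (-1).
  have := @jet1_affine R unit (t - s) (-1).
  by apply: jet1_eq => // r _; ring.
have jT := T_jet1 hP hA Af ts0 ju.
have jl := jet1_ln e0 (fun x => P_lower_bound x ts0) jT.
have := jet1_mul jT jl.
have LE : P (t - s) (L f) = L g by rewrite -(generator_P_comm hP hA) // Eg.
rewrite LE Eg; apply: jet1_eq => // x; first by rewrite expRK.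
by rewrite expRK /g; field; rewrite gt_eqF // expR_gt0.
Qed.

Lemma A_expRM h : A h -> A (fun y => expR (h y) * h y).
Proof. by move=> Ah; apply: (A_mul hA) => //; exact: (A_expR hA). Qed.

(** The derivative is P_s (L (g h) - (1 + h) L g), which is P_s (g Gamma(h)). *)
Lemma entropy_flow_jet1 t s x : 0 < s -> s <= t -> forall h, A h ->
  P (t - s) f = (fun y => expR (h y)) ->
  let g := fun y => expR (h y) in
  sjet1 (fun r => entropy_flow t f (s + r) x) (entropy_flow t f s x)
        (P s (fun y => g y * Gam h h y) x).
Proof.
move=> s0 st h Ah Eg g.
have jW := entropy_path_jet1 (ltW s0) st Ah Eg.
have Ag : A g by exact: (A_expR hA).
have AG := A_gamma hA Ah Ah.
have Ab : A (fun y => - ((1 + h y) * L g y)).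
  apply: (A_opp hA); apply: (A_mul hA); last exact: (A_L hA).
  by apply: (A_add hA) => //; exact: (A_cst hA).
have Agh := A_expRM Ah.
have ju : sjet1 (fun r => s + r) s 1.
  have := @jet1_affine R unit s 1.
  by apply: jet1_eq => // r _; rewrite mulr1.
have mW r : measurable_fun setT (entropy_path t f (s + r)).
  by apply: measurable_xlnx; exact: (A_T hA).
have := sjet1_at x (P_jet1 hP hA ju s0 mW Agh Ab jW).
have [B1 _] := entropy_second_order hP hA hD x Ah.
have -> : P s (fun y => g y * h y) x = entropy_flow t f s x.
  rewrite /entropy_flow; congr (P s _ x); apply/funext => y.
  rewrite /entropy_path extended_semigroupE; last by rewrite subr_ge0.
  by rewrite Eg expRK.
congr sjet1; rewrite mul1r -(P_add hP) ?ltW //; try exact: (A_bm hA).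
  congr (P s _ x); apply/funext => y; rewrite -[RHS]B1 -/g; ring.
by apply: (A_bm hA); exact: (A_L hA).
Qed.

(** Both values of the flow are averages by P_{s-r} of expressions in the same
    function g = P_{t-s} f: phi(s) - phi(s - r) is P_{s-r} applied to
    P_r (g ln g) - P_r g ln P_r g, which has a uniform second order expansion.
    Forward increments would involve P_{t-s-r} f, over which there is no control
    uniform in r. *)
Lemma entropy_flow_jet2 t s x : 0 < s -> s <= t -> forall h, A h ->
  P (t - s) f = (fun y => expR (h y)) ->
  let g := fun y => expR (h y) in
  exists rho : R -> R,
    sjet2 rho 0 (P s (fun y => g y * Gam h h y) x) (- P s (fun y => g y * gamma2 P h y) x) /\
    forall r, 0 <= r -> r <= s -> rho r = entropy_flow t f s x - entropy_flow t f (s - r) x.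
Proof.
move=> s0 st h Ah Eg g.
have ts0 : 0 <= t - s by rewrite subr_ge0.
have Ag : A g by exact: (A_expR hA).
have Agh : A (fun y => g y * h y) by exact: A_expRM.
have gge x' : e <= g x' by have := P_lower_bound x' ts0; rewrite Eg.
pose W r := fun y => T r (fun y => g y * h y) y - T r g y * ln (T r g y).
have jg := T_jet2 hP hA Ag.
have jW := jet2_add (T_jet2 hP hA Agh)
  (jet2_scale (-1) (jet2_mul jg (jet2_ln e0 gge jg))).
pose B := fun y => g y * Gam h h y.
pose B2 := fun y => 2^-1 * (L (L (fun z => g z * h z)) y - (1 + h y) * L (L g) y
   - L g y ^+ 2 / g y).
have AG := A_gamma hA Ah Ah; have AB : A B by exact: (A_mul hA).
have ALg := A_L hA Ag; have ALLg := A_L hA ALg.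
have AB2 : A B2.
  apply: (A_scale hA); apply: (A_sub hA).
    apply: (A_sub hA); first by do 2!apply: (A_L hA).
    by apply: (A_mul hA) => //; apply: (A_add hA) => //; exact: (A_cst hA).
  have -> : (fun y => L g y ^+ 2 / g y) = (fun y => (L g y * L g y) * expR (- 1 * h y)).
    by apply/funext => y; rewrite mulN1r expRN expr2.
  apply: (A_mul hA); first exact: (A_mul hA).
  by apply: (A_expR hA); exact: (A_scale hA).
(* The expansion of P_r (g h) - P_r g ln P_r g has coefficients 0, B and B2. *)
have so y := entropy_second_order hP hA hD y Ah.
have gn y : g y != 0 by rewrite gt_eqF // expR_gt0.
have {}jW : jet2 W (fun=> 0) B B2.
  apply: jet2_eq jW => [r y|y|y|y]; rewrite ?expRK.
  - by rewrite /W; ring.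
  - by rewrite /g; ring.
  - by have [b1 _] := so y; rewrite -[RHS]b1 -/g; field.
  - by rewrite /B2; field.
have mW r : measurable_fun setT (W r).
  by apply: measurable_funB; [apply: measurable_A|apply: measurable_xlnx]; exact: (A_T hA).
exists (fun r => P (s - r) (W r) x); split.
  have := sjet2_at x (P_jet2_backward hP hA s0 mW AB AB2 jW).
  congr sjet2.
  have s0' := ltW s0.
  have Agg : A (fun y => g y * gamma2 P h y).
    have -> : (fun y => g y * gamma2 P h y) = (fun y => L B y - B2 y).
      by apply/funext => y; have [_ [_ <-]] := so y.
    by apply: (A_sub hA) => //; exact: (A_L hA).
  rewrite -mulN1r -(P_scale hP) //; last exact: (A_bm hA).
  congr (P s _ x); apply/funext => y; have [_ [_]] := so y.
  by rewrite -/g -/B => <-; rewrite /B2; ring.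
move=> r r0 rs; have sr0 : 0 <= s - r by rewrite subr_ge0.
have s0' := ltW s0.
have Pg y : e <= P r g y by apply: (P_ge_cst hP) => //; exact: (A_bm hA).
have APg : A (P r g) by exact: (A_P hA).
have AlPg : A (fun y => ln (P r g y)) by exact: (A_ln hA e0).
have b1 : bounded_measurable (P r (fun y => g y * h y)) by apply: (A_bm hA); exact: (A_P hA).
have b2 : bounded_measurable (fun y => P r g y * ln (P r g y)).
  by apply: (A_bm hA); exact: (A_mul hA).
rewrite /W !extended_semigroupE // (P_sub hP) //; congr (_ - _).
  rewrite -(P_comp hP) //; last exact: (A_bm hA).
  rewrite subrK /entropy_flow /entropy_path extended_semigroupE // Eg.
  by congr (P s _ x); apply/funext => y; rewrite expRK.
rewrite /entropy_flow /entropy_path extended_semigroupE; last by lra.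
have -> : P (t - (s - r)) f = P r g.
  apply/funext => y; rewrite /g -Eg -(P_comp hP) //; last exact: (A_bm hA).
  by congr (P _ f y); ring.
by [].
Qed.

Lemma entropy_flow_right_continuous t x (del : R) : 0 < t -> 0 < del ->
  \forall s \near 0^'+, `|entropy_flow t f s x - entropy_flow t f 0 x| <= del.
Proof.
move=> t0 del0.
have t00 : 0 <= t - 0 by rewrite subr0 ltW.
have [h [Ah Eg _]] := P_expR_form t00.
have jW := entropy_path_jet1 (lexx 0) (ltW t0) Ah Eg.
pose a := fun y => expR (h y) * h y.
have Aa : A a by exact: A_expRM.
have aE : entropy_path t f 0 = a.
  by apply/funext => y; rewrite /entropy_path extended_semigroupE // Eg expRK.
have d2 : 0 < del / 2 by lra.
have [C [C1 HC]] := jet1_small d2 jW.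
have [D D1 HD] := P_taylor0 hP hA Aa.
have m0 : 0 < (C + D / (del / 2))^-1.
  rewrite invr_gt0 ltr_pwDl ?divr_ge0 //; lra.
apply: (at_right0I m0) => s s0 sm.
have sC : s * (C + D / (del / 2)) < 1.
  by rewrite -ltr_pdivlMr ?mul1r // -[X in 0 < X]invrK invr_gt0.
have Dd : 0 < D / (del / 2) by rewrite divr_gt0 //; lra.
have sC1 : C * `|s| <= 1 by rewrite gtr0_norm //; nra.
have sD1 : s * D <= del / 2.
  have : s * (D / (del / 2)) <= 1 by nra.
  by rewrite mulrA ler_pdivrMr // mul1r.
rewrite /entropy_flow aE (P_0 hP); last exact: (A_bm hA).
have s0' := ltW s0.
have HW := HC s sC1.
have mW : measurable_fun setT (entropy_path t f s).
  by apply: measurable_xlnx; exact: (A_T hA).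
have bd : bounded_measurable (fun y => entropy_path t f s y - a y).
  split; first by apply: measurable_funB => //; exact: measurable_A.
  by exists (del / 2) => y; have := HW y; rewrite add0r.
have -> : P s (entropy_path t f s) x - a x =
   P s (fun y => entropy_path t f s y - a y) x + (P s a x - a x).
  have -> : P s (entropy_path t f s) x = P s (fun y => (entropy_path t f s y - a y) + a y) x.
    by congr (P s _ x); apply/funext => y; rewrite subrK.
  by rewrite (P_add hP) //; [ring|exact: (A_bm hA)].
apply: le_trans (ler_normD _ _) _.
have b1 : `|P s (fun y => entropy_path t f s y - a y) x| <= del / 2.
  by apply: (P_norm_le hP) => // y; have := HW y; rewrite add0r.
have b2 := HD s x s0'.
lra.
Qed.

End fixed_function.

Lemma P_cauchy_schwarz s g u x : 0 <= s -> bounded_measurable g -> bounded_measurable u ->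
  (forall y, 0 <= g y) -> 0 < P s g x ->
  (P s (fun y => g y * u y) x) ^+ 2 / P s g x <= P s (fun y => g y * u y ^+ 2) x.
Proof.
move=> s0 bg bu g0 p0; set p := P s g x in p0 *; set q := P s _ x.
pose l := q / p.
have bgu := bm_mul bg bu.
have bgu2 : bounded_measurable (fun y => g y * u y ^+ 2).
  have -> : (fun y => g y * u y ^+ 2) = (fun y => g y * (u y * u y)).
    by apply/funext => y; rewrite expr2.
  by apply: bm_mul => //; exact: bm_mul.
have : 0 <= P s (fun y => (g y * u y ^+ 2) + ((- 2 * l) * (g y * u y) + l ^+ 2 * g y)) x.
  apply: (P_ge0 hP) => //.
    by apply: bm_add => //; apply: bm_add; exact: bm_scale.
  move=> y; have -> : g y * u y ^+ 2 + (- 2 * l * (g y * u y) + l ^+ 2 * g y) = g y * (u y - l) ^+ 2 by ring.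
  by rewrite mulr_ge0 // sqr_ge0.
rewrite (P_add hP) //; last by apply: bm_add; exact: bm_scale.
rewrite (P_axpy hP) ?(P_scale hP) //; last exact: bm_scale.
rewrite -/p -/q => K; rewrite -subr_ge0.
by rewrite (_ : _ - _ = P s (fun y => g y * u y ^+ 2) x + (- 2 * l * q + l ^+ 2 * p)) //;
  rewrite /l; field; rewrite gt_eqF.
Qed.

(** CD(0,n) under the average, then Cauchy-Schwarz with weight g. *)
Lemma gamma2_average_ge (n : R) s h x : 0 < n -> CD0 P A n -> 0 <= s -> A h ->
  forall g, g = (fun y => expR (h y)) ->
  (P s (fun y => g y * L h y) x) ^+ 2 / (n * P s g x) <= P s (fun y => g y * gamma2 P h y) x.
Proof.
move=> n0 cd s0 Ah g gE.
have Ag : A g by rewrite gE; exact: (A_expR hA).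
have gp y : 0 < g y by rewrite gE expR_gt0.
have ALh := A_L hA Ah.
have bg := A_bm hA Ag; have bL := A_bm hA ALh.
have p0 : 0 < P s g x by rewrite gE; exact: (P_expR_gt0 hP hA).
have cs := P_cauchy_schwarz s0 bg bL (fun y => ltW (gp y)) p0.
have bg2 : bounded_measurable (fun y => g y * gamma2 P h y).
  apply: bm_mul => //; apply: (A_bm hA); apply: (A_scale hA); apply: (A_sub hA).
    by apply: (A_L hA); exact: (A_gamma hA).
  by apply: (A_scale hA); exact: (A_gamma hA).
have bgu2 : bounded_measurable (fun y => g y * L h y ^+ 2).
  have -> : (fun y => g y * L h y ^+ 2) = (fun y => g y * (L h y * L h y)).
    by apply/funext => y; rewrite expr2.
  by apply: bm_mul => //; exact: bm_mul.
apply: (@le_trans _ _ (n^-1 * P s (fun y => g y * L h y ^+ 2) x)).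
  rewrite invfM mulrA mulrAC mulrC ler_pM2l ?invr_gt0 //.
rewrite -(P_scale hP) //; apply: (P_le hP) => //; first exact: bm_scale.
by move=> y; rewrite mulrCA ler_pM2l //; exact: cd.
Qed.

End entropy_flow.

(** * The curvature-dimension criterion implies the logarithmic Sobolev inequality *)

Lemma sjet1_add {R : realType} (f g : R -> R) a b a' b' : sjet1 f a b -> sjet1 g a' b' ->
  sjet1 (fun h => f h + g h) (a + a') (b + b').
Proof. exact: jet1_add. Qed.

Lemma sjet1_scale {R : realType} (k : R) (f : R -> R) a b : sjet1 f a b ->
  sjet1 (fun h => k * f h) (k * a) (k * b).
Proof. exact: jet1_scale. Qed.

Lemma sjet1_continuous {R : realType} (f : R -> R) s a b : sjet1 (fun r => f (s + r)) a b ->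
  {for s, continuous f}.
Proof.
move=> /sjet1_is_derive [df _].
by apply: differentiable_continuous; apply/derivable1_diffP.
Qed.

Section log_sobolev.
Context {d : measure_display} {E : measurableType d} {R : realType}
  {mu : {measure set E -> \bar R}} {P : R -> (E -> R) -> (E -> R)}
  {A : set (E -> R)} {n : R}.
Hypothesis hP : markov_semigroup mu P.
Hypothesis hA : nice_dense_algebra mu P A.
Hypothesis hD : diffusion P A.
Hypothesis n0 : 0 < n.
Implicit Types (f g : E -> R) (t s : R).

Local Notation L := (generator P).
Local Notation Gam := (carre_du_champ P).
Local Notation entropy_flow := (@entropy_flow d E R P).

(** Comparison with the barrier.  At a maximum of phi - eta in (0, t] the first
    derivatives agree, and the second order expansion to the left gives
    P_s (g Gamma_2(h)) <= eta''/2; this contradicts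
    P_s (g Gamma_2(h)) >= c/2 (phi' - L P_t f)^2 > eta''/2.  The slope condition
    excludes the end point t, so the maximum is at 0. *)
Lemma entropy_flow_maximum (cd : CD0 P A n) f (e0 : R) (Af : A f) (e0p : 0 < e0)
    (ef : forall x, e0 <= f x) t x e C : 0 < t -> 0 < t + e * t -> C != 0 ->
  let c := 2 / (n * P t f x) in
  let eta := barrier (P t (L f) x) c t e C in
  forall h, A h -> f = (fun y => expR (h y)) ->
  P t (fun y => f y * Gam h h y) x < barrier1 (P t (L f) x) c t e C t ->
  entropy_flow t f t x - entropy_flow t f 0 x <= eta t - eta 0.
Proof.
move=> t0 Dt C0 c eta h0 Ah0 fE slope.
pose phi s := entropy_flow t f s x.
pose Lp := P t (L f) x.
have t0' := ltW t0.
pose p := P t f x.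
have p0 : 0 < p.
  exact: lt_le_trans e0p (P_lower_bound hP hA Af ef x t0').
have c0 : 0 < c by rewrite divr_gt0 // mulr_gt0.
have D0 s : 0 <= s -> s <= t -> 0 < t + e * s.
  move=> s0 st; case: (leP 0 e) => e1; first by rewrite ltr_pwDl // mulr_ge0.
  by apply: lt_le_trans Dt _; rewrite lerD2l ler_wnM2l // ltW.
pose F s := phi s + (-1) * eta s.
have jphi s : 0 < s -> s <= t -> exists g h, [/\ A h, g = (fun y => expR (h y)),
    P (t - s) f = g & sjet1 (fun r => phi (s + r)) (phi s) (P s (fun y => g y * Gam h h y) x)].
  move=> s0 st; have ts0 : 0 <= t - s by rewrite subr_ge0.
  have [h [Ah Eg _]] := P_expR_form hP hA Af e0p ef ts0.
  exists (fun y => expR (h y)), h; split=> //.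
  exact: (entropy_flow_jet1 hP hA hD Af e0p ef x s0 st Ah Eg).
have jF s : 0 < s -> s <= t -> exists b, sjet1 (fun r => F (s + r)) (F s) b.
  move=> s0 st; have [g [h [_ _ _ J]]] := jphi s s0 st.
  have jb := jet2_jet1 (barrier_jet2 Lp c C t0 (D0 s (ltW s0) st)).
  by eexists; exact: sjet1_add J (sjet1_scale (-1) jb).
have Fc : {within `[0, t], continuous F}.
  apply/continuous_within_itvP => //; split.
  - move=> s; rewrite in_itv /= => /andP[s0 st].
    have [b J] := jF s s0 (ltW st); exact: sjet1_continuous J.
  - apply: cvgD.
      apply/cvgrPdist_le => del d0.
      have := entropy_flow_right_continuous hP hA Af e0p ef x t0 d0.
      by apply: filterS => s; rewrite distrC.
    apply: cvgM; first exact: cvg_cst.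
    apply: cvg_at_right_filter.
    have jb := jet2_jet1 (barrier_jet2 Lp c C t0 (D0 0 (lexx 0) t0')).
    exact: sjet1_continuous jb.
  - apply: cvg_at_left_filter; have [b J] := jF t t0 (lexx t).
    exact: sjet1_continuous J.
have [s0 s0t Fmax] := EVT_max t0' Fc.
move: s0t; rewrite in_itv /= => /andP[s00 s0t].
have goal0 : F t <= F 0 -> phi t - phi 0 <= eta t - eta 0 by rewrite /F; lra.
apply: goal0.
move: s00; rewrite le_eqVlt => /predU1P[s00|s0p].
  by rewrite s00; apply: Fmax; rewrite in_itv /= lexx t0'.
exfalso.
have [g [h [Ah gE Eg J1]]] := jphi s0 s0p s0t.
have Dp := D0 s0 (ltW s0p) s0t.
have Jb := barrier_jet2 Lp c C t0 Dp.
set b1 := barrier1 _ _ _ _ _ _ in Jb; set b2 := barrier2 _ _ _ _ _ in Jb.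
set B := P s0 (fun y => g y * Gam h h y) x in J1.
have JF := sjet1_add J1 (sjet1_scale (-1) (jet2_jet1 Jb)).
have Fle r : 0 <= s0 + r -> s0 + r <= t -> F (s0 + r) <= F s0.
  by move=> r1 r2; apply: Fmax; rewrite in_itv /= r1 r2.
(* Left neighbours exist at every point of (0, t]; at t the slope condition replaces
   right neighbours. *)
have left : b1 <= B.
  have JN := jet2_jet1 (jet2_opp_var Jb).
  have JF' : sjet1 (fun r => F (s0 - r)) (F s0) (- (B + -1 * b1)).
    have := unifO_comp (r := -%R).
    case: JF => q1 q2 q3 K; split; try exact: bounded_fct_cst.
    apply: unifO_eq (K _ _ _ _ q3 _) => [r y|]; first by rewrite /F /eta -/Lp; ring.
    by exists 1; split=> // r _; rewrite normrN mul1r.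
  have := sjet1_le0 JF' _; rewrite oppr_le0 mulN1r subr_ge0; apply.
  exists (1 + s0^-1); have si : 0 < s0^-1 by rewrite invr_gt0.
  split=> [|r r0 hr]; first lra.
  have : s0^-1 * r <= 1 by nra.
  rewrite mulrC ler_pdivrMr // mul1r => rs.
  by apply: Fle; lra.
have EB : B = b1.
  apply/eqP; rewrite eq_le left andbT.
  move: (s0t); rewrite le_eqVlt => /predU1P[st|st].
    have := slope; rewrite -/b1.
    have PE : P (t - s0) f = f by rewrite st subrr (P0_eq hP hA Af).
    have hE : h = h0.
      by apply/funext => y; apply: expR_inj; rewrite -[LHS]/((fun y => expR (h y)) y) -gE -Eg PE fE.
    by rewrite /b1 /B -hE -Eg PE st => /ltW.
  rewrite -subr_le0 -mulN1r; apply: (sjet1_le0 JF).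
  have ti : 0 < (t - s0)^-1 by rewrite invr_gt0 subr_gt0.
  exists (1 + (t - s0)^-1); split=> [|r r0 hr]; first lra.
  have : (t - s0)^-1 * r <= 1 by nra.
  rewrite mulrC ler_pdivrMr ?subr_gt0 // mul1r => rs.
  by apply: Fle; lra.
have Eg' : P (t - s0) f = (fun y => expR (h y)) by rewrite Eg.
have [rho [Jr rhoE]] := entropy_flow_jet2 hP hA hD Af e0p ef x s0p s0t Ah Eg'.
set K := P s0 (fun y => expR (h y) * gamma2 P h y) x in Jr.
have Jl : sjet2 (fun r => phi s0 - rho r - eta (s0 - r)) (F s0) 0 (K - b2).
  have Jc : jet2 (fun r (_ : unit) => phi s0 + r * 0) (fun=> phi s0) (fun=> 0) (fun=> 0).
    exact: jet2_affine.
  have := jet2_add (jet2_add Jc (jet2_scale (-1) Jr)) (jet2_scale (-1) (jet2_opp_var Jb)).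
  apply: jet2_eq => [r _|_|_|_]; rewrite /F /eta -/Lp; try ring.
  have -> : P s0 (fun y => expR (h y) * Gam h h y) x = b1 by rewrite -EB /B gE.
  ring.
have Kle : K <= b2.
  rewrite -subr_le0; apply: (sjet2_le0 Jl).
  exists (1 + s0^-1); have si : 0 < s0^-1 by rewrite invr_gt0.
  split=> [|r r0 hr]; first lra.
  have : s0^-1 * r <= 1 by nra.
  rewrite mulrC ler_pdivrMr // mul1r => rs.
  rewrite (rhoE _ (ltW r0) rs).
  have := Fle (- r); rewrite /F /eta => /(_ _ _) H.
  have := H (ltac:(lra)) (ltac:(lra)); rewrite /phi /F /eta -/Lp; lra.
have := barrier_strict Lp (t := t) c0 C0 Dp; rewrite -/b1 -/b2 ltNge => /negP; apply.
apply: le_trans Kle.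
have := gamma2_average_ge hP hA x n0 cd (ltW s0p) Ah erefl; rewrite -/K; apply: le_trans.
have ts0 : 0 <= t - s0 by rewrite subr_ge0.
have bf := A_bm hA Af.
have Pp : P s0 (fun y => expR (h y)) x = p.
  by rewrite -Eg' -(P_comp hP) ?(ltW s0p) // addrC subrK.
have Ag : A g by rewrite gE; exact: (A_expR hA).
have bgL : bounded_measurable (fun y => expR (h y) * L h y).
  by apply: (A_bm hA); apply: (A_mul hA); [rewrite -gE|exact: (A_L hA)].
have bgG : bounded_measurable (fun y => expR (h y) * Gam h h y).
  by apply: (A_bm hA); apply: (A_mul hA); [rewrite -gE|exact: (A_gamma hA)].
have AL := A_L hA Af.
have sum : P s0 (fun y => expR (h y) * L h y) x = Lp - b1.
  have -> : Lp = P s0 (L g) x.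
    by rewrite -Eg (generator_P_comm hP hA) // -(P_comp hP) ?(ltW s0p) ?(addrC s0) ?subrK //; exact: (A_bm hA).
  rewrite -EB /B gE -(P_sub hP) ?(ltW s0p) //; last first.
    by apply: (A_bm hA); apply: (A_L hA); rewrite -gE.
  congr (P s0 _ x); apply/funext => y.
  have [_ [B2 _]] := entropy_second_order hP hA hD y Ah.
  by rewrite -B2; ring.
rewrite sum Pp /c -/p -/b1 -sqrrN opprB le_eqVlt; apply/orP; left; apply/eqP.
by field; rewrite !gt_eqF.
Qed.

(** The constants e = k - 1 and C of the barrier are chosen so that its slope at t is
    that of the flow plus eps; its increment over [0, t] is then the right side of the
    inequality, up to k t eps.  The value C = 0 is avoided by moving eps, which
    tends to 0 at the end. *)
Theorem CD0_linear_log_sobolev : CD0 P A n -> linear_log_sobolev P A n.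
Proof.
move=> cd h Ah t k x t0 k0 F0 ->; have t0' := ltW t0; pose F y := expR (h y); rewrite -/F.
have AF : A F by exact: (A_expR hA).
have AG := A_gamma hA Ah Ah; have ALh := A_L hA Ah; have ALF := A_L hA AF.
have [lo [e0 Fge]] := expR_lower_bound hA Ah.
pose p := P t F x; pose Lp := P t (L F) x; pose c := 2 / (n * p).
pose a := - P t (fun y => F y * L h y) x.
have p0 : 0 < p by exact: lt_le_trans e0 (P_lower_bound hP hA AF Fge x t0').
have c0 : 0 < c by rewrite divr_gt0 // mulr_gt0.
have slopeE : P t (fun y => F y * Gam h h y) x = a + Lp.
  rewrite /a /Lp addrC -(P_sub hP) //; [|exact: (A_bm hA)|by apply: (A_bm hA); exact: (A_mul hA)].
  congr (P t _ x); apply/funext => y.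
  by have [_ [B2 _]] := entropy_second_order hP hA hD y Ah; rewrite -[LHS]B2.
have entE : entropy P t F x = entropy_flow t F t x - entropy_flow t F 0 x.
  rewrite /entropy /entropy_flow /entropy_path subrr subr0 !extended_semigroupE // (P0_eq hP hA AF).
  congr (_ - _); rewrite (P_0 hP) //; apply: (A_bm hA); apply: (A_mul hA); first exact: (A_P hA).
  apply: (A_ln hA e0); last exact: (A_P hA).
  by move=> y; exact: (P_lower_bound hP hA AF Fge).
have key (eps : R) : 0 < eps -> t ^+ 2 * k ^+ 2 * (a + eps + (k - 1) / (c * t * k)) != 0 ->
    entropy P t F x <= t * Lp + k * t * (a + eps) + c^-1 * (k - 1 - ln k).
  move=> eps0 C1; rewrite entE.
  have D0 : t + (k - 1) * t = t * k by ring.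
  have D1 : 0 < t + (k - 1) * t by rewrite D0 mulr_gt0.
  have := @entropy_flow_maximum cd F lo AF e0 Fge t x (k - 1) _ t0 D1 C1 h Ah erefl.
  rewrite -/p -/c -/Lp slopeE => H; apply: le_trans (H _) _.
    rewrite /barrier1 D0.
    have -> : Lp - c^-1 * ((k - 1) / (t * k)) +
      t ^+ 2 * k ^+ 2 * (a + eps + (k - 1) / (c * t * k)) / (t * k) ^+ 2 = a + eps + Lp.
      by field; rewrite !gt_eqF.
    by lra.
  rewrite barrier_gap // D0 [t * k / t](_ : _ = k); last by field; rewrite gt_eqF.
  rewrite le_eqVlt; apply/orP; left; apply/eqP.
  by field; rewrite !gt_eqF.
rewrite (generator_P_comm hP hA) // -/Lp -/p.
have -> : n / 2 * p = c^-1 by rewrite /c; field; rewrite !gt_eqF.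
have -> : k * t * P t (fun y => F y * L h y) x = - (k * t * a) by rewrite /a; ring.
rewrite leNgt; apply/negP => lt0.
(* Of the two values gap / (2 k t) and gap / (3 k t) of eps, at most one makes C
   vanish. *)
pose gap := entropy P t F x - (t * Lp - - (k * t * a) + c^-1 * (k - 1 - ln k)).
have gap0 : 0 < gap by rewrite /gap subr_gt0.
have kt0 : 0 < k * t by rewrite mulr_gt0.
have tk : t ^+ 2 * k ^+ 2 != 0 by rewrite mulf_neq0 // expf_eq0 /= gt_eqF.
have nokey (eps : R) : 0 < eps -> k * t * eps < gap ->
    a + eps + (k - 1) / (c * t * k) = 0.
  move=> eps0 egap; apply/eqP; rewrite -[_ == _]negbK; apply/negP => C1.
  have := key eps eps0 (mulf_neq0 tk C1); rewrite /gap in egap; lra.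
have g2 : k * t * (gap / (2 * (k * t))) = gap / 2 by field; rewrite !gt_eqF.
have g3 : k * t * (gap / (3 * (k * t))) = gap / 3 by field; rewrite !gt_eqF.
have h2 : 0 < gap / (2 * (k * t)) by rewrite divr_gt0 // mulr_gt0.
have h3 : 0 < gap / (3 * (k * t)) by rewrite divr_gt0 // mulr_gt0.
have := nokey _ h2 _; have := nokey _ h3 _.
rewrite g2 g3 => /(_ (ltac:(lra))) E3 /(_ (ltac:(lra))) E2.
have : gap / (2 * (k * t)) = gap / (3 * (k * t)) by lra.
have -> : gap / (2 * (k * t)) = gap / (3 * (k * t)) + gap / (6 * (k * t)).
  by field; rewrite !gt_eqF.
have : 0 < gap / (6 * (k * t)) by rewrite divr_gt0 // mulr_gt0.
lra.
Qed.

End log_sobolev.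

(** * The logarithmic Sobolev inequality near time 0, and its two forms *)

Section log_sobolev_converse.
Context {d : measure_display} {E : measurableType d} {R : realType}
  {mu : {measure set E -> \bar R}} {P : R -> (E -> R) -> (E -> R)}
  {A : set (E -> R)} {n : R}.
Hypothesis hP : markov_semigroup mu P.
Hypothesis hA : nice_dense_algebra mu P A.
Hypothesis hD : diffusion P A.
Hypothesis n0 : 0 < n.
Implicit Types (f g : E -> R) (t s : R).

Local Notation L := (generator P).
Local Notation Gam := (carre_du_champ P).
Local Notation T := (@extended_semigroup d E R P).

(** With k = 1 + e t the difference of the two sides vanishes to first order at
    t = 0, and its second order coefficient is
    F (Gamma_2(h) - e L h + n e^2 / 4), smallest for e = 2 L h / n. *)
Theorem linear_log_sobolev_CD0 : linear_log_sobolev P A n -> CD0 P A n.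
Proof.
move=> lls h Ah x; pose F y := expR (h y).
have AF : A F by exact: (A_expR hA).
have ALh := A_L hA Ah; have ALF := A_L hA AF.
have AFLh : A (fun y => F y * L h y) by exact: (A_mul hA).
have AFh : A (fun y => F y * h y) by exact: (A_mul hA).
have [lo [e0 Fge]] := expR_lower_bound hA Ah.
have {}Fge y : lo <= F y by exact: Fge.
pose e := 2 * L h x / n.
have j1 := T_jet2 hP hA ALF; have j2 := T_jet2 hP hA AFLh.
have j3 := T_jet2 hP hA AF; have j4 := T_jet2 hP hA AFh.
have jl := jet2_ln e0 Fge j3.
have jt : jet2 (fun r (_ : E) => 0 + r * 1 : R) (fun=> 0) (fun=> 1) (fun=> 0) by exact: jet2_affine.
have jk : jet2 (fun r (_ : E) => 1 + r * e : R) (fun=> 1) (fun=> e) (fun=> 0) by exact: jet2_affine.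
have jlk := jet2_ln ltr01 (fun _ : E => lexx 1) jk.
have jD := jet2_add (jet2_add (jet2_add (jet2_add (jet2_mul jt j1)
    (jet2_scale (-1) (jet2_mul (jet2_mul jk jt) j2)))
    (jet2_scale (n / 2) (jet2_mul j3 (jet2_add (jet2_scale e jt) (jet2_scale (-1) jlk)))))
    (jet2_scale (-1) j4)) (jet2_mul j3 jl).
have jN := sjet2_at x (jet2_scale (-1) jD).
have [B1 [B2 B3]] := entropy_second_order hP hA hD x Ah.
rewrite -/F in B1 B2 B3.
have gn : F x != 0 by rewrite gt_eqF // expR_gt0.
have nn : n != 0 by rewrite gt_eqF.
have LB : L (fun y => F y * Gam h h y) x = L (L F) x - L (fun y => F y * L h y) x.
  rewrite -(L_sub hP hA) //; congr (L _ x); apply/funext => y; exact: esym (B2 y).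
have {}jN : sjet2 (fun r => - (r * T r (L F) x - (1 + r * e) * r * T r (fun y => F y * L h y) x
     + n / 2 * T r F x * (r * e - ln (1 + r * e)) - T r (fun y => F y * h y) x
     + T r F x * ln (T r F x))) 0 0
     (- (F x * (gamma2 P h x - n^-1 * L h x ^+ 2))).
  apply: jet2_eq jN => [r _|_|_|_].
  - move: (ln (T r F x)) (ln (1 + r * e)) => l1 l2.
    move: (T r (L F) x) (T r (fun y => F y * L h y) x) (T r F x) (T r (fun y => F y * h y) x).
    move=> *; ring.
  - by rewrite ln1 expRK /F; ring.
  - have b1 := B1 x; have b2 := B2 x; rewrite ln1 expRK.
    by rewrite [LHS](_ : _ = - (L F x - F x * L h x - (L (fun z => F z * h z) x - (1 + h x) * L F x)));
      [rewrite b1 b2; ring|field].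
  - have B4 : F x * gamma2 P h x = L (fun y => F y * Gam h h y) x - 2^-1 *
       (L (L (fun y => F y * h y)) x - (1 + h x) * L (L F) x - L F x ^+ 2 / F x) := esym B3.
    rewrite (mulrBr (F x) (gamma2 P h x)) B4 LB ln1 expRK /e; move: gn nn.
    move: (L (L (L F)) x) (L (L (fun y => F y * L h y)) x) (L (fun y => F y * L h y) x).
    move: (L (L (fun y => F y * h y)) x) (L (L F) x) (L F x) (L h x) (F x) (h x) (n).
    by move=> *; field; apply/andP.
have : F x * (gamma2 P h x - n^-1 * L h x ^+ 2) >= 0; last first.
  by rewrite pmulr_rge0 ?expR_gt0 // subr_ge0.
rewrite -oppr_le0; apply: (sjet2_le0 jN).
exists (1 + `|e|); split=> [|r r0 hr]; first by have := normr_ge0 e; lra.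
have k0 : 0 < 1 + r * e.
  have : - `|e| <= e by rewrite lerNl; have := ler_norm (- e); rewrite normrN.
  nra.
have r0' := ltW r0; have := lls h Ah r (1 + r * e) x r0 k0 F erefl.
rewrite !extended_semigroupE // (generator_P_comm hP hA) // oppr_le0 /entropy.
under [X in P r X]eq_fun do rewrite expRK.
rewrite -/F.
have -> : n / 2 * P r F x * (1 + r * e - 1 - ln (1 + r * e)) =
  n / 2 * P r F x * (r * e - ln (1 + r * e)) by ring.
lra.
Qed.

(** This identity exhibits the right side of the linear inequality as the tangent
    k w - 1 - ln k to ln w. *)
Lemma log_sobolev_rhs t p Q k : 0 < p ->
  - (k * t * Q) + n / 2 * p * (k - 1 - ln k) =
  n / 2 * p * (k * (1 - 2 * t / n * (Q / p)) - 1 - ln k).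
Proof. by move=> p0; field; rewrite !gt_eqF. Qed.

Theorem local_to_linear_log_sobolev : local_log_sobolev P A n -> linear_log_sobolev P A n.
Proof.
move=> ls h Ah t k x t0 k0 F FE.
have AF : A F by rewrite FE; exact: (A_expR hA).
have Fp y : 0 < F y by rewrite FE expR_gt0.
have lnF : (fun y => ln (F y)) = h by apply/funext => y; rewrite FE expRK.
have [] := ls F t AF Fp _ (ltW t0) x; first by rewrite lnF.
have p0 : 0 < P t F x by rewrite FE; exact: (P_expR_gt0 hP hA _ Ah (ltW t0)).
rewrite /log_sobolev_arg lnF => w0 /le_trans; apply.
rewrite -addrA lerD2l log_sobolev_rhs // ler_pM2l ?mulr_gt0 ?divr_gt0 //.
set w := 1 - _ in w0 *.
have := @le_ln1Dx R (k * w - 1); rewrite [1 + _]addrC subrK lnM ?posrE // => H.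
by have := H _; rewrite ltrBrDl subrr mulr_gt0 // => /(_ isT); lra.
Qed.

(** If the argument w were not positive, letting k tend to infinity would make the
    right side tend to - oo; so w > 0, and k = 1 / w is optimal. *)
Theorem linear_to_local_log_sobolev : linear_log_sobolev P A n -> local_log_sobolev P A n.
Proof.
move=> lls f t Af fp Alnf; rewrite le_eqVlt => /predU1P[<-|t0] x.
  rewrite /log_sobolev_arg mulr0 !mul0r subr0 ltr01 ln1 mulr0 /entropy.
  rewrite !(P_0 hP); [by rewrite subrr addr0|exact: (A_bm hA)|].
  by apply: (A_bm hA); exact: (A_mul hA).
have FE : f = (fun y => expR (ln (f y))) by apply/funext => y; rewrite lnK // posrE.
have p0 : 0 < P t f x by rewrite FE; exact: (P_expR_gt0 hP hA _ Alnf (ltW t0)).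
have H k : 0 < k -> entropy P t f x <= t * L (P t f) x +
    n / 2 * P t f x * (k * log_sobolev_arg P n t f x - 1 - ln k).
  move=> k0; have := lls _ Alnf t k x t0 k0 f FE.
  by rewrite -addrA log_sobolev_rhs.
have np : 0 < n / 2 * P t f x by rewrite mulr_gt0 // divr_gt0.
have w0 : 0 < log_sobolev_arg P n t f x.
  rewrite ltNge; apply/negP => w0.
  (* With k = exp M the tangent inequality would read 0 <= - n/2 P_t f. *)
  pose M := (t * L (P t f) x - entropy P t f x) / (n / 2 * P t f x).
  have := H (expR M) (expR_gt0 M); rewrite expRK.
  have wM : expR M * log_sobolev_arg P n t f x <= 0 by rewrite pmulr_rle0 ?expR_gt0.
  have ME : n / 2 * P t f x * M = t * L (P t f) x - entropy P t f x.
    by rewrite /M mulrC divfK // gt_eqF.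
  set q := n / 2 * P t f x in np ME *.
  set w := expR M * _ in wM *.
  have -> : q * (w - 1 - M) = q * w - q - q * M by ring.
  rewrite ME; nra.
split=> //; have wi : 0 < (log_sobolev_arg P n t f x)^-1 by rewrite invr_gt0.
have := H _ wi; rewrite mulVf ?gt_eqF // subrr sub0r lnV ?posrE // opprK.
by [].
Qed.

End log_sobolev_converse.

(** * Norms along a path of exponents *)

Section hypercontractivity.
Context {d : measure_display} {E : measurableType d} {R : realType}
  {mu : {measure set E -> \bar R}} {P : R -> (E -> R) -> (E -> R)}
  {A : set (E -> R)} {n : R}.
Hypothesis hP : markov_semigroup mu P.
Hypothesis hA : nice_dense_algebra mu P A.
Hypothesis hD : diffusion P A.
Hypothesis n0 : 0 < n.
Implicit Types (f g : E -> R) (t s q : R).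

Local Notation L := (generator P).
Local Notation Gam := (carre_du_champ P).
Local Notation T := (@extended_semigroup d E R P).

(** The logarithm of the q-norm of f for the law P_u(., x). *)
Definition log_norm u q f x := q^-1 * ln (P u (fun y => expR (q * ln (f y))) x).

Lemma powRE (a q : R) : 0 < a -> a `^ q = expR (q * ln a).
Proof. by move=> a0; rewrite /powR gt_eqF. Qed.

Lemma norm_log_norm f (e : R) u q x : A f -> 0 < e -> (forall y, e <= f y) -> 0 <= u ->
  (P u (fun y => f y `^ q) x) `^ q^-1 = expR (log_norm u q f x).
Proof.
move=> Af e0 ef u0.
have -> : (fun y => f y `^ q) = (fun y => expR (q * ln (f y))).
  by apply/funext => y; rewrite powRE // (lt_le_trans e0).
rewrite powRE //; apply: (P_expR_gt0 hP hA) => //; apply: (A_scale hA); exact: (A_ln hA e0).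
Qed.

(** The condition on the derivatives is that q u + tau is constant to first order;
    it is what makes the terms in P_u (L F) collapse to - u P_u (L F). *)
Lemma log_norm_jet1 f (e : R) (u tau : R -> R) q u0 u1 tau0 tau1 x :
  A f -> 0 < e -> (forall y, e <= f y) -> q != 0 -> 0 < u0 -> 0 <= tau0 ->
  sjet1 u u0 u1 -> sjet1 tau tau0 tau1 -> tau1 + q * u1 = - u0 ->
  let h := fun y => q * ln (P tau0 f y) in
  let F := fun y => expR (h y) in
  sjet1 (fun r => log_norm (u r) (q + r) (T (tau r) f) x) (log_norm u0 q (P tau0 f) x)
    ((entropy P u0 F x - u0 * P u0 (L F) x + tau1 * (q - 1) * P u0 (fun y => F y * L h y) x)
      / (q ^+ 2 * P u0 F x)).
Proof.
move=> Af e0 ef q0 u0p t0 ju jtau constr h F.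
have [l [Al lE lnE]] := P_expR_form hP hA Af e0 ef t0.
have jT := T_jet1 hP hA Af t0 jtau.
have jl := jet1_ln e0 (fun y => P_lower_bound hP hA Af ef y t0) jT.
have jq : jet1 (fun r (_ : E) => q + r * 1 : R) (fun=> q) (fun=> 1) by exact: jet1_affine.
have jW := jet1_expR (jet1_mul jq jl).
pose g y := expR (l y).
pose v y := L l y + Gam l l y.
have hE : h = (fun y => q * l y) by apply/funext => y; rewrite /h lnE.
have Ag : A g by exact: (A_expR hA).
have AG := A_gamma hA Al Al.
have AL := A_L hA Al.
have Av : A v by exact: (A_add hA).
have Ah : A h by rewrite hE; exact: (A_scale hA).
have AF : A F by exact: (A_expR hA).
have gn y : g y != 0 by rewrite gt_eqF // expR_gt0.
have LE : P tau0 (L f) = L g by rewrite -(generator_P_comm hP hA) // lE.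
have LgE y : L g y = g y * v y by exact: (L_expR hD).
pose b y := F y * (l y + q * tau1 * v y).
have Ab : A b.
  by apply: (A_mul hA) => //; apply: (A_add hA) => //; exact: (A_scale hA).
have {}jW : jet1 (fun r y => expR ((q + r) * ln (T (tau r) f y))) F b.
  apply: jet1_eq jW => [r y|y|y]; first by rewrite mulr1.
    by [].
  rewrite /b /F LE lE /h lnE LgE expRK; congr (_ * _); rewrite -/(g y).
  by field; exact: gn.
have mW r : measurable_fun setT (fun y => expR ((q + r) * ln (T (tau r) f y))).
  apply: measurableT_comp; first exact: measurable_expR.
  apply: measurable_funM; first exact: measurable_cst.
  apply: measurableT_comp; first exact: measurable_ln.
  by apply: (measurable_A hA); exact: (A_T hA).
have jP := sjet1_at x (P_jet1 hP hA ju u0p mW AF Ab jW).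
have u0' := ltW u0p.
set p := P u0 F x in jP *.
have p0 : 0 < p by exact: (P_expR_gt0 hP hA).
have jlP := jet1_ln p0 (fun=> lexx p) jP.
have jqi : jet1 (fun r (_ : unit) => q + r * 1) (fun=> q) (fun=> 1) by exact: jet1_affine.
have qp : 0 < `|q| by rewrite normr_gt0.
have jqV := jet1_inv qp (fun=> lexx `|q|) jqi.
have := jet1_mul jqV jlP.
have lFE : (fun y => expR (q * ln (P tau0 f y))) = F by [].
apply: jet1_eq => [r _|_|_].
- by rewrite /log_norm mulr1.
- by rewrite /log_norm lFE.
(* Eliminating Gamma(l) leaves only averages that occur in the linear inequality. *)
have Gaml y : F y * v y * q = (q - 1) * (F y * L l y) + q^-1 * L F y.
  have -> : L F y = F y * (q * L l y + q ^+ 2 * Gam l l y).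
    rewrite (L_expR hD) // hE (L_scale hP hA) // (gamma_scale hP hA) //; last exact: (A_scale hA).
    by rewrite gamma_sym (gamma_scale hP hA) // /F hE; ring.
  by rewrite /v; field.
have ALF := A_L hA AF.
have AFl : A (fun y => F y * l y) by exact: (A_mul hA).
have AFL : A (fun y => F y * L l y) by exact: (A_mul hA).
have Pb : P u0 b x = P u0 (fun y => F y * l y) x +
   tau1 * ((q - 1) * P u0 (fun y => F y * L l y) x + q^-1 * P u0 (L F) x).
  have -> : b = (fun y => tau1 * ((q - 1) * (F y * L l y) + q^-1 * L F y) + F y * l y).
    by apply/funext => y; rewrite -Gaml /b; ring.
  rewrite (P_axpy hP) //; [|by apply: (A_bm hA); apply: (A_add hA); exact: (A_scale hA)|exact: (A_bm hA)].
  rewrite (P_axpy hP) //; [|exact: (A_bm hA)|by apply: (A_bm hA); exact: (A_scale hA)].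
  by rewrite (P_scale hP) //; [ring|exact: (A_bm hA)].
have ent : entropy P u0 F x = q * P u0 (fun y => F y * l y) x - p * ln p.
  rewrite /entropy -/p; congr (_ - _); rewrite -(P_scale hP) //; last exact: (A_bm hA).
  by congr (P u0 _ x); apply/funext => y; rewrite expRK hE; ring.
have FLh : P u0 (fun y => F y * L h y) x = q * P u0 (fun y => F y * L l y) x.
  rewrite -(P_scale hP) //; last exact: (A_bm hA).
  by congr (P u0 _ x); apply/funext => y; rewrite hE (L_scale hP hA) //; ring.
rewrite Pb ent FLh.
have uE : u0 = - tau1 - q * u1 by lra.
clear jP jlP ent.
move: p0 q0; move: p (P _ (fun y => F y * l y) x) (P _ (fun y => F y * L l y) x) (P _ (L F) x) (ln p).
by move=> p' a1 a2 a3 lp p0 q0; rewrite uE; field; rewrite q0 gt_eqF.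
Qed.

Lemma log_norm_derivative_le f (e : R) q u0 tau0 tau1 x : linear_log_sobolev P A n ->
  A f -> 0 < e -> (forall y, e <= f y) -> q != 0 -> 0 < u0 -> 0 <= tau0 ->
  let h := fun y => q * ln (P tau0 f y) in
  let F := fun y => expR (h y) in
  let k := tau1 * (q - 1) / u0 in
  0 < k ->
  (entropy P u0 F x - u0 * P u0 (L F) x + tau1 * (q - 1) * P u0 (fun y => F y * L h y) x)
      / (q ^+ 2 * P u0 F x) <= n / 2 * ((k - 1 - ln k) / q ^+ 2).
Proof.
move=> lls Af e0 ef q0 u0p t0 h F k k0.
have u0' := ltW u0p.
have Ah : A h.
  apply: (A_scale hA); apply: (A_ln hA e0); last exact: (A_P hA).
  by move=> y; exact: (P_lower_bound hP hA Af ef).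
have AF : A F by exact: (A_expR hA).
have p0 : 0 < P u0 F x by exact: (P_expR_gt0 hP hA).
have := lls h Ah u0 k x u0p k0 F erefl; rewrite (generator_P_comm hP hA) //.
have -> : k * u0 = tau1 * (q - 1) by rewrite /k divfK // gt_eqF.
have q2 : 0 < q ^+ 2 by rewrite exprn_even_gt0.
have q2p := mulr_gt0 q2 p0.
move=> H; rewrite ler_pdivrMr //.
have -> : n / 2 * ((k - 1 - ln k) / q ^+ 2) * (q ^+ 2 * P u0 F x) =
   n / 2 * P u0 F x * (k - 1 - ln k).
  by move: (ln k) (P u0 F x) => lk p; field.
lra.
Qed.

Section path.
Variables (al be c : R).

(** On the path, 1/u is affine in q and tau = c - q u; [path_k] is then
    tau' (q - 1) / u, and [path_phi] is a primitive of (k - 1 - ln k) / q^2. *)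
Definition path_u q : R := (al * q + be)^-1.
Definition path_tau q : R := c - q * path_u q.
Definition path_k q : R := - be * (q - 1) * path_u q.
Definition path_phi q : R := (q^-1 - 1) * ln (path_k q).

Lemma path_u_jet1 q : 0 < al * q + be ->
  sjet1 (fun r => path_u (q + r)) (path_u q) (- al * path_u q ^+ 2).
Proof.
move=> D0.
have J : jet1 (fun r (_ : unit) => (al * q + be) + r * al) (fun=> al * q + be) (fun=> al) by exact: jet1_affine.
have := jet1_inv D0 (fun=> ler_norm _) J; apply: jet1_eq => [r _|_|_] //.
  by rewrite /path_u; congr (_^-1); ring.
by rewrite /path_u exprVn.
Qed.

Lemma path_tau_jet1 q : 0 < al * q + be ->
  sjet1 (fun r => path_tau (q + r)) (path_tau q) (- be * path_u q ^+ 2).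
Proof.
move=> D0.
have jq : jet1 (fun r (_ : unit) => q + r * 1) (fun=> q) (fun=> 1) by exact: jet1_affine.
have jc : jet1 (fun r (_ : unit) => c + r * 0) (fun=> c) (fun=> 0) by exact: jet1_affine.
have := jet1_add jc (jet1_scale (-1) (jet1_mul jq (path_u_jet1 D0))).
apply: jet1_eq => [r _|_|_]; rewrite /path_tau; try ring.
by rewrite /path_u; field; rewrite gt_eqF.
Qed.

Lemma path_phi_jet1 q : q != 0 -> 0 < al * q + be -> 0 < path_k q ->
  sjet1 (fun r => path_phi (q + r)) (path_phi q) ((path_k q - 1 - ln (path_k q)) / q ^+ 2).
Proof.
move=> q0 D0 k0.
have jq : jet1 (fun r (_ : unit) => q + r * 1) (fun=> q) (fun=> 1) by exact: jet1_affine.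
have jk0 : jet1 (fun r (_ : unit) => - be * (q - 1) + r * (- be)) (fun=> - be * (q - 1)) (fun=> - be).
  exact: jet1_affine.
have jk := jet1_mul jk0 (path_u_jet1 D0).
have jl := jet1_ln k0 (fun=> lexx (path_k q)) jk.
have qp : 0 < `|q| by rewrite normr_gt0.
have jc : jet1 (fun r (_ : unit) => -1 + r * 0) (fun=> -1) (fun=> 0 : R) by exact: jet1_affine.
have jqi := jet1_inv qp (fun=> lexx `|q|) jq.
have := jet1_mul (jet1_add jqi jc) jl.
apply: jet1_eq => [r _|_|_].
- rewrite /path_phi /path_k mulr0 addr0 mulr1; congr (_ * ln _); ring.
- by rewrite /path_phi.
rewrite -/(path_k q).
have uq : path_u q != 0 by rewrite invr_eq0 gt_eqF.
have kn : path_k q != 0 by rewrite gt_eqF.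
have b0 : be != 0 by apply: contraNneq kn => z; rewrite /path_k z oppr0 !mul0r.
have q1 : q - 1 != 0 by apply: contraNneq kn => z; rewrite /path_k z mulr0 mul0r.
have alE : al = ((path_u q)^-1 - be) / q by rewrite /path_u invrK; field.
move: (ln (path_k q)) => lk; rewrite alE /path_k.
move: (path_u q) uq => U uq.
by field; rewrite q0 uq q1 b0.
Qed.

End path.

(** The difference H - n/2 [path_phi] has nonpositive derivative on the interval; its
    two-sided derivative exists at the end point tau = 0 thanks to the extended
    semigroup. *)
Lemma hypercontractive_monotone f (e : R) al be c a b x : linear_log_sobolev P A n ->
  A f -> 0 < e -> (forall y, e <= f y) -> a < b ->
  (forall q, a <= q -> q <= b ->
     [/\ q != 0, 0 < al * q + be, 0 < path_k al be q & 0 <= path_tau al be c q]) ->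
  log_norm (path_u al be b) b (P (path_tau al be c b) f) x
    - log_norm (path_u al be a) a (P (path_tau al be c a) f) x
  <= n / 2 * (path_phi al be b - path_phi al be a).
Proof.
move=> lls Af e0 ef ab H.
pose G q := log_norm (path_u al be q) q (T (path_tau al be c q) f) x
   + - (n / 2) * path_phi al be q.
have dG q : a <= q -> q <= b -> exists2 D, D <= 0 & sjet1 (fun r => G (q + r)) (G q) D.
  move=> aq qb; have [q0 D0 k0 t0] := H q aq qb.
  have up : 0 < path_u al be q by rewrite invr_gt0.
  have constr : - be * path_u al be q ^+ 2 + q * (- al * path_u al be q ^+ 2) = - path_u al be q.
    by rewrite /path_u; field; rewrite gt_eqF.
  have j1 := log_norm_jet1 x Af e0 ef q0 up t0 (path_u_jet1 D0) (path_tau_jet1 c D0) constr.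
  have j2 := path_phi_jet1 q0 D0 k0.
  have kE : - be * path_u al be q ^+ 2 * (q - 1) / path_u al be q = path_k al be q.
    by rewrite /path_k; field; rewrite gt_eqF.
  have := @log_norm_derivative_le f e q _ _ (- be * path_u al be q ^+ 2) x lls Af e0 ef q0 up t0.
  rewrite /= kE => /(_ k0) le.
  have J := sjet1_add j1 (sjet1_scale (- (n / 2)) j2).
  eexists; last by rewrite /G (extended_semigroupE f t0); exact: J.
  by rewrite [- (n / 2) * _]mulNr subr_le0.
suff : G b <= G a.
  have [_ _ _ ta] := H a (lexx a) (ltW ab); have [_ _ _ tb] := H b (ltW ab) (lexx b).
  by rewrite /G !extended_semigroupE //; lra.
apply: (@ler0_derive1_le_cc _ G a b) => //.
- by move=> q; rewrite in_itv /= => /andP[aq qb]; have [D _ /sjet1_is_derive[]] := dG q (ltW aq) (ltW qb).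
- move=> q; rewrite in_itv /= => /andP[aq qb]; have [D D0 /sjet1_is_derive[_ dD]] := dG q (ltW aq) (ltW qb).
  by rewrite derive1E dD.
- apply: derivable_within_continuous => q; rewrite in_itv /= => /andP[aq qb].
  by have [D _ /sjet1_is_derive[]] := dG q aq qb.
- by rewrite in_itv /= lexx ltW.
- by rewrite in_itv /= lexx ltW.
- exact: ltW.
Qed.

End hypercontractivity.

(** * Hypercontractivity with the optimal path *)

Section constants.
Context {R : realType}.
Implicit Types q u : R.

(** The logarithm of the hypercontractive constant, and the opposite of that of the
    reverse constant; m is the mean slope of tau between q1 and q2. *)
Definition log_hyper_cst q1 q2 u1 u2 : R :=
  let m := (u1 * q1 - u2 * q2) / (q2 - q1) in
  (q2^-1 - 1) * ln ((q2 - 1) / u1 * m) - (q1^-1 - 1) * ln ((q1 - 1) / u2 * m).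

Lemma hypercontractivity_cstE q1 q2 u1 u2 : 1 < q1 -> q1 < q2 -> 0 < u1 -> 0 < u2 ->
  0 < u1 * q1 - u2 * q2 ->
  hypercontractivity_cst q1 q2 u1 u2 = expR (log_hyper_cst q1 q2 u1 u2).
Proof.
move=> h1 h2 p1 p2 t0; rewrite /hypercontractivity_cst /log_hyper_cst.
have m0 : 0 < (u1 * q1 - u2 * q2) / (q2 - q1) by rewrite divr_gt0 // subr_gt0.
have k1 : 0 < (q1 - 1) / u2 by rewrite divr_gt0 // subr_gt0.
have k2 : 0 < (q2 - 1) / u1 by rewrite divr_gt0 // subr_gt0 (lt_trans h1).
rewrite !powRE // -!expRD (lnM (x := (q2 - 1) / u1)) ?posrE // (lnM (x := (q1 - 1) / u2)) ?posrE //.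
by congr expR; move: (ln _) (ln _) (ln _) => a b c; ring.
Qed.

Lemma reverse_hypercontractivity_cstE q1 q2 u1 u2 : q1 < 1 -> q2 < q1 -> 0 < u1 -> 0 < u2 ->
  0 < u1 * q1 - u2 * q2 ->
  reverse_hypercontractivity_cst q1 q2 u1 u2 = expR (- log_hyper_cst q1 q2 u1 u2).
Proof.
move=> h1 h2 p1 p2 t0; rewrite /reverse_hypercontractivity_cst /log_hyper_cst.
have m0 : 0 < (u1 * q1 - u2 * q2) / (q1 - q2) by rewrite divr_gt0 // subr_gt0.
have k1 : 0 < (1 - q1) / u2 by rewrite divr_gt0 // subr_gt0.
have k2 : 0 < (1 - q2) / u1 by rewrite divr_gt0 // subr_gt0 (lt_trans h2).
have E q u : (q - 1) / u * ((u1 * q1 - u2 * q2) / (q2 - q1)) =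
    (1 - q) / u * ((u1 * q1 - u2 * q2) / (q1 - q2)).
  by rewrite -(opprB q2 q1) -(opprB q 1) invrN; ring.
rewrite !E !powRE // -!expRD (lnM (x := (1 - q2) / u1)) ?posrE // (lnM (x := (1 - q1) / u2)) ?posrE //.
by congr expR; move: (ln _) (ln _) (ln _) => a b c; ring.
Qed.

Section path_endpoints.
Variables (q1 q2 u1 u2 : R).
Hypotheses (p1 : 0 < u1) (p2 : 0 < u2) (q12 : q2 - q1 != 0).
Hypothesis t0 : 0 < u1 * q1 - u2 * q2.

Definition path_al := (u2^-1 - u1^-1) / (q2 - q1).
Definition path_be := u1^-1 - path_al * q1.

Let u1n : u1 != 0. Proof. by rewrite gt_eqF. Qed.
Let u2n : u2 != 0. Proof. by rewrite gt_eqF. Qed.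

Lemma path_u_start : path_u path_al path_be q1 = u1.
Proof. by rewrite /path_u /path_be addrC subrK invrK. Qed.

Lemma path_u_end : path_u path_al path_be q2 = u2.
Proof.
rewrite /path_u (_ : _ + _ = u2^-1) ?invrK // /path_be /path_al.
by field; rewrite u1n u2n q12.
Qed.

Lemma path_tau_start : path_tau path_al path_be (u1 * q1) q1 = 0.
Proof. by rewrite /path_tau path_u_start mulrC subrr. Qed.

Lemma path_tau_end : path_tau path_al path_be (u1 * q1) q2 = u1 * q1 - u2 * q2.
Proof. by rewrite /path_tau path_u_end (mulrC q2). Qed.

Lemma path_beE : path_be = - ((u1 * q1 - u2 * q2) / (q2 - q1)) / (u1 * u2).
Proof. by rewrite /path_be /path_al; field; rewrite u1n u2n q12. Qed.

Lemma path_phiE : path_phi path_al path_be q2 - path_phi path_al path_be q1 =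
  log_hyper_cst q1 q2 u1 u2.
Proof.
rewrite /path_phi /log_hyper_cst; congr (_ * ln _ - _ * ln _).
  by rewrite /path_k path_u_end path_beE; field; rewrite u1n u2n q12.
by rewrite /path_k path_u_start path_beE; field; rewrite u1n u2n q12.
Qed.

(** With theta = (q - q1) / (q2 - q1), the affine function 1/u is the convex
    combination of 1/u1 and 1/u2, and tau is a nonnegative multiple of theta.
    The hypothesis on q - 1 covers both exponents above 1 and increasing, and
    exponents below 1 and decreasing. *)
Lemma path_conditions q : 0 <= (q - q1) / (q2 - q1) <= 1 -> 0 < (q - 1) / (q2 - q1) ->
  [/\ 0 < path_al * q + path_be, 0 < path_k path_al path_be q &
      0 <= path_tau path_al path_be (u1 * q1) q].
Proof.
set th := (q - q1) / (q2 - q1) => /andP[th0 th1] kq.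
have DE : path_al * q + path_be = (1 - th) / u1 + th / u2.
  by rewrite /path_be /path_al /th; field; rewrite u1n u2n q12.
have i1 : 0 < u1^-1 by rewrite invr_gt0.
have i2 : 0 < u2^-1 by rewrite invr_gt0.
have D0 : 0 < path_al * q + path_be by rewrite DE; nra.
have up : 0 < path_u path_al path_be q by rewrite invr_gt0.
split=> //.
  rewrite /path_k mulr_gt0 // path_beE.
  have -> : - (- ((u1 * q1 - u2 * q2) / (q2 - q1)) / (u1 * u2)) * (q - 1) =
    (q - 1) / (q2 - q1) * ((u1 * q1 - u2 * q2) / (u1 * u2)).
    by field; rewrite u1n u2n q12.
  by rewrite mulr_gt0 // divr_gt0 // mulr_gt0.
rewrite /path_tau.
have -> : u1 * q1 - q * path_u path_al path_be q =
   ((u1 * q1) * (path_al * q + path_be) - q) * path_u path_al path_be q.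
  by rewrite mulrBl -[_ * _ * path_u _ _ _]mulrA mulfV ?mulr1 // gt_eqF.
rewrite pmulr_lge0 // DE.
have -> : u1 * q1 * ((1 - th) / u1 + th / u2) - q = th * ((u1 * q1 - u2 * q2) / u2).
  by rewrite /th; field; rewrite u1n u2n q12.
by rewrite mulr_ge0 // divr_ge0 // ltW.
Qed.

End path_endpoints.

(** Raised to the power q, the hypothesis becomes
    (X / M)^q <= (1 + l)^q a + (l^2 + l)^q, whose right side tends to a. *)
Lemma powR_limit (X a M q : R) : 0 <= X -> 0 <= a -> 0 < M -> 0 < q ->
  (forall l, 0 < l -> l < 1 ->
     X <= ((1 + l) `^ q * a + (l ^+ 2 + l) `^ q) `^ q^-1 * M) ->
  X <= a `^ q^-1 * M.
Proof.
move=> X0 a0 M0 q0 H; have qi : 0 < q^-1 by rewrite invr_gt0.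
have XM0 : 0 <= X / M by rewrite divr_ge0 // ltW.
have pK (y : R) : 0 <= y -> (y `^ q^-1) `^ q = y.
  by move=> y0; rewrite -powRrM mulVf ?gt_eqF // powRr1.
have pK' (y : R) : 0 <= y -> (y `^ q) `^ q^-1 = y.
  by move=> y0; rewrite -powRrM mulfV ?gt_eqF // powRr1.
have le_pow (r y z : R) : 0 <= r -> 0 <= y -> y <= z -> y `^ r <= z `^ r.
  by move=> r0 y0 yz; apply: ge0_ler_powR => //; rewrite nnegrE // (le_trans y0).
rewrite -ler_pdivrMr // -(pK' _ XM0); apply: (le_pow _); [exact: ltW|exact: powR_ge0|].
set Y := (X / M) `^ q.
have {}H l : 0 < l -> l < 1 -> Y <= (1 + l) `^ q * a + (l ^+ 2 + l) `^ q.
  move=> l0 l1; have := H l l0 l1; rewrite -ler_pdivrMr // => le.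
  have s0 : 0 <= (1 + l) `^ q * a + (l ^+ 2 + l) `^ q.
    by rewrite addr_ge0 // ?mulr_ge0 // powR_ge0.
  by rewrite -[leRHS]pK //; apply: (le_pow _) => //; exact: ltW.
rewrite leNgt; apply/negP => aY.
(* For l small enough both errors are at most eta, and a + eta (a + 1) < Y. *)
pose eta := (Y - a) / (2 * (a + 1)).
have eta0 : 0 < eta by rewrite divr_gt0 ?subr_gt0 // mulr_gt0 //; lra.
have e1 : 1 < (1 + eta) `^ q^-1.
  have one : 1 `^ q^-1 = 1 :> R by rewrite powR1.
  rewrite -[ltLHS]one; apply: gt0_ltr_powR => //; rewrite ?nnegrE //; lra.
have e2 : 0 < eta `^ q^-1 by exact: powR_gt0.
pose l := Num.min (1 / 2) (Num.min ((1 + eta) `^ q^-1 - 1) (eta `^ q^-1 / 2)).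
have l0 : 0 < l.
  by rewrite !lt_min subr_gt0 e1 !divr_gt0.
have la : l <= 1 / 2 by rewrite ge_min lexx.
have lb : l <= (1 + eta) `^ q^-1 - 1 by rewrite !ge_min lexx !orbT.
have lc : l <= eta `^ q^-1 / 2 by rewrite !ge_min lexx !orbT.
have h1 : (1 + l) `^ q <= 1 + eta.
  rewrite -[leRHS]pK; last lra.
  by apply: (le_pow _); [exact: ltW|lra|lra].
have h2 : (l ^+ 2 + l) `^ q <= eta.
  rewrite -[leRHS]pK; last exact: ltW.
  by apply: (le_pow _); [exact: ltW|nra|nra].
have := H l l0 (ltac:(lra)).
have ea : eta * (2 * (a + 1)) = Y - a by rewrite /eta divfK // gt_eqF // mulr_gt0 //; lra.
have : (1 + l) `^ q * a <= (1 + eta) * a by rewrite ler_wpM2r.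
lra.
Qed.

(** If y >= l then y + l^2 <= (1 + l) y; otherwise y + l^2 <= l^2 + l. *)
Lemma powR_shift_le (y l q : R) : 0 <= y -> 0 < l -> 0 < q ->
  (y + l ^+ 2) `^ q <= (1 + l) `^ q * y `^ q + (l ^+ 2 + l) `^ q.
Proof.
move=> y0 l0 q0.
have le_pow (z w : R) : 0 <= z -> z <= w -> z `^ q <= w `^ q.
  by move=> z0 zw; apply: ge0_ler_powR; rewrite ?nnegrE ?(ltW q0) // (le_trans z0).
have l2 : 0 <= l ^+ 2 by rewrite sqr_ge0.
case: (leP l y) => ly.
  rewrite -powRM //; last lra.
  apply: (@le_trans _ _ (((1 + l) * y) `^ q)); last by rewrite lerDl powR_ge0.
  by apply: (le_pow _); [lra|rewrite expr2; nra].
apply: (@le_trans _ _ ((l ^+ 2 + l) `^ q)); last first.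
  by rewrite lerDr mulr_ge0 // powR_ge0.
by apply: (le_pow _); lra.
Qed.

End constants.

Section hypercontractivity_equivalence.
Context {d : measure_display} {E : measurableType d} {R : realType}
  {mu : {measure set E -> \bar R}} {P : R -> (E -> R) -> (E -> R)}
  {A : set (E -> R)} {n : R}.
Hypothesis hP : markov_semigroup mu P.
Hypothesis hA : nice_dense_algebra mu P A.
Hypothesis hD : diffusion P A.
Hypothesis n0 : 0 < n.
Implicit Types (f g : E -> R) (t s q : R).

Local Notation L := (generator P).
Local Notation Gam := (carre_du_champ P).
Local Notation T := (@extended_semigroup d E R P).
Local Notation log_norm := (@log_norm d E R P).

Lemma log_hypercontractivity f (e : R) q1 q2 u1 u2 x : linear_log_sobolev P A n ->
  A f -> 0 < e -> (forall y, e <= f y) -> 1 < q1 -> q1 < q2 -> 0 < u1 -> 0 < u2 ->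
  0 < u1 * q1 - u2 * q2 ->
  log_norm u2 q2 (P (u1 * q1 - u2 * q2) f) x - log_norm u1 q1 f x
    <= n / 2 * log_hyper_cst q1 q2 u1 u2.
Proof.
move=> lls Af e0 ef h1 h2 p1 p2 t0.
have q12 : q2 - q1 != 0 by rewrite gt_eqF // subr_gt0.
have := @hypercontractive_monotone _ _ _ _ _ _ n hP hA hD f e (path_al q1 q2 u1 u2)
  (path_be q1 q2 u1 u2) (u1 * q1) q1 q2 x lls Af e0 ef h2.
rewrite path_phiE // path_u_start // path_u_end // path_tau_start // path_tau_end //.
rewrite (P0_eq hP hA Af); apply=> q qa qb.
have i0 : 0 < (q2 - q1)^-1 by rewrite invr_gt0 subr_gt0.
have [] := @path_conditions R q1 q2 u1 u2 p1 p2 q12 t0 q.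
- apply/andP; split; first by rewrite mulr_ge0 ?subr_ge0 // ltW.
  by rewrite ler_pdivrMr ?subr_gt0 // mul1r lerD2r.
- by rewrite mulr_gt0 // subr_gt0 (lt_le_trans h1).
by split=> //; rewrite gt_eqF // (lt_le_trans _ qa) // (lt_trans _ h1).
Qed.

Lemma log_reverse_hypercontractivity f (e : R) q1 q2 u1 u2 x : linear_log_sobolev P A n ->
  A f -> 0 < e -> (forall y, e <= f y) ->
  (0 < q2 /\ q2 < q1 /\ q1 < 1) \/ (q2 < q1 /\ q1 < 0) -> 0 < u1 -> 0 < u2 ->
  0 < u1 * q1 - u2 * q2 ->
  log_norm u1 q1 f x - log_norm u2 q2 (P (u1 * q1 - u2 * q2) f) x
    <= - (n / 2 * log_hyper_cst q1 q2 u1 u2).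
Proof.
move=> lls Af e0 ef hq p1 p2 t0.
have h2 : q2 < q1 by case: hq => [[_ []]|[]].
have h1 : q1 < 1 by case: hq => [[_ []]//|[_ h]]; exact: lt_trans h ltr01.
have q12 : q2 - q1 != 0 by rewrite lt_eqF // subr_lt0.
have := @hypercontractive_monotone _ _ _ _ _ _ n hP hA hD f e (path_al q1 q2 u1 u2)
  (path_be q1 q2 u1 u2) (u1 * q1) q2 q1 x lls Af e0 ef h2.
have -> : - (n / 2 * log_hyper_cst q1 q2 u1 u2) =
    n / 2 * (path_phi (path_al q1 q2 u1 u2) (path_be q1 q2 u1 u2) q1
           - path_phi (path_al q1 q2 u1 u2) (path_be q1 q2 u1 u2) q2).
  by rewrite -(path_phiE p1 p2 q12); ring.
rewrite path_u_start // path_u_end // path_tau_start // path_tau_end //.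
rewrite (P0_eq hP hA Af); apply=> q qa qb.
have i0 : 0 < (q1 - q2)^-1 by rewrite invr_gt0 subr_gt0.
have iN : (q2 - q1)^-1 = - (q1 - q2)^-1 by rewrite -invrN opprB.
have [] := @path_conditions R q1 q2 u1 u2 p1 p2 q12 t0 q.
- rewrite iN mulrN -mulNr opprB; apply/andP; split; first by rewrite mulr_ge0 ?subr_ge0 // ltW.
  by rewrite ler_pdivrMr ?subr_gt0 // mul1r lerD2l lerN2.
- by rewrite iN mulrN -mulNr opprB mulr_gt0 // subr_gt0 (le_lt_trans qb).
split=> //; case: hq => [[q20 _]|[_ q10]].
  by rewrite gt_eqF // (lt_le_trans q20).
by rewrite lt_eqF // (le_lt_trans qb).
Qed.

Lemma bm_powR f q : bounded_measurable f -> (forall y, 0 <= f y) -> 0 <= q ->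
  bounded_measurable (fun y => f y `^ q).
Proof.
move=> [mf [C HC]] f0 q0; split.
  by apply: (measurableT_comp (f := fun z : R => z `^ q)) => //; exact: measurable_powR.
exists (C `^ q) => y; rewrite ger0_norm ?powR_ge0 //; apply: ge0_ler_powR => //.
- by rewrite nnegrE.
- by rewrite nnegrE (le_trans _ (HC y)).
- exact: le_trans (ler_norm _) (HC y).
Qed.

Lemma P_powR_shift_le u q g l x : 0 <= u -> 0 < q -> 0 < l -> bounded_measurable g ->
  (forall y, 0 <= g y) ->
  P u (fun y => (g y + l ^+ 2) `^ q) x <= (1 + l) `^ q * P u (fun y => g y `^ q) x + (l ^+ 2 + l) `^ q.
Proof.
move=> u0 q0 l0 bg g0.
have bgq := bm_powR bg g0 (ltW q0).
rewrite -[X in _ + X](P_cst hP _ x u0) -(P_axpy hP) //.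
apply: (P_le hP) => //; first apply: bm_powR.
- by apply: bm_add.
- by move=> y; rewrite addr_ge0 // sqr_ge0.
- exact: ltW.
- by apply: bm_add => //; exact: bm_scale.
- by move=> y; exact: powR_shift_le.
Qed.

Lemma P_powR_mono u q f g x : 0 <= u -> 0 < q -> bounded_measurable f -> bounded_measurable g ->
  (forall y, 0 <= f y) -> (forall y, f y <= g y) ->
  (P u (fun y => f y `^ q) x) `^ q^-1 <= (P u (fun y => g y `^ q) x) `^ q^-1.
Proof.
move=> u0 q0 bf bg f0 fg.
have g0 y : 0 <= g y by rewrite (le_trans _ (fg y)).
have bfq := bm_powR bf f0 (ltW q0); have bgq := bm_powR bg g0 (ltW q0).
have pp h : bounded_measurable (fun y => h y `^ q) -> 0 <= P u (fun y => h y `^ q) x.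
  by move=> bh; apply: (P_ge0 hP) => // y; exact: powR_ge0.
apply: ge0_ler_powR; rewrite ?nnegrE ?invr_ge0 ?(ltW q0) ?pp //.
apply: (P_le hP) => // y; apply: ge0_ler_powR; rewrite ?nnegrE ?(ltW q0) //.
Qed.

Lemma P_powR_shift_norm_le u q g l x : 0 <= u -> 0 < q -> 0 < l -> bounded_measurable g ->
  (forall y, 0 <= g y) ->
  (P u (fun y => (g y + l ^+ 2) `^ q) x) `^ q^-1 <=
  ((1 + l) `^ q * P u (fun y => g y `^ q) x + (l ^+ 2 + l) `^ q) `^ q^-1.
Proof.
move=> u0 q0 l0 bg g0; have le := P_powR_shift_le x u0 q0 l0 bg g0.
have pos : 0 <= P u (fun y => (g y + l ^+ 2) `^ q) x.
  apply: (P_ge0 hP) => //; last by move=> y; exact: powR_ge0.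
  by apply: bm_powR => //; [exact: bm_add|move=> y; rewrite addr_ge0 ?sqr_ge0|exact: ltW].
by apply: ge0_ler_powR; rewrite ?nnegrE ?invr_ge0 ?(ltW q0) // (le_trans pos).
Qed.

(** Functions that are not bounded away from 0 are reached through f + l^2 as l tends
    to 0. *)
Theorem linear_log_sobolev_hypercontractivity :
  linear_log_sobolev P A n -> local_hypercontractivity P A n.
Proof.
move=> lls q1 q2 u1 u2 h1 h2 p1 p2 tau t0 f Af fp x.
have q10 : 0 < q1 by rewrite (lt_trans ltr01).
have q20 : 0 < q2 by rewrite (lt_trans q10).
have bf := A_bm hA Af.
have f0 y : 0 <= f y by rewrite ltW.
have t0' := ltW t0; have p1' := ltW p1; have p2' := ltW p2.
rewrite hypercontractivity_cstE // -expRM.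
apply: powR_limit => //; first exact: powR_ge0.
- by apply: (P_ge0 hP) => //; [exact: bm_powR (ltW q10)|move=> y; exact: powR_ge0].
- exact: expR_gt0.
move=> l l0 l1.
have Afl : A (fun y => f y + l ^+ 2) by apply: (A_add hA) => //; exact: (A_cst hA).
have l2 : 0 < l ^+ 2 by rewrite exprn_gt0.
have fle y : l ^+ 2 <= f y + l ^+ 2 by rewrite lerDr.
have key := log_hypercontractivity x lls Afl l2 fle h1 h2 p1 p2 t0.
have Ptl y : l ^+ 2 <= P tau (fun y => f y + l ^+ 2) y.
  by apply: (P_ge_cst hP) => //; exact: (A_bm hA).
apply: (@le_trans _ _ ((P u2 (fun y => P tau (fun y => f y + l ^+ 2) y `^ q2) x) `^ q2^-1)).
  apply: P_powR_mono => //.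
  - exact: (P_bm hP).
  - by apply: (P_bm hP) => //; exact: (A_bm hA).
  - by move=> y; exact: (P_ge0 hP).
  - by move=> y; apply: (P_le hP) => //; [exact: (A_bm hA)|move=> z; rewrite lerDl ltW].
rewrite (norm_log_norm hP hA _ _ (A_P hA t0' Afl) l2 Ptl p2').
apply: (@le_trans _ _ ((P u1 (fun y => (f y + l ^+ 2) `^ q1) x) `^ q1^-1 *
    expR (log_hyper_cst q1 q2 u1 u2 * (n / 2)))); last first.
  by rewrite ler_wpM2r ?expR_ge0 //; exact: P_powR_shift_norm_le.
rewrite (norm_log_norm hP hA _ _ Afl l2 fle p1') -expRD ler_expR.
rewrite -/tau in key; rewrite (mulrC _ (n / 2)) -lerBlDl; exact: key.
Qed.

(** For negative exponents the boundedness of f^q1 bounds f away from 0; for positive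
    exponents f + l^2 is used, and the perturbation is on the right side. *)
Theorem linear_log_sobolev_reverse_hypercontractivity :
  linear_log_sobolev P A n -> local_reverse_hypercontractivity P A n.
Proof.
move=> lls q1 q2 u1 u2 hq p1 p2 tau t0 f Af fp bfq x.
have bf := A_bm hA Af.
have f0 y : 0 <= f y by rewrite ltW.
have t0' := ltW t0; have p1' := ltW p1; have p2' := ltW p2.
have h2 : q2 < q1 by case: hq => [[_ []]|[]].
have h1 : q1 < 1 by case: hq => [[_ []]//|[_ h]]; exact: lt_trans h ltr01.
rewrite reverse_hypercontractivity_cstE // -expRM.
have main g (e : R) : A g -> 0 < e -> (forall y, e <= g y) ->
    (P u1 (fun y => g y `^ q1) x) `^ q1^-1 <=
    (P u2 (fun y => P tau g y `^ q2) x) `^ q2^-1 * expR (- log_hyper_cst q1 q2 u1 u2 * (n / 2)).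
  move=> Ag e0 eg.
  have key := log_reverse_hypercontractivity x lls Ag e0 eg hq p1 p2 t0.
  have Pg y : e <= P tau g y by apply: (P_ge_cst hP) => //; exact: (A_bm hA).
  rewrite (norm_log_norm hP hA _ _ Ag e0 eg p1').
  rewrite (norm_log_norm hP hA _ _ (A_P hA t0' Ag) e0 Pg p2') -expRD ler_expR.
  by rewrite -lerBlDl mulNr (mulrC _ (n / 2)).
case: (hq) => [[q20 [_ _]]|[_ q10]]; last first.
  (* f^q1 <= B and q1 < 0 give f >= exp (ln B / q1). *)
  have [B B1 HB] := bounded_fct_ge1 bfq.2.
  have B0 : 0 < B by exact: lt_le_trans ltr01 B1.
  apply: (main f (expR (ln B / q1)) Af (expR_gt0 _)) => y.
  rewrite -[leRHS]lnK ?posrE // ler_expR ler_ndivrMr // mulrC.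
  rewrite -ler_expR lnK ?posrE // -powRE //.
  exact: le_trans (ler_norm _) (HB y).
have q10 : 0 < q1 by rewrite (lt_trans q20).
apply: powR_limit => //; first exact: powR_ge0.
- apply: (P_ge0 hP) => //; last by move=> y; exact: powR_ge0.
  apply: bm_powR (ltW q20); first exact: (P_bm hP).
  by move=> y; exact: (P_ge0 hP).
- exact: expR_gt0.
move=> l l0 l1.
have Afl : A (fun y => f y + l ^+ 2) by apply: (A_add hA) => //; exact: (A_cst hA).
have l2 : 0 < l ^+ 2 by rewrite exprn_gt0.
have fle y : l ^+ 2 <= f y + l ^+ 2 by rewrite lerDr.
apply: (@le_trans _ _ ((P u1 (fun y => (f y + l ^+ 2) `^ q1) x) `^ q1^-1)).
  apply: P_powR_mono => //; first exact: (A_bm hA).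
  by move=> y; rewrite lerDl ltW.
apply: le_trans (main _ _ Afl l2 fle) _; rewrite ler_wpM2r ?expR_ge0 //.
have -> : P tau (fun y => f y + l ^+ 2) = (fun y => P tau f y + l ^+ 2).
  by apply/funext => y; rewrite (P_add hP) // (P_cst hP).
apply: P_powR_shift_norm_le => //; first exact: (P_bm hP).
by move=> y; exact: (P_ge0 hP).
Qed.

End hypercontractivity_equivalence.

(** * From hypercontractivity back to the logarithmic Sobolev inequality *)

Section converse.
Context {d : measure_display} {E : measurableType d} {R : realType}
  {mu : {measure set E -> \bar R}} {P : R -> (E -> R) -> (E -> R)}
  {A : set (E -> R)} {n : R}.
Hypothesis hP : markov_semigroup mu P.
Hypothesis hA : nice_dense_algebra mu P A.
Hypothesis hD : diffusion P A.
Hypothesis n0 : 0 < n.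
Implicit Types (f g : E -> R) (t s q : R).

Local Notation L := (generator P).
Local Notation T := (@extended_semigroup d E R P).
Local Notation log_norm := (@log_norm d E R P).

Section tangent_path.
Variables (q t m : R).
Hypotheses (q0 : q != 0) (t0 : 0 < t) (k0 : 0 < m * (q - 1)).

(** The path tau = m r leaving (q, t) at constant speed, with u determined by
    (q + r) u + tau = q t. *)
Definition tangent_u r := (t * q - m * r) / (q + r).

(** The logarithm of the constant between (q, t) and (q + r, u), with the mean slope
    of tau replaced by its value m so that it makes sense at r = 0. *)
Definition tangent_cst r : R :=
  ((q + r)^-1 - 1) * ln ((q + r - 1) / t * m) - (q^-1 - 1) * ln ((q - 1) / tangent_u r * m).

Lemma tangent_u_jet1 : sjet1 tangent_u t (- (m + t) / q).
Proof.
have jq : jet1 (fun r (_ : unit) => q + r * 1) (fun=> q) (fun=> 1) by exact: jet1_affine.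
have jn : jet1 (fun r (_ : unit) => t * q + r * (- m)) (fun=> t * q) (fun=> - m) by exact: jet1_affine.
have qp : 0 < `|q| by rewrite normr_gt0.
have := jet1_mul jn (jet1_inv qp (fun=> lexx `|q|) jq).
apply: jet1_eq => [r _|_|_]; first by rewrite /tangent_u mulrN mulr1 (mulrC m).
  by rewrite mulfK.
by field.
Qed.

Lemma tangent_cst_jet1 :
  let k := m * (q - 1) / t in
  sjet1 tangent_cst 0 ((k - 1 - ln k) / q ^+ 2).
Proof.
move=> k; have kp : 0 < k by rewrite divr_gt0.
have tn : t != 0 by rewrite gt_eqF.
have jq : jet1 (fun r (_ : unit) => q + r * 1) (fun=> q) (fun=> 1) by exact: jet1_affine.
have jc : jet1 (fun r (_ : unit) => -1 + r * 0) (fun=> -1) (fun=> 0 : R) by exact: jet1_affine.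
have qp : 0 < `|q| by rewrite normr_gt0.
have jqi := jet1_add (jet1_inv qp (fun=> lexx `|q|) jq) jc.
have j1 : jet1 (fun r (_ : unit) => k + r * (m / t)) (fun=> k) (fun=> m / t) by exact: jet1_affine.
have jl1 := jet1_ln kp (fun=> lexx k) j1.
have tp : 0 < `|t| by rewrite normr_gt0.
have j2 := jet1_scale (m * (q - 1)) (jet1_inv tp (fun=> lexx `|t|) tangent_u_jet1).
have jl2 := jet1_ln kp (fun=> lexx k) j2.
have := jet1_add (jet1_mul jqi jl1) (jet1_scale (- (q^-1 - 1)) jl2).
have mq : m != 0 by apply: contraTneq k0 => ->; rewrite mul0r ltxx.
have q1 : q - 1 != 0 by apply: contraTneq k0 => ->; rewrite mulr0 ltxx.
apply: jet1_eq => [r _|_|_].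
- rewrite /tangent_cst mulr0 addr0 mulr1 mulNr; congr (_ * ln _ - _ * ln _).
    by rewrite /k; field.
  by ring.
- by rewrite -/k; ring.
rewrite -/k; move: (ln k) => lk; rewrite /k.
by field; rewrite q0 q1 mq tn.
Qed.

Lemma tangent_tau r : q + r != 0 -> t * q - tangent_u r * (q + r) = m * r.
Proof. by move=> qr; rewrite /tangent_u divfK //; ring. Qed.

Lemma tangent_cstE r : q + r != 0 -> r != 0 ->
  tangent_cst r = log_hyper_cst q (q + r) t (tangent_u r).
Proof.
move=> qr rn; rewrite /tangent_cst /log_hyper_cst tangent_tau //.
by have -> : m * r / (q + r - q) = m by rewrite addrAC subrr add0r mulfK.
Qed.

End tangent_path.

(** The inequality between q and q + r is an equality at r = 0, so it can be
    differentiated there.  The sign sgn selects r > 0, for exponents above 1, or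
    r < 0, for exponents below 1; dividing by r, the two cases give the same
    inequality between derivatives. *)
Lemma linear_log_sobolev_of_tangent h t k x q (sgn : R) : A h -> 0 < t -> 0 < k ->
  q != 0 -> q - 1 != 0 -> sgn ^+ 2 = 1 ->
  let m := k * t / (q - 1) in
  let f := fun y => expR (q^-1 * h y) in
  let G := fun r => log_norm (tangent_u q t m r) (q + r) (T (m * r) f) x
                    + - (n / 2) * tangent_cst q t m r in
  (exists C : R, 1 <= C /\ forall r, 0 < r -> C * r <= 1 -> sgn * G (sgn * r) <= sgn * G 0) ->
  forall F, F = (fun y => expR (h y)) ->
  entropy P t F x <= t * L (P t F) x - k * t * P t (fun y => F y * L h y) x
    + n / 2 * P t F x * (k - 1 - ln k).
Proof.
move=> Ah t0 k0 q0 q1 sgn2 m f G HG F FE; have t0' := ltW t0.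
have Aqh : A (fun y => q^-1 * h y) by exact: (A_scale hA).
have Af : A f by exact: (A_expR hA).
have [lo [e0 fge]] := expR_lower_bound hA Aqh.
have mE : m * (q - 1) = k * t by rewrite /m divfK.
have k0' : 0 < m * (q - 1) by rewrite mE mulr_gt0.
have ju := tangent_u_jet1 t m q0.
have jtau : sjet1 (fun r => m * r) 0 m.
  by apply: jet1_eq (@jet1_affine R unit 0 m) => // r _; rewrite add0r mulrC.
have constr : m + q * (- (m + t) / q) = - t by field.
have j1 := log_norm_jet1 hP hA hD x Af e0 fge q0 t0 (lexx 0) ju jtau constr.
have hE : (fun y => q * ln (P 0 f y)) = h.
  by apply/funext => y; rewrite (P0_eq hP hA Af) /f expRK mulrA mulfV // mul1r.
have j2 := tangent_cst_jet1 q0 t0 k0'.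
rewrite mE mulfK ?gt_eqF // in j2.
have JG := sjet1_add j1 (sjet1_scale (- (n / 2)) j2).
rewrite -/G in JG.
have G0 := sjet1_value JG; set D := (X in sjet1 _ _ X) in JG.
rewrite -G0 in JG.
have Js : sjet1 (fun r => sgn * G (sgn * r)) (sgn * G 0) D.
  have sn : `|sgn| = 1.
    by apply/eqP; rewrite -(@eqrXn2 _ 2) // real_normK ?num_real // sgn2 expr1n.
  case: JG => _ _ O; split; try exact: bounded_fct_cst.
  have O' : unifO 2 (fun r (_ : unit) => G (sgn * r) - (G 0 + sgn * r * D)).
    apply: (unifO_comp (r := fun r => sgn * r) O).
    by exists 1; split=> // r _; rewrite normrM sn.
  have := unifO_mul (unifO0 (bounded_fct_cst sgn)) O'.
  apply: unifO_eq => r _.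
  have -> : r * D = sgn ^+ 2 * (r * D) by rewrite sgn2 mul1r.
  by ring.
have D0 := sjet1_le0 Js HG.
move: D0; rewrite /D.
have fF : (fun y => expR (q * ln (P 0 f y))) = F.
  by rewrite FE; apply/funext => y; rewrite -[in RHS]hE.
have fFL : (fun y => expR (q * ln (P 0 f y)) * L h y) = (fun y => F y * L h y).
  by rewrite -fF.
rewrite fF hE fFL.
have AF : A F by rewrite FE; exact: (A_expR hA).
have p0 : 0 < P t F x by rewrite FE; exact: (P_expR_gt0 hP hA).
have q2 : 0 < q ^+ 2 by rewrite exprn_even_gt0.
have qp := mulr_gt0 q2 p0.
rewrite mE mulNr subr_le0 ler_pdivrMr // (generator_P_comm hP hA) //.
have -> : n / 2 * ((k - 1 - ln k) / q ^+ 2) * (q ^+ 2 * P t F x) =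
   n / 2 * P t F x * (k - 1 - ln k).
  by move: (ln k) (P t F x) => lk p; field.
by move=> H; lra.
Qed.

Lemma tangent_near q t m : q != 0 -> 0 < t ->
  exists C : R, 1 <= C /\ forall r, C * `|r| <= 1 ->
    0 < tangent_u q t m r /\ `|r| <= `|q| / 4.
Proof.
move=> q0 t0; have [C [C1 H]] := sjet1_pos (tangent_u_jet1 t m q0) t0.
have qp : 0 < `|q| by rewrite normr_gt0.
have qi : 0 < (`|q| / 4)^-1 by rewrite invr_gt0 divr_gt0.
exists (C + (`|q| / 4)^-1); split=> [|r hr]; first lra.
have r0 : 0 <= `|r| by [].
split; first by apply: H; nra.
have : (`|q| / 4)^-1 * `|r| <= 1 by nra.
by rewrite ler_pdivrMl ?mulr1 // divr_gt0.
Qed.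

Theorem hypercontractivity_linear_log_sobolev :
  local_hypercontractivity P A n -> linear_log_sobolev P A n.
Proof.
move=> hyp h Ah t k x t0 k0.
have q0 : 2 != 0 :> R by [].
have q1 : 2 - 1 != 0 :> R by have -> : 2 - 1 = 1 :> R by ring.
apply: (@linear_log_sobolev_of_tangent h t k x 2 1) => //; first by rewrite expr1n.
set m := k * t / (2 - 1); pose f := fun y => expR (2^-1 * h y); rewrite -/f.
have mE : m = k * t by rewrite /m; field.
have m0 : 0 < m by rewrite mE mulr_gt0.
have [C [C1 H]] := tangent_near m q0 t0.
exists C; split=> // r r0 rC; rewrite !mul1r.
have [] := H r; first by rewrite gtr0_norm.
set u2 := tangent_u 2 t m r => u20 _.
have Aqh : A (fun y => 2^-1 * h y) by exact: (A_scale hA).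
have Af : A f by exact: (A_expR hA).
have [lo [e0 fge]] := expR_lower_bound hA Aqh.
have fp y : 0 < f y by exact: expR_gt0.
have qr : 2 + r != 0 by rewrite gt_eqF // addr_gt0.
have tauE := tangent_tau t m qr; rewrite -/u2 in tauE.
have tau0 : 0 < t * 2 - u2 * (2 + r) by rewrite tauE mulr_gt0.
have h1 : 1 < 2 :> R by rewrite ltr1n.
have h2 : 2 < 2 + r by rewrite ltrDl.
have := hyp 2 (2 + r) t u2 h1 h2 t0 u20 tau0 f Af fp x.
have Pf y : lo <= P (t * 2 - u2 * (2 + r)) f y.
  by apply: (P_ge_cst hP) => //; [exact: ltW|exact: (A_bm hA)].
rewrite (norm_log_norm hP hA _ _ Af e0 fge (ltW t0)).
rewrite (norm_log_norm hP hA _ _ (A_P hA (ltW tau0) Af) e0 Pf (ltW u20)).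
rewrite hypercontractivity_cstE // -expRM -expRD ler_expR.
have rn : r != 0 by rewrite gt_eqF.
have cE := tangent_cstE t m qr rn; rewrite -/u2 in cE.
rewrite -cE tauE.
have m0' : 0 <= m * r by rewrite mulr_ge0 // ltW.
rewrite extended_semigroupE // mulr0 extended_semigroupE // addr0 (P0_eq hP hA Af).
have u00 : tangent_u 2 t m 0 = t by exact: sjet1_value (tangent_u_jet1 t m q0).
have k0' : 0 < m * (2 - 1) by rewrite mE; have := mulr_gt0 k0 t0; lra.
have c00 : tangent_cst 2 t m 0 = 0 by exact: sjet1_value (tangent_cst_jet1 q0 t0 k0').
rewrite u00 c00 mulr0 addr0 -/u2; lra.
Qed.

Theorem reverse_hypercontractivity_linear_log_sobolev :
  local_reverse_hypercontractivity P A n -> linear_log_sobolev P A n.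
Proof.
move=> hyp h Ah t k x t0 k0.
pose q : R := 1 / 2.
have qE : q = 1 / 2 by [].
have q0 : q != 0 by rewrite gt_eqF // qE; lra.
have q1 : q - 1 != 0 by rewrite lt_eqF // qE; lra.
apply: (@linear_log_sobolev_of_tangent h t k x q (-1)) => //; first by rewrite sqrrN expr1n.
set m := k * t / (q - 1); pose f := fun y => expR (q^-1 * h y); rewrite -/f.
have mE : m * (q - 1) = k * t by rewrite /m divfK.
have k0' : 0 < m * (q - 1) by rewrite mE mulr_gt0.
have m0 : m < 0 by move: k0'; rewrite qE; lra.
have [C [C1 H]] := tangent_near m q0 t0.
exists C; split=> // r r0 rC; rewrite !mulN1r.
have [] := H (- r); first by rewrite normrN gtr0_norm.
set u2 := tangent_u q t m (- r) => u20; rewrite normrN gtr0_norm // ger0_norm; last by rewrite qE; lra.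
move=> rq.
have Aqh : A (fun y => q^-1 * h y) by exact: (A_scale hA).
have Af : A f by exact: (A_expR hA).
have [lo [e0 fge]] := expR_lower_bound hA Aqh.
have fp y : 0 < f y by exact: expR_gt0.
have qr0 : 0 < q - r by rewrite qE in rq *; lra.
have qr : q - r != 0 by rewrite gt_eqF.
have tauE := tangent_tau t m qr; rewrite -/u2 in tauE.
have mr : 0 < m * - r by rewrite mulrN -mulNr mulr_gt0 // oppr_gt0.
have tau0 : 0 < t * q - u2 * (q - r) by rewrite tauE.
have h1 : q < 1 by rewrite qE; lra.
have h2 : q - r < q by lra.
have bfq : bounded_measurable (fun y => f y `^ q).
  by apply: (bm_powR (A_bm hA Af)) => [y|]; [exact: ltW|rewrite qE; lra].
have := hyp q (q - r) t u2 (or_introl (conj qr0 (conj h2 h1))) t0 u20 tau0 f Af fp bfq x.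
have Pf y : lo <= P (t * q - u2 * (q - r)) f y.
  by apply: (P_ge_cst hP) => //; [exact: ltW|exact: (A_bm hA)].
rewrite (norm_log_norm hP hA _ _ Af e0 fge (ltW t0)).
rewrite (norm_log_norm hP hA _ _ (A_P hA (ltW tau0) Af) e0 Pf (ltW u20)).
rewrite reverse_hypercontractivity_cstE // -expRM -expRD ler_expR.
have rn : - r != 0 by rewrite oppr_eq0 gt_eqF.
have cE := tangent_cstE t m qr rn; rewrite -/u2 in cE.
rewrite -cE tauE.
have mr' := ltW mr.
rewrite extended_semigroupE // mulr0 extended_semigroupE // addr0 (P0_eq hP hA Af).
have u00 : tangent_u q t m 0 = t by exact: sjet1_value (tangent_u_jet1 t m q0).
have c00 : tangent_cst q t m 0 = 0 by exact: sjet1_value (tangent_cst_jet1 q0 t0 k0').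
rewrite u00 c00 mulr0 addr0 -/u2; lra.
Qed.

End converse.

(** * The equivalence *)

Theorem theorem4p1 (d : measure_display) (E : measurableType d) (R : realType)
    (mu : {measure set E -> \bar R}) (P : R -> (E -> R) -> (E -> R))
    (A : set (E -> R)) (n : R)
    (n_ge1 : 1 <= n)
    (P_markov : markov_semigroup mu P)
    (A_nice : nice_dense_algebra mu P A)
    (P_diffusion : diffusion P A) :
  (CD0 P A n <-> local_log_sobolev P A n) /\
  (CD0 P A n <-> local_hypercontractivity P A n) /\
  (CD0 P A n <-> local_reverse_hypercontractivity P A n).
Proof.
have n0 : 0 < n by exact: lt_le_trans ltr01 n_ge1.
have cd_lls : CD0 P A n <-> linear_log_sobolev P A n.
  split; first exact: (CD0_linear_log_sobolev P_markov A_nice P_diffusion n0).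
  exact: (linear_log_sobolev_CD0 P_markov A_nice P_diffusion n0).
split; [|split]; rewrite cd_lls; split.
- exact: (linear_to_local_log_sobolev P_markov A_nice n0).
- exact: (local_to_linear_log_sobolev P_markov A_nice n0).
- exact: (linear_log_sobolev_hypercontractivity P_markov A_nice P_diffusion).
- exact: (hypercontractivity_linear_log_sobolev P_markov A_nice P_diffusion).
- exact: (linear_log_sobolev_reverse_hypercontractivity P_markov A_nice P_diffusion).
- exact: (reverse_hypercontractivity_linear_log_sobolev P_markov A_nice P_diffusion).
Qed.
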